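(* Let $P=(a_1,\dots,a_k)\in\mathcal P$, let $(z_{-1},z_0,\dots,z_m)=\Delta(P)$ and let $$P^*=(\underbrace{1,\dots,1}_{z_{-1}},\underbrace{e,\dots,e}_{z_0},\underbrace{e\ell,\dots,e\ell}_{z_1},\dots,\underbrace{e\ell^m,\dots,e\ell^m}_{z_m}).$$ Then $P^*$ is equivalent to a standard parabolic subgroup contained in $P$. Moreover, $$\nu_\ell([P:B])=s_0z_0+\cdots+s_mz_m=\nu_\ell([P^*:B])\quad\text{and}\quad N(P)=N(P^* ).$$
   Context: Let $n\ge 2$ and $G=\mathrm{GL}_n(q)$, the general linear group over the finite field $F_q$ of characteristic $p$. Let $\ell\ne p$ be a prime, and let $R$ be a local principal ideal domain of characteristic $0$ with maximal ideal $\ell R$, containing a primitive $p$-th root of unity; $R^*$ is its unit group and $K=R/\ell R$. Modules are left modules. $\nu_\ell$ denotes the $\ell$-adic valuation of integers. $B$ is the group of upper triangular matrices in $G$ and $U$ the group of upper unitriangular matrices; $S_n$ is viewed as the subgroup of permutation matrices of $G$; $\widehat{S}=\sum_{s\in S}s\in RG$ for $S\subseteq G$. Put $\varepsilon=\sum_{\sigma\in S_n}\mathrm{sg}(\sigma)\,\sigma\widehat{B}\in RG$. The Steinberg lattice is the left ideal $I=RG\cdot\varepsilon$, and $L=I/\ell I$, a $KG$-module. Let $f:I\times I\to R$ be the restriction to $I$ of the $R$-bilinear form on $RG$ given by $(g,h)\mapsto\delta_{g,h}$ for $g,h\in G$, scaled by $1/|B|$ (it takes values in $R$). For $c\ge 0$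 put $I(c)=\{x\in I : f(x,I)\subseteq \ell^cR\}$, $L(c)=(I(c)+\ell I)/\ell I$ and $M(c)=L(c)/L(c+1)$. $\mathcal P$ is the set of standard parabolic subgroups (subgroups of $G$ containing $B$). A composition $(a_1,\dots,a_k)$ of $n$ is identified with the block upper triangular subgroup with diagonal blocks of sizes $a_1,\dots,a_k$; this gives a bijection between compositions of $n$ and $\mathcal P$. Two members of $\mathcal P$ are equivalent if their compositions are rearrangements of each other. For a group homomorphism $\lambda:U\to R^*$, let $P(\lambda)\in\mathcal P$ be the subgroup generated by $B$ and the transpositions $(i,i+1)$, $1\le i<n$, such that $\lambda$ is non-trivial on $X_{i,i+1}=\{I_n+aE^{i,i+1} : a\in F_q\}$. Put $E_\lambda=\sum_{u\in U}\lambda(u)u\varepsilon\in I$ and $F_\lambda=E_\lambda+\ell I\in L$. For $P\in\mathcal P$ with $c=\nu_\ell([G:P])$, define $N(P)=KG\cdot(F_\lambda+L(c+1))\subseteq M(c)$ for any $\lambda$ with $P(\lambda)=P$ (such $\lambda$ exist, $F_\lambda\in L(c)$, and $N(P)$ does not depend on the choice). If $\nu_\ell([G:P])=\nu_\ell([G:Q])$, then $N(P),N(Q)$ are submodules of the same $M(c)$. Let $e=\min\{i\ge 2 : \ell \mid \frac{q^i-1}{q-1}\}$, $d=\nu_\ell\big(\frac{q^e-1}{q-1}\big)$, and $m=\max\{i\ge 0 : \ell^i\le\lfloor n/e\rfloor\}$ (with $m=0$ if $n<e$). Define $s_0=d$ and $s_{i+1}=\ell s_i+1$, i.e. $s_1=\ell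 d+1$, $s_2=\ell^2d+\ell+1$, $s_3=\ell^3d+\ell^2+\ell+1,\dots$. For $1\le a\le n$ put $\Delta(a)=(y_{-1},y_0,\dots,y_m)$, where $0\le y_{-1}<e$, $0\le y_i<\ell$ for $0\le i\le m$, and $a=y_{-1}+e(y_0+y_1\ell+\cdots+y_m\ell^m)$. For $P=(a_1,\dots,a_k)$ put $\Delta(P)=\Delta(a_1)+\cdots+\Delta(a_k)$ (componentwise sum). *)

(* Defs.v *)
From HB Require Import structures.
From mathcomp Require Import all_boot all_order all_fingroup all_algebra.
From mathcomp Require Import generic_quotient ring_quotient fraction boolp.

Set Implicit Arguments.
Unset Strict Implicit.
Unset Printing Implicit Defensive.

Import GRing.Theory.

Local Open Scope ring_scope.
Local Open Scope quotient_scope.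

Section Submodules.
Variables (A : pzRingType) (V : lmodType A).

(* A v, the submodule generated by v; for V = A^o, a principal left ideal. *)
Definition cyclic_sub (v : V) : {pred V} := fun x => `[< exists a : A, x = a *: v >].

Lemma cyclic_sub_closed v : submod_closed (cyclic_sub v).
Proof.
split; first by apply/asboolP; exists 0; rewrite scale0r.
move=> a _ _ /asboolP[b ->] /asboolP[c ->]; apply/asboolP; exists (a * b + c).
by rewrite scalerDl scalerA.
Qed.
HB.instance Definition _ v :=
  GRing.isSubmodClosed.Build A V (cyclic_sub v) (cyclic_sub_closed v).

Definition muln_sub (l : nat) : {pred V} := fun x => `[< exists y : V, x = y *+ l >].

Lemma muln_sub_closed l : submod_closed (muln_sub l).
Proof.
split; first by apply/asboolP; exists 0; rewrite mul0rn.
move=> a _ _ /asboolP[x ->] /asboolP[y ->]; apply/asboolP; exists (a *: x + y).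
by rewrite mulrnDl scalerMnr.
Qed.
HB.instance Definition _ l :=
  GRing.isSubmodClosed.Build A V (muln_sub l) (muln_sub_closed l).

End Submodules.

Section QuotientModule.
Variables (A : pzRingType) (V : lmodType A) (S : submodClosed V).

(* A submodClosed predicate is declared closed under sums and scaling only, while
   Quotient.quot expects declared closure under opposites. *)
Definition zmod_pred : {pred V} := S.

Lemma zmod_pred_closed : zmod_closed zmod_pred.
Proof.
split=> [|x y xS yS]; first exact: (rpred0 S).
by rewrite -[- y]scaleN1r /zmod_pred (rpredD (S := S)) // (rpredZ (s := S)).
Qed.
HB.instance Definition _ := GRing.isZmodClosed.Build V zmod_pred zmod_pred_closed.

Definition quotmod : Type := Quotient.quot zmod_pred.
HB.instance Definition _ := Choice.on quotmod.
HB.instance Definition _ := EqQuotient.on quotmod.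
HB.instance Definition _ := GRing.Zmodule.on quotmod.
HB.instance Definition _ := ZmodQuotient.on quotmod.

Definition quotmod_scale (a : A) (x : quotmod) : quotmod := \pi_quotmod (a *: repr x).

Lemma quotmod_eqP (x y : V) : reflect (x = y %[mod quotmod]) (x - y \in S).
Proof.
by apply: (iffP idP); rewrite -[_ \in S]/(_ \in zmod_pred) Quotient.idealrBE => /eqP.
Qed.

Lemma quotmod_pi_scale a x : quotmod_scale a (\pi_quotmod x) = \pi_quotmod (a *: x).
Proof.
apply/quotmod_eqP; rewrite -scalerBr rpredZ //.
by apply/quotmod_eqP; rewrite reprK.
Qed.

Lemma quotmod_scaleA a b x :
  quotmod_scale a (quotmod_scale b x) = quotmod_scale (a * b) x.
Proof. by rewrite {2}/quotmod_scale quotmod_pi_scale scalerA. Qed.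
Lemma quotmod_scale1 : left_id 1 quotmod_scale.
Proof. by move=> x; rewrite /quotmod_scale scale1r reprK. Qed.
Lemma quotmod_scaleDr : right_distributive quotmod_scale +%R.
Proof.
move=> a x y; rewrite -[x]reprK -[y]reprK -raddfD !quotmod_pi_scale.
by rewrite scalerDr raddfD.
Qed.
Lemma quotmod_scaleDl x : {morph quotmod_scale^~ x : a b / a + b}.
Proof. by move=> a b; rewrite /quotmod_scale scalerDl raddfD. Qed.

HB.instance Definition _ := GRing.Zmodule_isLmodule.Build A quotmod
  quotmod_scaleA quotmod_scale1 quotmod_scaleDr quotmod_scaleDl.

End QuotientModule.

Section GroupAlgebra.
Variables (R : comPzRingType) (gT : finGroupType).

(* An element of R[gT] is its coefficient function; the product is the convolution,
   not the pointwise product carried by {ffun gT -> R}. *)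
Definition galg : Type := {ffun gT -> R^o}.
HB.instance Definition _ := Choice.on galg.
HB.instance Definition _ := GRing.Zmodule.on galg.
HB.instance Definition _ := GRing.Lmodule.on galg.

Definition coefg (x : galg) : gT -> R := (x : {ffun gT -> R^o}).
Definition galg_of (c : gT -> R) : galg := [ffun g => c g : R^o].

Lemma galg_ofE c g : coefg (galg_of c) g = c g.
Proof. by rewrite /coefg ffunE. Qed.
Lemma galgP (x y : galg) : coefg x =1 coefg y -> x = y.
Proof. by move=> xy; apply/ffunP. Qed.
Lemma coefgD (x y : galg) g : coefg (x + y) g = coefg x g + coefg y g.
Proof. by rewrite /coefg ffunE. Qed.
Lemma coefgB (x y : galg) g : coefg (x - y) g = coefg x g - coefg y g.
Proof. by rewrite /coefg !ffunE. Qed.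
Lemma coefgZ a (x : galg) g : coefg (a *: x) g = a * coefg x g.
Proof. by rewrite /coefg !ffunE. Qed.
Lemma coefgMn (x : galg) k g : coefg (x *+ k) g = coefg x g *+ k.
Proof. by elim: k => [|k IH]; [rewrite /coefg ffunE | rewrite !mulrS coefgD IH]. Qed.

Definition galg1 : galg := galg_of (fun g => (g == 1%g)%:R).
Definition galg_mul (x y : galg) : galg :=
  galg_of (fun g => \sum_h coefg x h * coefg y (h^-1 * g)%g).

Lemma galg_mulA : associative galg_mul.
Proof.
move=> x y z; apply: galgP => g; rewrite !galg_ofE.
under eq_bigr => h _ do rewrite galg_ofE mulr_sumr.
under [RHS]eq_bigr => h _ do rewrite galg_ofE mulr_suml.
rewrite [RHS]exchange_big /=; apply: eq_bigr => h _.
rewrite [RHS](reindex_inj (mulgI h)) /=; apply: eq_bigr => k _.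
by rewrite mulrA mulKg invMg mulgA.
Qed.
Lemma galg_mul1 : left_id galg1 galg_mul.
Proof.
move=> x; apply: galgP => g; rewrite galg_ofE (bigD1 1%g) //= big1 ?addr0.
  by rewrite galg_ofE eqxx mul1r invg1 mul1g.
by move=> h /negPf h1; rewrite galg_ofE h1 mul0r.
Qed.
Lemma galg_mulr1 : right_id galg1 galg_mul.
Proof.
move=> x; apply: galgP => g; rewrite galg_ofE (bigD1 g) //= big1 ?addr0.
  by rewrite galg_ofE mulVg eqxx mulr1.
by move=> h /negPf h1; rewrite galg_ofE -eq_mulVg1 h1 mulr0.
Qed.
Lemma galg_mulDl : left_distributive galg_mul +%R.
Proof.
move=> x y z; apply: galgP => g; rewrite coefgD !galg_ofE -big_split /=.
by apply: eq_bigr => h _; rewrite coefgD mulrDl.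
Qed.
Lemma galg_mulDr : right_distributive galg_mul +%R.
Proof.
move=> x y z; apply: galgP => g; rewrite coefgD !galg_ofE -big_split /=.
by apply: eq_bigr => h _; rewrite coefgD mulrDr.
Qed.

HB.instance Definition _ := GRing.Zmodule_isPzRing.Build galg
  galg_mulA galg_mul1 galg_mulr1 galg_mulDl galg_mulDr.

Definition gbase (g : gT) : galg := galg_of (fun h => (h == g)%:R).
Lemma gbaseM g h : gbase g * gbase h = gbase (g * h)%g.
Proof.
apply: galgP => k; rewrite !galg_ofE (bigD1 g) //= big1 ?addr0 => [|u /negPf ug].
  by rewrite !galg_ofE eqxx mul1r -(can_eq (mulKg g)) mulKVg.
by rewrite galg_ofE ug mul0r.
Qed.

Definition hat (S : {set gT}) : galg := \sum_(s in S) gbase s.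

End GroupAlgebra.

Section ResidueRing.
Variables (R : comPzRingType) (l : nat).

Definition residue : Type := quotmod (@muln_sub R R^o l).
HB.instance Definition _ := Choice.on residue.
HB.instance Definition _ := EqQuotient.on residue.
HB.instance Definition _ := GRing.Zmodule.on residue.
HB.instance Definition _ := ZmodQuotient.on residue.

Definition residue1 : residue := \pi_residue 1.
Definition residue_mul (x y : residue) : residue := \pi_residue (repr x * repr y).

Lemma residue_eqP (x y : R) : (exists z : R, x - y = z *+ l) <-> x = y %[mod residue].
Proof.
split=> [xy|/(quotmod_eqP (@muln_sub R R^o l))/asboolP//].
by apply/(quotmod_eqP (@muln_sub R R^o l))/asboolP.
Qed.

Lemma residue_pi_mul (x y : R) : residue_mul (\pi_residue x) (\pi_residue y) = \pi_residue (x * y).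
Proof.
apply/residue_eqP; set x' := repr _; set y' := repr _.
have [u ux] : exists z : R, x' - x = z *+ l by apply/residue_eqP; rewrite reprK.
have [v vy] : exists z : R, y' - y = z *+ l by apply/residue_eqP; rewrite reprK.
exists (u * y' + x * v); rewrite mulrnDl -mulrnAl -mulrnAr -ux -vy.
by rewrite mulrBl mulrBr addrA subrK.
Qed.

Lemma residue_mulA : associative residue_mul.
Proof.
move=> x y z; rewrite -[x]reprK -[y]reprK -[z]reprK. 
rewrite (residue_pi_mul (repr y)) (residue_pi_mul (repr x) (_ * _)).
by rewrite (residue_pi_mul (repr x) (repr y)) (residue_pi_mul (_ * _)) mulrA.
Qed.
Lemma residue_mulC : commutative residue_mul.
Proof. by move=> x y; rewrite /residue_mul mulrC. Qed.
Lemma residue_mul1 : left_id residue1 residue_mul.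
Proof. by move=> x; rewrite -[x]reprK residue_pi_mul mul1r reprK. Qed.
Lemma residue_mulDl : left_distributive residue_mul +%R.
Proof.
move=> x y z; rewrite -[x]reprK -[y]reprK -[z]reprK -raddfD !residue_pi_mul.
by rewrite mulrDl raddfD.
Qed.
HB.instance Definition _ := GRing.Zmodule_isComPzRing.Build residue
  residue_mulA residue_mulC residue_mul1 residue_mulDl.

End ResidueRing.

Section ResidueModule.
Variables (R : comPzRingType) (gT : finGroupType) (l : nat).
Variable V : lmodType (galg R gT).

Local Notation K := (residue R l).

Definition galg_red (r : galg R gT) : galg K gT := galg_of (fun g => \pi_K (coefg r g)).
Definition galg_lift (a : galg K gT) : galg R gT := galg_of (fun g => repr (coefg a g)).

Lemma galg_liftK : cancel galg_lift galg_red.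
Proof. by move=> a; apply: galgP => g; rewrite !galg_ofE reprK. Qed.

Lemma galg_red_eq r s : galg_red r = galg_red s -> exists t, r - s = t *+ l.
Proof.
move=> rs; have /choice[c cE] g : exists z : R, coefg r g - coefg s g = z *+ l.
  by apply/residue_eqP; have := congr1 (fun x => coefg x g) rs; rewrite !galg_ofE.
exists (galg_of c); apply: galgP => g.
by rewrite coefgB coefgMn galg_ofE cE.
Qed.

(* V / lV as a module over K[gT]: a scalar acts through any lift of it to R[gT]. *)
Definition resmod : Type := quotmod (@muln_sub _ V l).
HB.instance Definition _ := Choice.on resmod.
HB.instance Definition _ := EqQuotient.on resmod.
HB.instance Definition _ := GRing.Zmodule.on resmod.
HB.instance Definition _ := ZmodQuotient.on resmod.

Definition resmod_scale (a : galg K gT) (x : resmod) : resmod :=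
  \pi_resmod (galg_lift a *: repr x).

Lemma resmod_eqP (x y : V) : (exists z : V, x - y = z *+ l) <-> x = y %[mod resmod].
Proof.
split=> [xy|/(quotmod_eqP (@muln_sub _ V l))/asboolP//].
by apply/(quotmod_eqP (@muln_sub _ V l))/asboolP.
Qed.

Lemma resmod_pi_scale r x :
  resmod_scale (galg_red r) (\pi_resmod x) = \pi_resmod (r *: x).
Proof.
apply/resmod_eqP; set x' := repr _.
have [u ux] : exists z : V, x' - x = z *+ l by apply/resmod_eqP; rewrite reprK.
have [t tr] := galg_red_eq (galg_liftK (galg_red r)).
exists (t *: x' + r *: u).
rewrite mulrnDl scalerMnl -tr scalerMnr -ux scalerBl scalerBr.
by rewrite addrA subrK.
Qed.

Lemma resmod_scaleA a b x : resmod_scale a (resmod_scale b x) = resmod_scale (a * b) x.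
Proof.
rewrite -[x]reprK -[a]galg_liftK -[b]galg_liftK; set r := galg_lift a; set s := galg_lift b.
have -> : galg_red r * galg_red s = galg_red (r * s).
  apply: galgP => g; rewrite !galg_ofE raddf_sum; apply: eq_bigr => h _.
  by rewrite !galg_ofE; apply: (residue_pi_mul l).
by rewrite (resmod_pi_scale s) (resmod_pi_scale r) (resmod_pi_scale (r * s)) scalerA.
Qed.
Lemma resmod_scale1 : left_id 1 resmod_scale.
Proof.
move=> x; rewrite -{1}[x]reprK; have -> : 1 = galg_red 1.
  by apply: galgP => g; rewrite !galg_ofE; case: (g == 1%g); rewrite ?raddf0.
by rewrite resmod_pi_scale scale1r reprK.
Qed.
Lemma resmod_scaleDr : right_distributive resmod_scale +%R.
Proof.
move=> a x y; rewrite -[x]reprK -[y]reprK -[a]galg_liftK -raddfD.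
rewrite (resmod_pi_scale _ (repr x)) (resmod_pi_scale _ (repr y)).
by rewrite (resmod_pi_scale _ (_ + _)) scalerDr raddfD.
Qed.
Lemma resmod_scaleDl x : {morph resmod_scale^~ x : a b / a + b}.
Proof.
move=> a b; rewrite -[x]reprK -[a]galg_liftK -[b]galg_liftK.
set r := galg_lift a; set s := galg_lift b.
have -> : galg_red r + galg_red s = galg_red (r + s).
  by apply: galgP => g; rewrite coefgD [RHS]galg_ofE coefgD raddfD !galg_ofE.
by rewrite (resmod_pi_scale r) (resmod_pi_scale s) (resmod_pi_scale (r + s)) scalerDl raddfD.
Qed.
HB.instance Definition _ := GRing.Zmodule_isLmodule.Build (galg K gT) resmod
  resmod_scaleA resmod_scale1 resmod_scaleDr resmod_scaleDl.

End ResidueModule.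

Section Ideals.
Variable R : comNzRingType.
Implicit Type J : R -> Prop.

Definition is_ideal J :=
  [/\ J 0, forall x y, J x -> J y -> J (x + y) & forall a x, J x -> J (a * x)].

Definition maximal_ideal J :=
  [/\ is_ideal J, ~ J 1 &
      forall J', is_ideal J' -> (forall x, J x -> J' x) ->
        (forall x, J' x -> J x) \/ J' 1].

Definition principal_ideal_ring :=
  forall J, is_ideal J -> exists a, forall x, J x <-> exists r, x = r * a.

Definition local_with_maximal (l : nat) :=
  forall J, maximal_ideal J <-> forall x, J x <-> exists r, x = l%:R * r.

End Ideals.

(* {'GL_n[F]} consists of matrices of size n.-1.+1, which is n as soon as n > 0. *)
Section Subgroups.
Variables (F : finFieldType) (n : nat).
Local Notation gT := {'GL_n[F]}.

Definition borel : {set gT} :=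
  [set g : gT | [forall i : 'I_n.-1.+1, forall j : 'I_n.-1.+1, (j < i)%N ==> (val g i j == 0)]].

Definition unitri : {set gT} := [set g in borel | [forall i, val g i i == 1]].

Definition permGL (s : 'S_n.-1.+1) : gT := FinRing.Unit (unitmx_perm F s : perm_mx s \is a GRing.unit).

Definition root_set (i j : 'I_n.-1.+1) : {set gT} :=
  [set g : gT | [exists a, val g == 1%:M + a *: delta_mx i j]].

Definition is_composition (a : seq nat) := (sumn a == n) && (0 \notin a).

(* reshape_index a i is the position in a of the block containing the index i. *)
Definition parab (a : seq nat) : {set gT} :=
  [set g : gT | [forall i : 'I_n.-1.+1, forall j : 'I_n.-1.+1,
     (reshape_index a j < reshape_index a i)%N ==> (val g i j == 0)]].

Lemma parabP a (g : gT) :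
  reflect (forall i j : 'I_n.-1.+1, (reshape_index a j < reshape_index a i)%N -> val g i j = 0)
          (g \in parab a).
Proof.
rewrite inE; apply: (iffP forallP) => [gP i j ij|gP i].
  by have /forallP/(_ j)/implyP/(_ ij)/eqP := gP i.
by apply/forallP => j; apply/implyP => ij; rewrite gP.
Qed.

Lemma parab_group_set a : group_set (parab a).
Proof.
apply/group_setP; split=> [|g h /parabP gP /parabP hP]; apply/parabP => i j ij.
  by rewrite mxE; case: eqP ij => // ->; rewrite ltnn.
rewrite mxE big1 // => k _.
have [ik|ki] := leqP (reshape_index a i) (reshape_index a k).
  by rewrite (hP k j (leq_trans ij ik)) mulr0.
by rewrite (gP i k ki) mul0r.
Qed.
Canonical parab_group a := Group (parab_group_set a).

Definition standard_parabolic (P : {group gT}) := borel \subset P.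

Definition par_equiv (P Q : {set gT}) :=
  exists a b : seq nat, [/\ is_composition a, is_composition b,
    P = parab a, Q = parab b & perm_eq a b].

Section LinearCharacters.
Variables (R : comUnitRingType).

(* lam restricts to a homomorphism from U to the unit group of R; its values
   outside U are irrelevant below. *)
Definition unitri_char (lam : gT -> R) :=
  {in unitri, forall u, lam u \is a GRing.unit} /\
  {in unitri &, {morph lam : u v / (u * v)%g >-> u * v}}.

Definition char_parab (lam : gT -> R) : {group gT} :=
  <<borel :|: [set permGL (tperm ij.1 ij.2) | ij : 'I_n.-1.+1 * 'I_n.-1.+1
     & (ij.2 == ij.1.+1 :> nat) && [exists x in root_set ij.1 ij.2, lam x != 1%R]]>>%G.

End LinearCharacters.

End Subgroups.

Section Steinberg.
Variables (F : finFieldType) (n : nat) (R : idomainType) (l : nat).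
Local Notation gT := {'GL_n[F]}.
Local Notation RG := (galg R gT).
Local Notation K := (residue R l).

Definition steinberg_gen : RG :=
  \sum_(s : 'S_n.-1.+1) (-1) ^+ s *: (gbase R (permGL F s) * hat R (borel F n)).

Record steinberg : Type := Steinberg {
  steinberg_val : RG^o;
  _ : steinberg_val \in cyclic_sub (steinberg_gen : RG^o) }.
HB.instance Definition _ := [isSub for steinberg_val].
HB.instance Definition _ := [Choice of steinberg by <:].
HB.instance Definition _ := [SubChoice_isSubLmodule of steinberg by <:].

Lemma steinberg_gen_in : steinberg_gen \in cyclic_sub (steinberg_gen : RG^o).
Proof. by apply/asboolP; exists 1; rewrite scale1r. Qed.
Definition steinberg_eps : steinberg := Steinberg steinberg_gen_in.

Lemma steinberg_scaleE (r : RG) (x : steinberg) : val (r *: x) = r * (val x : RG).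
Proof. by []. Qed.

(* The values of the form are a priori in the fraction field; they are in R. *)
Definition steinberg_form (x y : steinberg) : {fraction R} :=
  tofrac (\sum_g coefg (val x) g * coefg (val y) g) / #|borel F n|%:R.

Definition steinberg_filt (c : nat) : {pred steinberg} :=
  fun x => `[< forall y, exists r : R, steinberg_form x y = tofrac (l%:R ^+ c * r) >].

Definition galg_adj (a : RG) : RG := galg_of (fun g => coefg a g^-1%g).

Lemma galg_adjP (a x y : RG) :
  \sum_g coefg (a * x) g * coefg y g = \sum_g coefg x g * coefg (galg_adj a * y) g.
Proof.
under eq_bigr => g _ do rewrite galg_ofE mulr_suml.
under [RHS]eq_bigr => g _ do rewrite galg_ofE mulr_sumr.
rewrite exchange_big [RHS]exchange_big /= [RHS](reindex_inj invg_inj) /=.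
apply: eq_bigr => h _; rewrite (reindex_inj (mulgI h)) /=; apply: eq_bigr => g _.
by rewrite galg_ofE invgK mulKg mulrCA mulrA.
Qed.

Lemma steinberg_form_adj (a : RG) x y :
  steinberg_form (a *: x) y = steinberg_form x (galg_adj a *: y).
Proof. by rewrite /steinberg_form !linearZ galg_adjP. Qed.

Lemma steinberg_formDl x y z :
  steinberg_form (x + y) z = steinberg_form x z + steinberg_form y z.
Proof.
rewrite /steinberg_form -mulrDl -raddfD -big_split /=; congr (tofrac _ / _).
by apply: eq_bigr => g _; rewrite coefgD mulrDl.
Qed.

Lemma steinberg_filt_closed c : submod_closed (steinberg_filt c).
Proof.
split.
  apply/asboolP => y; exists 0; rewrite mulr0 /steinberg_form big1 ?mul0r //.
  by move=> g _; rewrite /coefg ffunE mul0r.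
move=> a x y /asboolP xP /asboolP yP; apply/asboolP => z.
have [r rE] := xP (galg_adj a *: z); have [s sE] := yP z.
by exists (r + s); rewrite steinberg_formDl steinberg_form_adj rE sE mulrDr raddfD.
Qed.

Definition lat_mod : Type := resmod l steinberg.
HB.instance Definition _ := Choice.on lat_mod.
HB.instance Definition _ := EqQuotient.on lat_mod.
HB.instance Definition _ := GRing.Lmodule.on lat_mod.
HB.instance Definition _ := ZmodQuotient.on lat_mod.

(* L(c) = (I(c) + lI) / lI, the image of I(c) in L *)
Definition lat_filt (c : nat) : {pred lat_mod} :=
  fun v => `[< exists2 x, x \in steinberg_filt c & v = \pi_lat_mod x >].

Lemma lat_filt_closed c : submod_closed (lat_filt c).
Proof.
have [c0 cP] := steinberg_filt_closed c; split.
  by apply/asboolP; exists 0; rewrite ?raddf0.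
move=> a _ _ /asboolP[x xc ->] /asboolP[y yc ->]; apply/asboolP.
exists (galg_lift a *: x + y); first exact: cP.
rewrite raddfD -{1}[a]galg_liftK; congr (_ + _).
exact: resmod_pi_scale.
Qed.
HB.instance Definition _ c :=
  GRing.isSubmodClosed.Build (galg K gT) lat_mod (lat_filt c) (lat_filt_closed c).

(* M(c) is the image of L(c) in L / L(c+1). *)
Definition lat_quot (c : nat) : Type := quotmod (lat_filt c.+1).
HB.instance Definition _ c := Choice.on (lat_quot c).
HB.instance Definition _ c := EqQuotient.on (lat_quot c).
HB.instance Definition _ c := GRing.Lmodule.on (lat_quot c).
HB.instance Definition _ c := ZmodQuotient.on (lat_quot c).

Definition steinberg_E (lam : gT -> R) : steinberg :=
  \sum_(u in unitri F n) (lam u *: gbase R u) *: steinberg_eps.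

Definition steinberg_F (lam : gT -> R) : lat_mod := \pi_lat_mod (steinberg_E lam).

(* KG (F_lam + L(c+1)), which is contained in M(c) as soon as F_lam is in L(c). *)
Definition N_sub (c : nat) (lam : gT -> R) : {pred lat_quot c} :=
  cyclic_sub (\pi_(lat_quot c) (steinberg_F lam)).

End Steinberg.

Arguments N_sub {F n R} l c lam _ : assert.

Definition qnum (q i : nat) : nat := ((q ^ i - 1) %/ (q - 1))%N.

Definition is_least (P : nat -> Prop) (e : nat) := P e /\ forall i, P i -> (e <= i)%N.

Fixpoint s_seq (l d i : nat) : nat :=
  if i is j.+1 then (l * s_seq l d j).+1 else d.

Section Digits.
Variables (e l m : nat).

(* The pair (y_{-1}, (y_0, ..., y_m)). *)
Definition Delta (a : nat) : nat * {ffun 'I_m.+1 -> nat} :=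
  (a %% e, [ffun i : 'I_m.+1 => (a %/ e) %/ l ^ i %% l])%N.

Lemma digits_sum k x : (0 < l)%N -> (\sum_(i < k) x %/ l ^ i %% l * l ^ i = x %% l ^ k)%N.
Proof.
move=> l0; elim: k x => [|k IH] x; first by rewrite big_ord0 modn1.
rewrite big_ord_recl /= expn0 divn1 muln1.
under eq_bigr => i _ do rewrite /bump /= add1n expnS divnMA mulnCA mulnC.
rewrite -big_distrl /= (IH (x %/ l)%N) expnS.
have {3}-> : (x = x %/ l %/ l ^ k * (l * l ^ k) + (x %/ l %% l ^ k * l + x %% l))%N.
  by rewrite addnA [(l * _)%N]mulnC mulnA -mulnDl -!divn_eq.
rewrite modnMDl [RHS]modn_small; first by rewrite addnC.
rewrite [(l * _)%N]mulnC addnC.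
apply: (@leq_trans (((x %/ l) %% l ^ k).+1 * l)%N); first by rewrite mulSn ltn_add2r ltn_pmod.
by rewrite leq_mul2r ltn_pmod ?expn_gt0 ?l0 // orbT.
Qed.

Lemma digits_uniq k (y : nat -> nat) : (0 < l)%N -> (forall i, y i < l)%N ->
  forall j, (j < k)%N -> ((\sum_(i < k) y i * l ^ i) %/ l ^ j %% l = y j)%N.
Proof.
move=> l0; elim: k y => [|k IH] y yl j // jk.
rewrite big_ord_recl /= expn0 muln1.
under eq_bigr => i _ do rewrite /bump /= add1n expnSr mulnA.
rewrite -big_distrl /= addnC.
case: j jk => [|j] jk; first by rewrite divn1 modnMDl modn_small.
by rewrite expnS divnMA divnMDl // [(y 0 %/ l)%N]divn_small // addn0 (IH (fun i => y i.+1)).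
Qed.

(* Delta a is the unique tuple of digits required; the bound on a holds for a <= n
   when m = trunc_log l (n %/ e). *)
Lemma DeltaP (a : nat) (y : nat * {ffun 'I_m.+1 -> nat}) :
  (0 < e)%N -> (0 < l)%N -> (a %/ e < l ^ m.+1)%N ->
  [/\ (y.1 < e)%N, forall i, (y.2 i < l)%N &
      a = (y.1 + e * \sum_(i < m.+1) y.2 i * l ^ i)%N] <-> y = Delta a.
Proof.
move=> e0 l0 am; split=> [|->].
  case: y => y1 y2 /= [y1e y2l ->]; rewrite /Delta mulnC addnC; congr pair.
    by rewrite modnMDl modn_small.
  apply/ffunP => i; rewrite ffunE divnMDl // [(y1 %/ e)%N]divn_small // addn0.
  pose z k := if insub k is Some j then y2 j else 0%N.
  have zE (j : 'I_m.+1) : z j = y2 j by rewrite /z valK.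
  rewrite -zE; under [X in (X %/ _)%N]eq_bigr => j _ do rewrite -zE.
  by rewrite digits_uniq // => k; rewrite /z; case: insubP.
split=> [|i|] /=; rewrite ?ffunE ?ltn_pmod //.
under eq_bigr => i _ do rewrite ffunE.
by rewrite digits_sum // [(a %/ e %% _)%N]modn_small // addnC mulnC -divn_eq.
Qed.

Definition Delta_seq (P : seq nat) : nat * {ffun 'I_m.+1 -> nat} := \sum_(a <- P) Delta a.

Definition star (P : seq nat) : seq nat :=
  let z := Delta_seq P in
  nseq z.1 1%N ++ flatten [seq nseq (z.2 i) (e * l ^ i)%N | i <- enum 'I_m.+1].

End Digits.

(* Main.v *)
Require Import Defs.
From mathcomp Require Import all_boot all_order all_fingroup all_algebra.
From mathcomp Require Import all_solvable boolp zify ring.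
From mathcomp Require generic_quotient.

Set Implicit Arguments.
Unset Strict Implicit.
Unset Printing Implicit Defensive.

Import GRing.Theory.

Local Open Scope ring_scope.

(** For a character [lam] of [U] let [E_lam] be the sum of the vectors [lam(u) u eps], on
    which [U] acts through the inverse of [lam]; [N(P)] is generated by the class of [E_lam]
    for any [lam] attached to [P]. It is therefore enough that, modulo [l], each of [E_lam]
    and [E_mu] lies in the submodule generated by the other when [lam] is attached to [P]
    and [mu] to the star of [P]: the two submodules then agree in every layer [M(c)]. The
    relation [reach lam mu] says that an element of the group ring carries [E_lam] to a
    multiple of [E_mu] by a scalar outside the maximal ideal [l R].

    The lattice [I] has the basis of the [u eps] for [u] in [U] ([Uspan_ideal],
    [Uspan_free]), so that it is the regular module of [U]: every character of [U] occurs in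
    it once ([ehat_ideal]), and the [U]-invariants have rank one, the projection on them
    being the evaluation at the identity ([hatU_ideal]). A passage from [E_lam] to another
    eigenvector and back is thus a scalar, and when this scalar is prime to [l] both
    passages are invertible modulo [l] ([link_reach]). Which scalars are prime to [l] is
    decided on two kinds of passages.

    Descent: let [Q] be a parabolic subgroup contained in [P], of index prime to [l]. The
    sum, over [g] in [P], of the conjugates by [g] of the sum of the elements of the unipotent
    radical of [Q] commutes with [P], hence is scalar on the invariants of the radical of [P]
    ([commuting_scalar]). Its trace shows that this scalar is the index of [Q] in [P] up to
    the order of [Q] and a power of the characteristic ([theta_scalar]), so for some [g] the
    passage through the conjugate of the radical of [Q] by [g] does not vanish modulo [l].
    By the Bruhat decomposition [g] may be taken to be a permutation, and since [lam] is
    non-trivial on all simple root subgroups inside the blocks of [P], it must reverse the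
    order of the blocks of [Q] in each block of [P] ([block_reversal]). The eigenvector
    reached has a character attached to [Q] ([descent]).

    Rearrangement: when the blocks of [Q'] are those of [Q] in another order, a permutation
    conjugates one Levi subgroup to the other. The composite of the projections on the
    invariants of the two radicals commutes with the Levi subgroup, and so acts by the same
    scalar for all the characters trivial on the radical ([scalar_transfer]); for the trivial
    character the scalar is a power of the characteristic up to sign ([rearrangement]).

    Finally the diagonal matrices permute transitively the characters attached to a given
    parabolic subgroup ([generic_torus]). The chain of passages from [P] to its star goes
    through the parabolic subgroup [Q] whose composition concatenates the stars of the parts
    of [P]. The index of [Q] in [P] is prime to [l] by a valuation count: the order of a
    parabolic subgroup is a power of [q] times a product of factors [q^i - 1] ([logn_spar]),
    so that modulo the order of [B] each part contributes the valuation of a product of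
    factors [(q^i - 1) / (q - 1)]. This is a linear function of the digits of the part by
    lifting the exponent and Legendre's formula ([val_sum_digits]), with coefficients equal
    to its values at the parts [e l^i] of the star ([val_sum_pow]). *)

(** * Permutations and blocks of indices *)

Section Ordinals.
Variable m : nat.
Implicit Types (i j k : 'I_m) (s t : 'S_m) (b : 'I_m -> nat).

(** The sum of [f] over all indices is unchanged by [s]. *)
Lemma perm_sum_le (f : 'I_m -> nat) s : (forall i, (f i <= f (s i))%N) -> forall i, f (s i) = f i.
Proof.
move=> fs i; apply/eqP; rewrite eqn_leq fs andbT leqNgt; apply/negP => lt_i.
have : (\sum_j f j < \sum_j f (s j))%N.
  by rewrite (bigD1 i) //= [ltnRHS](bigD1 i) //= -addSn leq_add // leq_sum.
have -> : \sum_j f j = \sum_j f (s j) by apply: (reindex_inj (@perm_inj _ s)).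
by rewrite ltnn.
Qed.

(** A composition is represented by a monotone function sending each index to the label
    of its block. Only the order of the labels matters: [coarser] compares compositions
    through it, whatever the labels. *)
Definition block_fun b := forall i j, (i <= j)%N -> (b i <= b j)%N.
Definition coarser b b' := forall i j, (b' j <= b' i)%N -> (b j <= b i)%N.
Definition block_incr b s := forall i j, (i < j)%N -> b i = b j -> (s i < s j)%N.

(** Among the rearrangements of [s0] inside the blocks, one that maximises
    [\sum_i i * s0 (t i)] has no descent inside a block, since exchanging the two
    values at a descent increases the sum. *)
Lemma block_sort b s0 : block_fun b ->
  exists t : 'S_m, (forall i, b (t i) = b i) /\ block_incr b (t * s0)%g.
Proof.
move=> bm.
pose P := [pred t : 'S_m | [forall i, b (t i) == b i]].
have P1 : P 1%g by apply/forallP => i; rewrite perm1.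
have [t Pt tmax] := @arg_maxnP _ (1%g : 'S_m) P (fun t => \sum_(i : 'I_m) i * (t * s0)%g i)%N P1.
have bt i : b (t i) = b i by apply/eqP; move/forallP: Pt.
exists t; split=> // i j ij bij; rewrite ltnNge; apply/negP => le_ji.
have nij : i != j by apply: contraTneq ij => ->; rewrite ltnn.
have lt_ji : ((t * s0)%g j < (t * s0)%g i)%N.
  by rewrite ltn_neqAle le_ji andbT (inj_eq val_inj) (inj_eq perm_inj) eq_sym.
have Pt' : P (tperm i j * t)%g.
  by apply/forallP => k; rewrite permM bt; case: tpermP => // ->; rewrite bij.
have := tmax _ Pt'; apply/negP; rewrite -ltnNge.
rewrite -mulgA; set u := (t * s0)%g in lt_ji *.
rewrite (bigD1 i) // [ltnRHS](bigD1 i) //= (bigD1 j) 1?eq_sym //=.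
rewrite [X in (_ < _ + X)%N](bigD1 j) 1?eq_sym //=.
rewrite !addnA [X in (_ < _ + X)%N](eq_bigr (fun k : 'I_m => k * u k)%N);
  last move=> k /andP[ki kj]; last first.
  by rewrite permM tpermD // eq_sym.
rewrite ltn_add2r [in ltnRHS]permM tpermL [(tperm i j * u)%g j]permM tpermR.
by move: ij lt_ji; move: (u i) (u j) => x y; nia.
Qed.

End Ordinals.

(** * Parabolic subgroups of the general linear group *)

(** The general linear group as an abstract finite group, so that its operations are
    inferred from the group structure and not from the ring of matrices. *)
Definition GLT (F : finFieldType) (n : nat) : finGroupType := {'GL_n[F]}.

Section GLGroups.
Variables (F : finFieldType) (n : nat).
Local Notation gT := (GLT F n).
Local Notation I := 'I_n.-1.+1.
Implicit Types (g h x u v : gT) (i j k : I) (s t : 'S_n.-1.+1) (b : I -> nat).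

Lemma GL_mulE g h i j : val (g * h)%g i j = \sum_k val g i k * val h k j.
Proof. by rewrite mxE. Qed.

Lemma GL_oneE i j : val (1%g : gT) i j = (i == j)%:R.
Proof. by rewrite mxE. Qed.

Lemma GL_eqP g h : (forall i j, val g i j = val h i j) -> g = h.
Proof. by move=> gh; apply/val_inj/matrixP. Qed.

Definition GLof (A : 'M[F]_n.-1.+1) : gT := insubd (1%g : gT) A.

Lemma GLofK A : A \in unitmx -> val (GLof A) = A.
Proof. by move=> uA; rewrite insubdK. Qed.

Definition pmat s : gT := permGL F s.

Lemma pmatM s t : pmat (s * t) = (pmat s * pmat t)%g.
Proof. by apply: val_inj; rewrite /= perm_mxM. Qed.

Lemma pmat1 : pmat (1 : 'S_n.-1.+1) = 1%g.
Proof. by apply: val_inj; rewrite /= perm_mx1. Qed.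

Lemma pmatV s : pmat s^-1 = (pmat s)^-1%g.
Proof. by apply: (mulIg (pmat s)); rewrite mulVg -pmatM mulVg pmat1. Qed.

Lemma pmat_mulE s g i j : val (pmat s * g)%g i j = val g (s i) j.
Proof. by rewrite -[val _]/(perm_mx s *m val g) -row_permE mxE. Qed.

Lemma mul_pmatE s g i j : val (g * pmat s)%g i j = val g i (s^-1 j)%g.
Proof. by rewrite -[val _]/(val g *m perm_mx s) -[s in LHS]invgK -col_permE mxE. Qed.

Lemma conj_pmatE s g i j : val (g ^ pmat s)%g i j = val g (s^-1 i)%g (s^-1 j)%g.
Proof. by rewrite conjgE -pmatV pmat_mulE mul_pmatE. Qed.

Lemma conj_pmatVE s g i j : val (g ^ (pmat s)^-1)%g i j = val g (s i) (s j).
Proof. by rewrite -pmatV conj_pmatE invgK. Qed.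

(** The standard parabolic subgroup of a block function, its unipotent radical and its
    Levi complement. The identity labelling [@nat_of_ord _] gives the Borel subgroup, the
    unitriangular group and the diagonal torus. *)
Definition spar b : {set gT} :=
  [set g : gT | [forall i, forall j, (b j < b i)%N ==> (val g i j == 0)]].

Definition prad b : {set gT} :=
  [set g : gT | [forall i, forall j, (b j <= b i)%N ==> (val g i j == (i == j)%:R)]].

Definition levi b : {set gT} :=
  [set g : gT | [forall i, forall j, (b j != b i) ==> (val g i j == 0)]].

Lemma sparP b g : reflect (forall i j, (b j < b i)%N -> val g i j = 0) (g \in spar b).
Proof.
rewrite inE; apply: (iffP forallP) => [gP i j ij|gP i].
  by have /forallP/(_ j)/implyP/(_ ij)/eqP := gP i.
by apply/forallP => j; apply/implyP => ij; rewrite gP.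
Qed.

Lemma pradP b g :
  reflect (forall i j, (b j <= b i)%N -> val g i j = (i == j)%:R) (g \in prad b).
Proof.
rewrite inE; apply: (iffP forallP) => [gP i j ij|gP i].
  by have /forallP/(_ j)/implyP/(_ ij)/eqP := gP i.
by apply/forallP => j; apply/implyP => ij; rewrite gP.
Qed.

Lemma leviP b g : reflect (forall i j, b j != b i -> val g i j = 0) (g \in levi b).
Proof.
rewrite inE; apply: (iffP forallP) => [gP i j ij|gP i].
  by have /forallP/(_ j)/implyP/(_ ij)/eqP := gP i.
by apply/forallP => j; apply/implyP => ij; rewrite gP.
Qed.

Lemma spar_group_set b : group_set (spar b).
Proof.
apply/group_setP; split=> [|g h /sparP gP /sparP hP]; apply/sparP => i j ij.
  by rewrite GL_oneE; case: eqP ij => // ->; rewrite ltnn.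
rewrite GL_mulE big1 // => k _; case: (leqP (b i) (b k)) => [ik|ki].
  by rewrite (hP k j (leq_trans ij ik)) mulr0.
by rewrite (gP i k ki) mul0r.
Qed.
Canonical spar_group b := Group (spar_group_set b).

Lemma prad_group_set b : group_set (prad b).
Proof.
apply/group_setP; split=> [|g h /pradP gP /pradP hP]; apply/pradP => i j ij.
  by rewrite GL_oneE.
rewrite GL_mulE (bigD1 i) //= gP // eqxx mul1r hP // big1 ?addr0 // => k ki.
case: (leqP (b k) (b i)) => [ki'|ik]; first by rewrite gP // eq_sym (negPf ki) mul0r.
by rewrite hP ?(leq_trans ij (ltnW ik)) //; case: eqVneq ik => [->|_ _]; rewrite ?mulr0 // ltnNge ij.
Qed.
Canonical prad_group b := Group (prad_group_set b).

Lemma levi_group_set b : group_set (levi b).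
Proof.
apply/group_setP; split=> [|g h /leviP gP /leviP hP]; apply/leviP => i j ij.
  by rewrite GL_oneE; case: (i =P j) ij => // ->; rewrite eqxx.
rewrite GL_mulE big1 // => k _; case: (eqVneq (b k) (b i)) => [ki|ki].
  by rewrite hP ?mulr0 // ki.
by rewrite (gP i k ki) mul0r.
Qed.
Canonical levi_group b := Group (levi_group_set b).

Lemma levi_sub b : levi b \subset spar b.
Proof.
apply/subsetP => g /leviP gL; apply/sparP => i j ij; apply: gL.
by rewrite neq_ltn ij.
Qed.

Lemma prad_sub b : prad b \subset spar b.
Proof.
apply/subsetP => g /pradP gL; apply/sparP => i j ij.
by rewrite gL ?(ltnW ij) //; case: eqP ij => // ->; rewrite ltnn.
Qed.

(** Write [g^-1 u g] as [1 + g^-1 (u - 1) g]: in each term of an entry on or below the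
    diagonal blocks one of the three factors vanishes. *)
Lemma prad_norm b : spar b \subset 'N(prad b)%g.
Proof.
apply/subsetP => g gP; rewrite inE; apply/subsetP => _ /imsetP[u /pradP uU ->].
apply/pradP => i l il; rewrite conjgE.
have /sparP gV : (g^-1)%g \in spar b := @groupVr _ (spar_group b) g gP.
move/sparP: gP => gP.
have -> : val (g^-1 * (u * g))%g = 1%:M + val (g^-1)%g *m ((val u - 1%:M) *m val g).
  have gg : val (g^-1)%g *m val g = 1%:M by rewrite -[1%:M]/(val (1%g : gT)) -(mulVg g).
  by rewrite mulmxBl mul1mx mulmxBr gg addrC subrK.
rewrite mxE [X in X + _]mxE [X in _ + X]mxE big1 ?addr0 // => j _.
rewrite [X in _ * X]mxE mulr_sumr big1 // => k _.
rewrite [X in _ * (X * _)]mxE [X in _ * ((_ + X) * _)]mxE [X in _ * ((_ - X) * _)]mxE.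
case: (leqP (b i) (b j)) => [ij|ji]; last by rewrite gV // mul0r.
case: (leqP (b k) (b l)) => [kl|lk]; last by rewrite gP // !mulr0.
by rewrite uU ?(leq_trans kl) ?(leq_trans il) // subrr mul0r mulr0.
Qed.

Lemma unitri_prad : unitri F n = prad (@nat_of_ord _).
Proof.
apply/setP => g; apply/idP/pradP => [|gU].
  rewrite 2!inE => /andP[/forallP gB /forallP g1] i j.
  rewrite leq_eqVlt => /predU1P[/val_inj ->|ij]; first by rewrite eqxx; apply/eqP.
  rewrite (negPf (_ : i != j)); last by rewrite neq_ltn ij orbT.
  by have /forallP/(_ j)/implyP/(_ ij)/eqP := gB i.
rewrite 2!inE; apply/andP; split; apply/forallP => i; last by rewrite gU ?eqxx.
apply/forallP => j; apply/implyP => ij; rewrite gU ?(ltnW ij) //.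
by case: (i =P j) ij => // ->; rewrite ltnn.
Qed.

Lemma sparS b b' : coarser b b' -> spar b' \subset spar b.
Proof.
move=> bb; apply/subsetP => g /sparP gP; apply/sparP => i j ij; apply: gP.
by rewrite ltnNge; apply: contraL ij => /bb; rewrite -leqNgt.
Qed.

Lemma pradS b b' : coarser b b' -> prad b \subset prad b'.
Proof.
by move=> bb; apply/subsetP => g /pradP gP; apply/pradP => i j /bb; apply: gP.
Qed.

Lemma block_fun_coarser b : block_fun b -> coarser b (@nat_of_ord _).
Proof. by move=> bm i j; apply: bm. Qed.

Local Notation B := (spar (@nat_of_ord n.-1.+1)).
Local Notation U := (prad (@nat_of_ord n.-1.+1)).

Lemma borel_norm : B \subset 'N(U)%g.
Proof. exact: prad_norm. Qed.

Lemma pmat_spar b s : (forall i, b (s i) = b i) -> pmat s \in levi b.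
Proof.
move=> bs; apply/leviP => i j ij; rewrite /= !mxE; case: eqP => // e.
by case/eqP: ij; rewrite -e bs.
Qed.

(** A permutation matrix in a parabolic subgroup never lowers the block label, hence keeps
    it by [perm_sum_le]. *)
Lemma spar_perm b s : pmat s \in spar b -> forall i, b (s i) = b i.
Proof.
move/sparP => sP; apply: perm_sum_le => i; rewrite leqNgt; apply/negP => /sP/eqP.
by rewrite /= !mxE eqxx oner_eq0.
Qed.

(** Uniqueness in the Bruhat decomposition: the entries of [s^-1 u t] at the places
    [(s i, t i)] are the diagonal entries of [u]. *)
Lemma bruhat_uniq u s t : u \in U -> ((pmat s)^-1 * u * pmat t)%g \in B -> s = t.
Proof.
move=> /pradP uU; move=> /sparP sut.
have st i : (s i <= t i)%N.
  rewrite leqNgt; apply/negP => /sut/eqP; rewrite -pmatV mul_pmatE pmat_mulE !permK.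
  by rewrite uU // eqxx oner_eq0.
have le_id j : (j <= (s^-1 * t)%g j)%N by rewrite permM -{1}[j](permKV s).
apply/permP => i; apply: val_inj; have := perm_sum_le le_id (s i).
by rewrite permM permK.
Qed.

End GLGroups.

(** * Root elements *)

Section RootElements.
Variables (F : finFieldType) (n : nat).
Local Notation gT := (GLT F n).
Local Notation I := 'I_n.-1.+1.
Local Notation B := (spar F (@nat_of_ord n.-1.+1)).
Local Notation U := (prad F (@nat_of_ord n.-1.+1)).
Implicit Types (g h x y u v : gT) (i j k : I) (s t : 'S_n.-1.+1) (b : I -> nat) (a c : F).

Definition xroot i j a : gT := GLof (1%:M + a *: delta_mx i j).

Lemma xroot_val i j a : i != j -> val (xroot i j a) = 1%:M + a *: delta_mx i j.
Proof.
move=> ij; apply/GLofK.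
suff /mulmx1_unit[] :
  (1%:M + a *: delta_mx i j) *m (1%:M - a *: delta_mx i j) = 1%:M :> 'M[F]_n.-1.+1 by [].
rewrite mulmxBr mulmx1 mulmxDl mul1mx -scalemxAl -scalemxAr mul_delta_mx_0 1?eq_sym //.
by rewrite !scaler0 addr0 addrK.
Qed.

Lemma xrootE i j a k l : i != j ->
  val (xroot i j a) k l = (k == l)%:R + a * ((k == i) && (l == j))%:R.
Proof. by move=> ij; rewrite xroot_val // !mxE. Qed.

Lemma mul_xrootE g i j a k l : i != j ->
  val (g * xroot i j a)%g k l = val g k l + val g k i * a * (l == j)%:R.
Proof.
move=> ij; rewrite GL_mulE.
under eq_bigr => m _ do rewrite xrootE // mulrDr.
rewrite big_split /= (bigD1 l) //= eqxx mulr1 big1 ?addr0 => [|m /negPf ->]; last by rewrite mulr0.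
congr (_ + _); rewrite (bigD1 i) //= eqxx /= big1 ?addr0 ?mulrA // => m /negPf ->.
by rewrite !mulr0.
Qed.

Lemma xroot_mulE g i j a k l : i != j ->
  val (xroot i j a * g)%g k l = val g k l + (k == i)%:R * a * val g j l.
Proof.
move=> ij; rewrite GL_mulE.
under eq_bigr => m _ do rewrite xrootE // mulrDl.
rewrite big_split /= (bigD1 k) //= eqxx mul1r big1 ?addr0 => [|m /negPf mk]; last by rewrite eq_sym mk mul0r.
congr (_ + _); rewrite (bigD1 j) //= eqxx /= big1 ?addr0 ?andbT => [|m /negPf ->].
  by rewrite (mulrC a).
by rewrite andbF mulr0 mul0r.
Qed.

Lemma xroot0 i j : i != j -> xroot i j 0 = 1%g.
Proof. by move=> ij; apply: val_inj; rewrite /= xroot_val // scale0r addr0. Qed.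

Lemma xrootD i j a c : i != j -> (xroot i j a * xroot i j c)%g = xroot i j (a + c).
Proof.
move=> ij; apply: GL_eqP => k l; rewrite mul_xrootE // !xrootE // (negPf ij) andbF mulr0 addr0.
by rewrite mulrDl addrA -mulnb natrM; ring.
Qed.

Lemma xroot_prad b i j a : (b i < b j)%N -> xroot i j a \in prad F b.
Proof.
move=> ij; have nij : i != j by apply: contraTneq ij => ->; rewrite ltnn.
apply/pradP => k l kl; rewrite xrootE //.
by case: andP kl => [[/eqP-> /eqP->]|_ _]; rewrite ?mulr0 ?addr0 // leqNgt ij.
Qed.

Lemma xroot_levi b i j a : i != j -> b i = b j -> xroot i j a \in levi F b.
Proof.
move=> nij ij; apply/leviP => k l kl; rewrite xrootE //.
case: (k =P l) kl => [->|_ kl]; first by rewrite eqxx.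
by case: andP kl => [[/eqP-> /eqP->]|_ _]; rewrite ?mulr0 ?addr0 // ij eqxx.
Qed.

Lemma xroot_conj i j a s : i != j -> (xroot i j a ^ pmat F s)%g = xroot (s i) (s j) a.
Proof.
move=> ij; apply: GL_eqP => k l; rewrite conj_pmatE !xrootE ?(inj_eq perm_inj) //.
by rewrite !(can2_eq (permKV s) (permK s)).
Qed.

Lemma xroot_comm i k j a c : i != k -> k != j -> i != j ->
  (xroot i k a * xroot k j c)%g = (xroot k j c * xroot i k a * xroot i j (a * c)%R)%g.
Proof.
move=> ik kj ij; apply: GL_eqP => x y; rewrite !mul_xrootE // !xrootE //.
rewrite !(eqxx, negPf ik, negPf kj, negPf ij, eq_sym j i, eq_sym k i, eq_sym j k, andbT, andbF) /=.
by rewrite -!mulnb !natrM; ring.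
Qed.

(** * Generation of the general linear group and its Bruhat decomposition *)

Lemma borel_diag g i : g \in B -> val g i i != 0.
Proof.
move=> gB; have gV : (g^-1)%g \in B by rewrite groupV.
move/sparP: gV => gV; move/sparP: gB => gB.
have : val (g * g^-1)%g i i = 1 by rewrite mulgV GL_oneE eqxx.
rewrite GL_mulE (bigD1 i) //= big1 ?addr0 => [|k ki].
  by apply: contra_eq_neq => ->; rewrite mul0r eq_sym oner_eq0.
case: (ltngtP i k) => [lt|lt|/val_inj e]; [by rewrite gV ?mulr0|by rewrite gB ?mul0r|].
by rewrite e eqxx in ki.
Qed.

Definition torus (d : I -> F) : gT := GLof (diag_mx (\row_i d i)).

Lemma torusE (d : I -> F) i j : (forall k, d k != 0) -> val (torus d) i j = d i *+ (i == j).
Proof.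
move=> d0; rewrite GLofK ?mxE ?mxE //.
by rewrite unitmxE det_diag unitfE prodf_seq_neq0; apply/allP => k _; rewrite mxE d0.
Qed.

Lemma torus_levi (d : I -> F) b : (forall k, d k != 0) -> torus d \in levi F b.
Proof.
by move=> d0; apply/leviP => i j; rewrite torusE //; case: (i =P j) => // ->; rewrite eqxx.
Qed.

Local Notation T := (levi F (@nat_of_ord n.-1.+1)).

Lemma torus_conj s y : y \in T -> (y ^ pmat F s)%g \in T.
Proof.
move=> /leviP tT; apply/leviP => i j ij; rewrite conj_pmatE tT //.
by rewrite (inj_eq val_inj) (inj_eq perm_inj) -(inj_eq val_inj).
Qed.

Lemma borel_UT g : g \in B -> exists u y, [/\ u \in U, y \in T & g = (u * y)%g].
Proof.
move=> gB; have d0 k : (val g k k)^-1 != 0 by rewrite invr_eq0 borel_diag.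
have tT := @torus_levi _ (@nat_of_ord _) d0; set y0 := torus _ in tT.
exists (g * y0)%g, (y0^-1)%g; split; [|by rewrite (@groupV _ (levi_group F (@nat_of_ord _)))|by rewrite mulgK].
apply/pradP => i j; rewrite leq_eqVlt => ij.
rewrite GL_mulE (bigD1 j) //= torusE // eqxx mulr1n big1 ?addr0 => [|k /negPf kj]; last first.
  by rewrite torusE // kj mulr0.
case/predU1P: ij => [/val_inj->|ij]; first by rewrite eqxx divff ?borel_diag.
move: gB => /sparP/(_ _ _ ij) ->; rewrite mul0r.
by case: (i =P j) ij => // ->; rewrite ltnn.
Qed.

Lemma U_sub_B : U \subset B. Proof. exact: prad_sub. Qed.
Lemma T_sub_B : T \subset B. Proof. exact: levi_sub. Qed.

(** Permutations are products of simple transpositions, and the two triangular factors of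
    a permuted [LU] decomposition lie in [B] and in its conjugate by the order-reversing
    permutation. *)
Lemma GL_gen (H : {group gT}) : B \subset H ->
  (forall i j, j = i.+1 :> nat -> pmat F (tperm i j) \in H) -> forall g, g \in H.
Proof.
move=> BH sH.
have tH d : forall i j, j = (i + d.+1)%N :> nat -> pmat F (tperm i j) \in H.
  elim: d => [|d IH] i j ij; first by apply: sH; rewrite ij addn1.
  have lt_k : (i + d.+1 < n.-1.+1)%N by rewrite (leq_trans _ (ltn_ord j)) // ij !addnS.
  pose k := Ordinal lt_k.
  have -> : tperm i j = (tperm i k ^ tperm k j)%g.
    by rewrite tpermJ tpermL tpermD // -(inj_eq val_inj) /= ?ij; apply/eqP; lia.
  have skj : pmat F (tperm k j) \in H by apply: sH; rewrite ij addnS.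
  by rewrite conjgE tpermV !pmatM (groupM skj) // (groupM _ skj) // IH.
have pH s : pmat F s \in H.
  have [ts -> _] := prod_tpermP s.
  elim: ts => [|[i j] ts IH]; first by rewrite big_nil pmat1.
  rewrite big_cons pmatM groupM //=.
  case: (ltngtP i j) => [lt|lt|/val_inj->]; last by rewrite tperm1 pmat1.
    by apply: (tH (j - i.+1)%N); lia.
  by rewrite tpermC; apply: (tH (i - j.+1)%N); lia.
move=> g; have := cormen_lup_correct (val g); have := cormen_lup_perm (val g).
have := cormen_lup_detL (val g); have := @cormen_lup_lower _ _ (val g).
have := @cormen_lup_upper _ _ (val g).
case: (cormen_lup (val g)) => [[P L] V] /= Vup Llow Ldet /is_perm_mxP[s ->] PA.
have uL : L \in unitmx by rewrite unitmxE Ldet unitr1.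
have uV : V \in unitmx.
  have : perm_mx s *m val g \in unitmx by rewrite unitmx_mul unitmx_perm (valP g).
  by rewrite -[_ *m _]/(perm_mx s * val g) PA unitmx_mul uL.
have -> : g = ((pmat F s)^-1 * GLof L * GLof V)%g.
  apply: (mulgI (pmat F s)); rewrite !mulgA mulgV mul1g; apply: val_inj.
  by rewrite /= !GLofK.
have VH : GLof V \in H.
  by apply/(subsetP BH); apply/sparP => i j ij; rewrite GLofK ?Vup.
have LH : GLof L \in H.
  pose w : 'S_n.-1.+1 := perm (@rev_ord_inj n.-1.+1).
  have -> : GLof L = (pmat F w * (GLof L ^ pmat F w) * (pmat F w)^-1)%g.
    by rewrite conjgE !mulgA mulgV mul1g mulgK.
  rewrite groupM ?groupV // groupM //.
  apply/(subsetP BH); apply/sparP => i j ij.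
  rewrite conj_pmatE GLofK // Llow.
    by rewrite (inj_eq perm_inj) -(inj_eq val_inj) gtn_eqF.
  have wV : (w^-1)%g = w.
    by apply/permP => k; apply: (@perm_inj _ w); rewrite permKV !permE rev_ordK.
  by rewrite wV !permE /= leq_sub2l // ltnS ltnW.
by rewrite !groupM ?groupV.
Qed.

Section RankOne.
Variables (i i' : I) (ii : i' = i.+1 :> nat).
Local Notation si := (tperm i i').

Lemma simple_neq : i != i'.
Proof. by rewrite -(inj_eq val_inj) /= ii neq_ltn ltnSn. Qed.

(** A simple transposition conjugates into [U] the elements of [U] whose entry at the
    corresponding superdiagonal place is zero; a root element brings this entry to zero. *)
Lemma simple_split u : u \in U -> exists u1,
  [/\ u1 \in U, (u1 ^ pmat F si)%g \in U & u = (u1 * xroot i i' (val u i i'))%g].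
Proof.
have nii := simple_neq; move=> uU.
have xU a : xroot i i' a \in U by rewrite xroot_prad ?ii.
exists (u * xroot i i' (- val u i i'))%g; split.
- by rewrite groupM.
- have u1U : (u * xroot i i' (- val u i i'))%g \in U by rewrite groupM.
  apply/pradP => k l lk; rewrite conj_pmatE tpermV.
  have [le|lt] := leqP (si l) (si k).
    by move/pradP: u1U => ->; rewrite ?(inj_eq perm_inj).
  have [-> ->] : k = i' /\ l = i.
    have N (x y : I) : x <> y -> (x : nat) <> y by move=> h /val_inj.
    move: lt lk; case: tpermP => [->|->|/N li /N li'];
      by case: tpermP => [->|->|/N ki /N ki'] // h1 h2; exfalso; lia.
  rewrite tpermL tpermR mul_xrootE // eqxx mulr1 eq_sym (negPf nii).
  by move/pradP/(_ i i (leqnn _)): uU => ->; rewrite eqxx mul1r subrr.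
- by rewrite -mulgA xrootD // addNr xroot0 // mulg1.
Qed.

Lemma xroot_fix s a : (s i < s i')%N -> (xroot i i' a ^ pmat F s)%g \in B.
Proof.
by move=> lt; rewrite xroot_conj ?simple_neq // (subsetP U_sub_B) ?xroot_prad.
Qed.

(** In rank one the lower unipotent [si x(a) si] equals [x(1/a) si t x(1/a)] with [t]
    diagonal; [h] is [t x(1/a)], known only through the position of its entries. *)
Lemma simple_flip a : a != 0 -> exists h,
  (pmat F si * xroot i i' a = xroot i i' a^-1%R * pmat F si * h * pmat F si)%g /\
  forall s, (s i < s i')%N -> (h ^ pmat F s)%g \in B.
Proof.
have nii := simple_neq; have nii' : i' != i by rewrite eq_sym.
move=> a0; exists (pmat F si * (xroot i i' (- a^-1) * xroot i' i a))%g.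
have ss : (pmat F si * pmat F si = 1)%g by rewrite -pmatM tperm2 pmat1.
split.
  have -> : xroot i' i a = (pmat F si * xroot i i' a * pmat F si)%g.
    have sV : (pmat F si)^-1%g = pmat F si by rewrite -pmatV tpermV.
    by rewrite -{1}sV -mulgA -conjgE xroot_conj // tpermL tpermR.
  rewrite !mulgA -!(mulgA _ (pmat F si) (pmat F si)) ss !mulg1.
  by rewrite xrootD // addrN xroot0 // mul1g.
move=> s lt; apply/sparP => k l lk.
rewrite conj_pmatE pmat_mulE xroot_mulE // !xrootE //.
have [ek|nki] := eqVneq (s^-1 k)%g i.
  rewrite ek tpermL (negPf nii') eqxx mul0r mul0r addr0 /=.
  have -> : (i' == (s^-1 l)%g) = false.
    by apply/negP => /eqP e; move: lk; rewrite -(permKV s l) -(permKV s k) ek -e ltnNge ltnW.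
  have -> : ((s^-1 l)%g == i) = false.
    by apply/negP => /eqP e; move: lk; rewrite -(permKV s l) -(permKV s k) ek e ltnn.
  by rewrite mulr0 addr0.
have [ek|nki'] := eqVneq (s^-1 k)%g i'.
  rewrite ek tpermR (negPf nii) eqxx /=.
  have -> : (i' == (s^-1 l)%g) = false.
    by apply/negP => /eqP e; move: lk; rewrite -(permKV s l) -(permKV s k) ek -e ltnn.
  rewrite mulr0 addr0 add0r mul1r (eq_sym i).
  by rewrite eqxx /=; case: (_ == i); rewrite ?mulr0 ?addr0 // mulr1 mulNr mulVf // subrr.
rewrite tpermD 1?eq_sym // (negPf nki) (negPf nki') mulr0 mul0r mul0r !addr0.
have nkl : (k == l) = false by apply/negP => /eqP e; rewrite e ltnn in lk.
by rewrite (inj_eq perm_inj) eq_sym nkl.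
Qed.

End RankOne.

(** The union of the double cosets [U s B] is stable under the left multiplication by [B]
    and by the simple transpositions, hence by the whole group. *)
Lemma bruhat g : exists u s x, [/\ u \in U, x \in B & g = (u * pmat F s * x)%g].
Proof.
pose C := [set g : gT | `[< exists u s x, [/\ u \in U, x \in B & g = (u * pmat F s * x)%g] >]].
pose S := [set h : gT | [forall g in C, (h * g)%g \in C]].
have SP h : reflect (forall g, g \in C -> (h * g)%g \in C) (h \in S).
  by rewrite inE; apply: (iffP forallP) => hC z; [move/implyP: (hC z)|apply/implyP; apply: hC].
have gS : group_set S.
  apply/group_setP; split=> [|x y /SP xS /SP yS]; apply/SP => z zC; first by rewrite mul1g.
  by rewrite -mulgA xS ?yS.
have TB x s : x \in T -> (x ^ pmat F s)%g \in B.
  by move=> xT; apply: (subsetP T_sub_B); apply: torus_conj.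
have allS (g0 : gT) : g0 \in Group gS.
  apply: GL_gen => [|i j ij].
    apply/subsetP => x xB; apply/SP => z; rewrite !inE => /asboolP[u [s [y [uU yB ->]]]].
    have xuB : (x * u)%g \in B by rewrite groupM // (subsetP U_sub_B).
    have [v [t [vU tT e]]] := borel_UT xuB.
    apply/asboolP; exists v, s, ((t ^ pmat F s) * y)%g; split=> //.
      by rewrite groupM // TB.
    by rewrite !mulgA e -(mulgA v) (conjgC t) !mulgA.
  apply/SP => z; rewrite !inE => /asboolP[u [s [y [uU yB ->]]]]; apply/asboolP.
  have nij := simple_neq ij; have [u1 [u1U u1s ->]] := simple_split ij uU.
  set a := val u i j; set p := pmat F (tperm i j).
  have pV : (p^-1)%g = p by rewrite -pmatV tpermV.
  have pp : (p * p = 1)%g by rewrite -{1}pV mulVg.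
  have pu1 (w : gT) : (p * (u1 * w))%g = ((u1 ^ p) * (p * w))%g.
    by rewrite conjgE pV -!mulgA (mulgA p p) pp mul1g.
  rewrite -!mulgA pu1.
  have xU c : xroot i j c \in U by rewrite xroot_prad ?ij.
  (* The root element passes to the right through [s] when [s] keeps the order of [i] and
     [j]; otherwise the identity in rank one moves it to the left of the transposition. *)
  case: (ltngtP (s i) (s j)) => [lt|gt|/val_inj/perm_inj e]; last by rewrite e eqxx in nij.
    exists (u1 ^ p)%g, (tperm i j * s)%g, ((xroot i j a ^ pmat F s) * y)%g.
    split=> //; first by rewrite groupM ?xroot_fix.
    rewrite pmatM -/p; move: (u1 ^ p)%g (conjgC (xroot i j a) (pmat F s)) => c1.
    by move: (_ ^ _)%g => c2 e; rewrite -!mulgA (mulgA (xroot _ _ _)) e -!mulgA.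
  have lt : ((tperm i j * s)%g i < (tperm i j * s)%g j)%N by rewrite !permM tpermL tpermR.
  have [a0|a0] := eqVneq a 0.
    exists (u1 ^ p)%g, (tperm i j * s)%g, y.
    by rewrite a0 xroot0 // mul1g pmatM !mulgA.
  have [h [he hB]] := simple_flip ij a0.
  exists ((u1 ^ p) * xroot i j a^-1%R)%g, s, ((h ^ pmat F (tperm i j * s)) * y)%g; split.
  - by rewrite groupM.
  - by rewrite groupM ?hB.
  have := conjgC h (pmat F (tperm i j * s)); rewrite pmatM -/p.
  move: (h ^ (p * pmat F s))%g (u1 ^ p)%g => c1 c2 e.
  rewrite (mulgA p) he -/p -!mulgA; congr (_ * (_ * _))%g.
  by rewrite (mulgA p (pmat F s)) (mulgA h) e -!mulgA (mulgA p p) pp mul1g.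
have : (g * 1)%g \in C.
  have /SP := allS g; apply; rewrite inE; apply/asboolP.
  by exists 1%g, 1%g, 1%g; rewrite !group1 pmat1 !mulg1.
by rewrite mulg1 inE => /asboolP.
Qed.

End RootElements.

(** * Levi parts of unitriangular matrices *)

Section LeviPart.
Variables (F : finFieldType) (n : nat).
Local Notation gT := (GLT F n).
Local Notation I := 'I_n.-1.+1.
Local Notation U := (prad F (@nat_of_ord n.-1.+1)).
Implicit Types (g h x u v : gT) (i j k : I) (s t : 'S_n.-1.+1) (b : I -> nat) (a c : F).

(** The projection of [U] on its intersection with the Levi subgroup, along the unipotent
    radical. *)
Definition levi_part b u : gT :=
  GLof (\matrix_(i, j) if b i == b j then val u i j else 0).

Lemma levi_partE b u i j : u \in U ->
  val (levi_part b u) i j = if b i == b j then val u i j else 0.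
Proof.
move/pradP => uU; rewrite GLofK ?mxE // unitmxE -det_tr det_trig; last first.
  apply/is_trig_mxP => k l kl; rewrite !mxE; case: ifP => // _.
  by rewrite uU ?(ltnW kl) //; case: (l =P k) kl => // ->; rewrite ltnn.
by rewrite big1 ?unitr1 // => k _; rewrite !mxE eqxx uU // eqxx.
Qed.

Lemma levi_part_U b u : u \in U -> levi_part b u \in U.
Proof.
move=> uU; apply/pradP => i j ji; rewrite levi_partE //.
case: (i =P j) => [->|/eqP nij]; first by rewrite eqxx; move/pradP: uU => ->; rewrite ?eqxx.
by case: ifP => // _; move/pradP: uU => ->; rewrite ?(negPf nij).
Qed.

Lemma levi_part_levi b u : u \in U -> levi_part b u \in levi F b.
Proof.
by move=> uU; apply/leviP => i j ij; rewrite levi_partE // eq_sym (negPf ij).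
Qed.

Lemma levi_part_id b u : u \in U -> u \in levi F b -> levi_part b u = u.
Proof.
move=> uU /leviP uL; apply: GL_eqP => i j; rewrite levi_partE //.
by case: eqP => // /eqP; rewrite eq_sym => /uL->.
Qed.

Lemma levi_part1 b u : block_fun b -> u \in prad F b -> levi_part b u = 1%g.
Proof.
move=> bm uP; have uU := subsetP (pradS F (block_fun_coarser bm)) _ uP.
apply: GL_eqP => i j; rewrite levi_partE // GL_oneE; move/pradP: uP => uP.
case: eqP => [e|ne]; first by rewrite uP // e.
by case: (i =P j) ne => // ->.
Qed.

Lemma levi_partM b u v : block_fun b -> u \in U -> v \in U ->
  levi_part b (u * v)%g = (levi_part b u * levi_part b v)%g.
Proof.
move=> bm uU vU; apply: GL_eqP => i j.
rewrite levi_partE ?groupM // !GL_mulE.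
under [RHS]eq_bigr => k _ do rewrite !levi_partE //.
case: eqP => [bij|nij]; last first.
  rewrite big1 // => k _; case: eqP => [bik|_]; last by rewrite mul0r.
  by case: eqP => [bkj|_]; rewrite ?mulr0 //; case: nij; rewrite bik.
apply: eq_bigr => k _; rewrite -bij (eq_sym (b k)); case: eqP => // nik.
rewrite mul0r; move/pradP: uU => uU; move/pradP: vU => vU.
case: (leqP k i) => [ki|ik].
  by rewrite uU // (negPf (_ : i != k)) ?mul0r //; apply/eqP => e; rewrite e in nik.
case: (leqP j k) => [jk|kj].
  by rewrite vU // (negPf (_ : k != j)) ?mulr0 //; apply/eqP => e; rewrite e -bij in nik.
by case: nik; apply/eqP; rewrite eqn_leq (bm _ _ (ltnW ik)) bij (bm _ _ (ltnW kj)).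
Qed.

(** A matrix of [U] and its Levi part have the same diagonal blocks, and the inverse of the
    Levi part is block diagonal, so the quotient has identity diagonal blocks. *)
Lemma levi_part_rad b u : block_fun b -> u \in U -> ((levi_part b u)^-1 * u)%g \in prad F b.
Proof.
move=> bm uU; have lU := levi_part_U b uU; have lL := levi_part_levi b uU.
have : ((levi_part b u)^-1)%g \in levi F b by rewrite groupV.
have e : ((levi_part b u)^-1 * levi_part b u)%g = 1%g by rewrite mulVg.
move: e; move: ((levi_part b u)^-1)%g => w e /leviP wL.
apply/pradP => i j; rewrite leq_eqVlt => /predU1P[bji|bji]; last first.
  rewrite GL_mulE big1 => [|k _].
    by case: (i =P j) bji => // ->; rewrite ltnn.
  case: (eqVneq (b k) (b i)) => [bki|/wL->]; last by rewrite mul0r.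
  have /sparP uB : u \in spar F b.
    by apply: (subsetP (sparS F (block_fun_coarser bm))); apply: (subsetP (U_sub_B F n)).
  by rewrite uB ?mulr0 // bki.
have := congr1 (fun g => val g i j) e; rewrite GL_oneE => <-; rewrite !GL_mulE.
apply: eq_bigr => k _; rewrite levi_partE //.
case: (eqVneq (b k) (b i)) => [bki|/wL->]; last by rewrite !mul0r.
by rewrite bki bji eqxx.
Qed.

Lemma levi_conj_U b s u : block_incr b s -> u \in U -> u \in levi F b -> (u ^ pmat F s)%g \in U.
Proof.
move=> bs /pradP uU /leviP uL; apply/pradP => j l lj; rewrite conj_pmatE.
have [le|lt] := leqP (s^-1 l)%g (s^-1 j)%g.
  by rewrite uU // (inj_eq perm_inj).
have [e|ne] := eqVneq (b (s^-1 l)%g) (b (s^-1 j)%g).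
  by have := bs _ _ lt (esym e); rewrite !permKV ltnNge lj.
by rewrite uL //; case: (j =P l) lt => // ->; rewrite ltnn.
Qed.

(** Every unitriangular matrix is a product of root elements: clear the entries
    column by column from the left. *)
Lemma U_ind (Q : gT -> Prop) : Q 1%g ->
  (forall u i j a, (i < j)%N -> u \in U -> Q u -> Q (u * xroot i j a)%g) ->
  forall u, u \in U -> Q u.
Proof.
move=> Q1 QM u; pose A u := [set ij : I * I | (ij.1 < ij.2)%N & val u ij.1 ij.2 != 0].
have [m] := ubnP #|A u|; elim: m u => // m IH u; rewrite ltnS => Am uU.
have [A0|[ij0 ij0A]] := set_0Vmem (A u).
  suff -> : u = 1%g by [].
  apply: GL_eqP => i j; rewrite GL_oneE; have [ji|ij] := leqP j i; first by move/pradP: uU => ->.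
  have nij : i != j by rewrite -(inj_eq val_inj) neq_ltn ij.
  apply/eqP; rewrite (negPf nij); apply: contraT => uij.
  by have := in_set0 (i, j); rewrite -A0 inE /= ij uij.
case: (@arg_minnP _ ij0 (mem (A u)) (fun ij => nat_of_ord ij.2) ij0A) => -[i j] /=.
rewrite inE /= => /andP[ij uij] jmin.
have nij : i != j by rewrite -(inj_eq val_inj) neq_ltn ij.
have xU c : xroot i j c \in U by rewrite xroot_prad.
set u' := (u * xroot i j (- val u i j))%g.
have u'U : u' \in U by rewrite groupM.
have -> : u = (u' * xroot i j (val u i j))%g.
  by rewrite -mulgA xrootD // addNr xroot0 // mulg1.
apply: (QM _ _ _ _ ij u'U); apply: IH => //; apply: leq_trans Am.
have u'E (k l : I) : (k < l)%N -> val u' k l = if (k == i) && (l == j) then 0 else val u k l.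
  move=> kl; rewrite mul_xrootE //; case: (l =P j) => [ej|_]; last by rewrite andbF mulr0 addr0.
  rewrite andbT mulr1 ej; case: (k =P i) => [->|/eqP nki].
    by move/pradP/(_ i i (leqnn _)): (uU) => ->; rewrite eqxx mul1r subrr.
  have -> : val u k i = 0; last by rewrite mul0r addr0.
  have [ik|ki] := leqP i k; first by move/pradP: (uU) => ->; rewrite // (negPf nki).
  apply/eqP/contraT => uki; have /= := jmin (k, i); rewrite inE /= ki uki => /(_ isT).
  by rewrite leqNgt ij.
apply: proper_card; apply/properP; split.
  apply/subsetP => -[k l]; rewrite !inE /= => /andP[kl]; rewrite kl u'E //.
  by case: ifP => //; rewrite eqxx.
exists (i, j); first by rewrite inE /= ij.
by rewrite inE /= ij u'E // !eqxx.
Qed.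

Lemma torus_conjE (d : I -> F) i j a : (forall k, d k != 0) -> i != j ->
  (xroot i j a ^ torus d)%g = xroot i j ((d i)^-1 * a * d j).
Proof.
move=> d0 nij; apply: (mulgI (torus d)); rewrite -conjgC; apply: GL_eqP => k l.
rewrite mul_xrootE // xroot_mulE // !torusE //.
have [->|nki] := eqVneq k i; last by rewrite !mul0r.
rewrite !mulr1n mul1r (eq_sym j) -!mulrA mulVKf //.
by rewrite mulr_natr.
Qed.

End LeviPart.

(** * The group ring *)

(* Unification must not compare group elements by computing with matrices. *)
Opaque GLT.

Section GroupAlgebraTheory.
Variables (R : comPzRingType) (gT : finGroupType).
Local Notation RG := (galg R gT).
Implicit Types (x y z : RG) (g h : gT) (H K : {group gT}) (A : {set gT}).

Lemma coefgM x y g : coefg (x * y) g = \sum_h coefg x h * coefg y (h^-1 * g)%g.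
Proof. exact: galg_ofE. Qed.

Lemma galg_scalerAl (a : R) x y : a *: (x * y) = a *: x * y.
Proof.
apply: galgP => g; rewrite coefgZ !coefgM mulr_sumr.
by apply: eq_bigr => h _; rewrite coefgZ mulrA.
Qed.

Lemma galg_scalerAr (a : R) x y : a *: (x * y) = x * (a *: y).
Proof.
apply: galgP => g; rewrite coefgZ !coefgM mulr_sumr.
by apply: eq_bigr => h _; rewrite coefgZ mulrCA.
Qed.

(** The group element [g] in the group ring, locked so that it never unfolds to a
    function. *)
Definition gel : gT -> RG := locked (@gbase R gT).
Local Notation "[ 'b' g ]" := (gel g) (format "[ 'b'  g ]").

Lemma gelE g : [b g] = gbase R g.
Proof. by rewrite /gel -lock. Qed.

Lemma gel1 : [b 1%g] = 1 :> RG.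
Proof. by rewrite gelE; apply: galgP => g; rewrite galg_ofE. Qed.

Lemma gelM g h : [b g] * [b h] = [b (g * h)%g].
Proof. by rewrite !gelE gbaseM. Qed.

Lemma hatE A : hat R A = \sum_(g in A) [b g].
Proof. by apply: eq_bigr => g _; rewrite gelE. Qed.

Lemma coefg_gel g h : coefg [b g] h = (h == g)%:R.
Proof. by rewrite gelE; apply: galg_ofE. Qed.

Lemma coefg_sum (I : Type) (r : seq I) (P : pred I) (f : I -> RG) g :
  coefg (\sum_(i <- r | P i) f i) g = \sum_(i <- r | P i) coefg (f i) g.
Proof.
by elim/big_rec2: _ => [|i y z _ <-]; [rewrite /coefg ffunE | rewrite coefgD].
Qed.

Lemma coefg_gelM g x h : coefg ([b g] * x) h = coefg x (g^-1 * h)%g.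
Proof.
rewrite coefgM (bigD1 g) //= coefg_gel eqxx mul1r big1 ?addr0 // => k /negPf kg.
by rewrite coefg_gel kg mul0r.
Qed.

Lemma galg_sumE x : x = \sum_g coefg x g *: [b g].
Proof.
apply: galgP => g; rewrite coefg_sum (bigD1 g) //= coefgZ coefg_gel eqxx mulr1.
by rewrite big1 ?addr0 // => h /negPf hg; rewrite coefgZ coefg_gel eq_sym hg mulr0.
Qed.

Lemma gel_hat H g : g \in H -> [b g] * hat R H = hat R H.
Proof.
move=> gH; rewrite hatE mulr_sumr (reindex_inj (mulgI g^-1%g)) /=.
by apply: eq_big => h; rewrite ?groupMl ?groupV // => _; rewrite gelM mulKVg.
Qed.

Lemma hat_gel H g : g \in H -> hat R H * [b g] = hat R H.
Proof.
move=> gH; rewrite hatE mulr_suml (reindex_inj (mulIg g^-1%g)) /=.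
by apply: eq_big => h; rewrite ?groupMr ?groupV // => _; rewrite gelM mulgKV.
Qed.

Lemma hat_norm A g : g \in 'N(A)%g -> [b g] * hat R A = hat R A * [b g].
Proof.
move=> gN; rewrite hatE mulr_sumr mulr_suml (reindex_inj (conjg_inj g)) /=.
by apply: eq_big => h; rewrite ?memJ_norm // => _; rewrite !gelM -conjgC.
Qed.

End GroupAlgebraTheory.

(** * The Steinberg lattice *)

Section Steinberg.
Variables (F : finFieldType) (n : nat) (R : idomainType).
Local Notation gT := (GLT F n).
Local Notation I := 'I_n.-1.+1.
Local Notation RG := (galg R gT).
Local Notation B := (spar F (@nat_of_ord n.-1.+1)).
Local Notation U := (prad F (@nat_of_ord n.-1.+1)).
Local Notation T := (levi F (@nat_of_ord n.-1.+1)).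
Local Notation P s := (pmat F s).
Local Notation "[ 'b' g ]" := (gel R g) (format "[ 'b'  g ]").
Implicit Types (x y z : RG) (g h u v : gT) (i j k : I) (s t : 'S_n.-1.+1).

(** [chamber g] is the sum of the coset [g B]: a chamber of the building. The generator of
    the lattice is the alternating sum of the chambers of the standard apartment. *)
Definition chamber g : RG := [b g] * hat R B.

Lemma chamberM g h : [b g] * chamber h = chamber (g * h)%g.
Proof. by rewrite /chamber mulrA gelM. Qed.

Lemma chamber_fix g s : (g ^ P s)%g \in B -> chamber (g * P s)%g = chamber (P s).
Proof. by move=> gB; rewrite conjgC /chamber -gelM -mulrA gel_hat. Qed.

Definition steps : RG := \sum_(s : 'S_n.-1.+1) (-1) ^+ s *: chamber (P s).

Lemma steinberg_genE : steinberg_gen F n R = steps.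
Proof. by apply: eq_bigr => s _; rewrite /chamber gelE. Qed.

Lemma perm_steps s : [b P s] * steps = (-1) ^+ s *: steps.
Proof.
rewrite mulr_sumr scaler_sumr (reindex_inj (mulgI s^-1%g)) /=; apply: eq_bigr => t _.
rewrite -galg_scalerAr chamberM -pmatM mulKVg scalerA odd_permM odd_permV.
by rewrite signr_addb.
Qed.

Lemma torus_steps g : g \in T -> [b g] * steps = steps.
Proof.
move=> gT'; rewrite mulr_sumr; apply: eq_bigr => s _; rewrite -galg_scalerAr chamberM.
by rewrite chamber_fix // (subsetP (T_sub_B F n)) ?torus_conj.
Qed.

Section RankOne.
Variables (i j : I) (ij : j = i.+1 :> nat).
Local Notation p := (P (tperm i j)).

(** The half of the standard apartment that the root subgroup of [(i, j)] fixes; the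
    transposition exchanges it with the other half. *)
Definition half_steps : RG := \sum_(s : 'S_n.-1.+1 | (s i < s j)%N) (-1) ^+ s *: chamber (P s).

Lemma half_steps_fix g : (forall s, (s i < s j)%N -> (g ^ P s)%g \in B) ->
  [b g] * half_steps = half_steps.
Proof.
move=> gB; rewrite mulr_sumr; apply: eq_bigr => s /gB; rewrite -galg_scalerAr chamberM.
by move/chamber_fix->.
Qed.

Lemma steps_half : steps = half_steps - [b p] * half_steps.
Proof.
rewrite /steps (bigID (fun s : 'S_n.-1.+1 => (s i < s j)%N)) /=; congr (_ + _).
rewrite mulr_sumr -sumrN (reindex_inj (mulgI (tperm i j))) /=.
apply: eq_big => s; rewrite ?permM ?tpermL ?tpermR.
  by rewrite -leqNgt leq_eqVlt (inj_eq val_inj) (inj_eq perm_inj) (negPf (simple_neq ij)).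
move=> _; rewrite -galg_scalerAr chamberM -pmatM odd_permM odd_tperm (simple_neq ij).
by case: (odd_perm s); rewrite /= ?expr0 ?expr1 ?scaleN1r ?scale1r ?opprK.
Qed.

(** The root subgroup moves only the half apartment that the transposition [p] makes of the
    fixed one, and on this half [p x(a)] acts as [x(1/a)] by [simple_flip]. *)
Lemma flip_steps a : a != 0 ->
  [b p] * ([b xroot i j a] * steps) = [b xroot i j a^-1] * steps - steps.
Proof.
move=> a0; have pp : (p * p = 1)%g by rewrite -pmatM tperm2 pmat1.
have xfix c : [b xroot i j c] * half_steps = half_steps.
  by apply: half_steps_fix => s; apply: xroot_fix.
have [h [he hB]] := simple_flip ij a0.
rewrite steps_half !mulrBr !xfix.
have -> : [b p] * ([b xroot i j a] * ([b p] * half_steps)) =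
          [b xroot i j a^-1] * ([b p] * half_steps).
  rewrite !mulrA !gelM he -!mulgA pp mulg1 -[in RHS]gelM -[in LHS]gelM -[in LHS]gelM -!mulrA.
  by rewrite half_steps_fix.
by rewrite opprB [RHS]addrC addrA subrK.
Qed.

End RankOne.

Definition Uspan x := exists c : gT -> R, x = \sum_(u in U) c u *: ([b u] * steps).

Lemma UspanD x y : Uspan x -> Uspan y -> Uspan (x + y).
Proof.
move=> [c ->] [d ->]; exists (fun u => c u + d u); rewrite -big_split /=.
by apply: eq_bigr => u _; rewrite scalerDl.
Qed.

Lemma UspanZ a x : Uspan x -> Uspan (a *: x).
Proof.
move=> [c ->]; exists (fun u => a * c u); rewrite scaler_sumr.
by apply: eq_bigr => u _; rewrite scalerA.
Qed.

Lemma Uspan0 : Uspan 0.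
Proof. by exists (fun=> 0); rewrite big1 // => u _; rewrite scale0r. Qed.

Lemma Uspan_sum (J : Type) (r : seq J) (Q : pred J) (f : J -> RG) :
  (forall a, Q a -> Uspan (f a)) -> Uspan (\sum_(a <- r | Q a) f a).
Proof. by move=> fQ; apply: big_ind => //; [apply: Uspan0|apply: UspanD]. Qed.

Lemma Uspan_base u : u \in U -> Uspan ([b u] * steps).
Proof.
move=> uU; exists (fun v => (v == u)%:R); rewrite (bigD1 u) //= eqxx scale1r big1 ?addr0 //.
by move=> v /andP[_ /negPf ->]; rewrite scale0r.
Qed.

Lemma Uspan_steps : Uspan steps.
Proof. by rewrite -[steps]mul1r -gel1; apply: Uspan_base; apply: group1. Qed.

Lemma Uspan_stable g : (forall u, u \in U -> Uspan ([b g] * ([b u] * steps))) ->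
  forall x, Uspan x -> Uspan ([b g] * x).
Proof.
move=> gU x [c ->]; rewrite mulr_sumr; apply: Uspan_sum => u uU.
by rewrite -galg_scalerAr; apply/UspanZ/gU.
Qed.

Lemma Uspan_U u x : u \in U -> Uspan x -> Uspan ([b u] * x).
Proof.
move=> uU; apply: Uspan_stable => v vU; rewrite mulrA gelM.
by apply/Uspan_base/groupM.
Qed.

(** The span of the [U]-translates of the Steinberg element is stable under [B], because
    the torus fixes this element, and under the simple transpositions, by [flip_steps]. *)
Lemma Uspan_ideal x : Uspan (x * steps).
Proof.
suff gS g : Uspan ([b g] * steps).
  rewrite [x]galg_sumE mulr_suml; apply: Uspan_sum => g _.
  by rewrite -galg_scalerAl; apply: UspanZ.
pose S := [set g : gT | `[< forall x, Uspan x -> Uspan ([b g] * x) >]].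
have SP g0 : reflect (forall x, Uspan x -> Uspan ([b g0] * x)) (g0 \in S).
  by rewrite inE; apply: asboolP.
have grS : group_set S.
  apply/group_setP; split=> [|g1 g2 /SP g1S /SP g2S]; apply/SP => y yS.
    by rewrite gel1 mul1r.
  by rewrite -gelM -mulrA; apply/g1S/g2S.
suff: g \in Group grS by move/SP; apply; apply: Uspan_steps.
apply: GL_gen => [|i j ij].
  apply/subsetP => b bB; apply/SP; apply: Uspan_stable => u uU.
  have buB : (b * u)%g \in B by rewrite groupM // (subsetP (U_sub_B F n)).
  have [v [t [vU tT e]]] := borel_UT buB.
  by rewrite mulrA gelM e -gelM -mulrA torus_steps //; apply: Uspan_base.
apply/SP; apply: Uspan_stable => u uU.
have [u1 [u1U u1s ->]] := simple_split ij uU.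
set a := val u i j; set p := pmat F (tperm i j) in u1s *.
have -> : [b p] * ([b (u1 * xroot i j a)%g] * steps) =
    [b (u1 ^ p)%g] * ([b p] * ([b xroot i j a] * steps)).
  have pV : (p^-1)%g = p by rewrite -pmatV tpermV.
  have pp : (p * p = 1)%g by rewrite -{1}pV mulVg.
  rewrite !mulrA !gelM; congr ([b _] * _).
  by rewrite conjgE pV -!mulgA (mulgA p p) pp mul1g.
apply: (Uspan_U u1s); have [->|a0] := eqVneq a 0.
  rewrite xroot0 ?(simple_neq ij) // gel1 mul1r perm_steps.
  by apply/UspanZ/Uspan_steps.
rewrite flip_steps //; apply: UspanD; last by rewrite -scaleN1r; apply/UspanZ/Uspan_steps.
by apply: Uspan_base; rewrite xroot_prad ?ij.
Qed.

Lemma coef_steps g : coefg steps g = \sum_(s : 'S_n.-1.+1) (-1) ^+ s * ((P s)^-1 * g \in B)%g%:R.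
Proof.
rewrite coefg_sum; apply: eq_bigr => s _; rewrite coefgZ coefg_gelM; congr (_ * _).
rewrite hatE coefg_sum; case: (boolP ((P s)^-1 * g \in B)%g) => gB.
  rewrite (bigD1 _ gB) /= coefg_gel eqxx big1 ?addr0 // => h /andP[_ /negPf hg].
  by rewrite coefg_gel eq_sym hg.
by rewrite big1 // => h hB; rewrite coefg_gel; case: eqP => // e; rewrite e hB in gB.
Qed.

(** By the uniqueness in the Bruhat decomposition only one summand of the Steinberg
    element contributes at a monomial place. *)
Lemma coef_span (c : gT -> R) s :
  coefg (\sum_(u in U) c u *: ([b u] * steps)) (P s) =
  (-1) ^+ s * \sum_(u in U | (u ^ P s)%g \in B) c u.
Proof.
rewrite coefg_sum mulr_sumr big_mkcondr /=; apply: eq_bigr => u uU.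
rewrite coefgZ coefg_gelM coef_steps (bigD1 s) //= big1 ?addr0 => [|t ts]; last first.
  case: (boolP (_ \in B)) => [|_]; rewrite ?mulr0 // mulgA => /bruhat_uniq e.
  by rewrite e ?eqxx ?groupV in ts.
have -> : ((P s)^-1 * (u^-1 * P s) = (u ^ P s)^-1)%g by rewrite -conjVg conjgE.
have -> : ((u ^ P s)^-1 \in B)%g = (u ^ P s \in B)%g by exact: groupV.
by case: (_ \in B); rewrite ?mulr0 ?mulr1 // mulrC.
Qed.

End Steinberg.

(** * Eigenvectors of the unitriangular group *)

Section Eigenvectors.
Variables (F : finFieldType) (n : nat) (R : idomainType).
Local Notation gT := (GLT F n).
Local Notation I := 'I_n.-1.+1.
Local Notation RG := (galg R gT).
Local Notation B := (spar F (@nat_of_ord n.-1.+1)).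
Local Notation U := (prad F (@nat_of_ord n.-1.+1)).
Local Notation P s := (pmat F s).
Local Notation "[ 'b' g ]" := (gel R g) (format "[ 'b'  g ]").
Local Notation steps := (steps F n R).
Implicit Types (x y z : RG) (g h u v : gT) (i j k : I) (s t : 'S_n.-1.+1) (b : I -> nat).
Implicit Types lam mu : gT -> R.

Lemma U_sub_Bin u : u \in U -> u \in B.
Proof. exact: (subsetP (U_sub_B F n)). Qed.

Lemma coef_span_shift (c : gT -> R) v s : v \in U ->
  coefg (\sum_(u in U) c u *: ([b u] * steps)) (v * P s)%g =
  (-1) ^+ s * \sum_(u in U | (u ^ P s)%g \in B) c (v * u)%g.
Proof.
move=> vU; rewrite -(coef_span (fun u => c (v * u)%g)) -[v in LHS]invgK -coefg_gelM.
congr (coefg _ _); rewrite mulr_sumr (reindex_inj (mulgI v)) /=.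
apply: eq_big => u; first by rewrite groupMl.
by move=> _; rewrite -galg_scalerAr mulrA gelM mulKg.
Qed.

(** The longest element of the Weyl group of a Levi subgroup: it cuts the unipotent
    radical of the parabolic subgroup out of [U]. *)
Lemma longest b : block_fun b -> exists w : 'S_n.-1.+1, (forall i, b (w i) = b i) /\
  forall u, u \in U -> ((u ^ P w^-1)%g \in B) = (u \in prad F b).
Proof.
move=> bm; have [w [bw wP]] := @block_sort _ b (perm (@rev_ord_inj _)) bm.
exists w; split=> // u uU; apply/idP/idP => [/sparP uw|uP]; last first.
  apply: U_sub_Bin; apply: (subsetP (pradS F (block_fun_coarser bm))).
  have wN : P w^-1 \in 'N(prad F b)%g.
    apply: (subsetP (prad_norm F b)); rewrite pmatV groupV.
    by apply: (subsetP (levi_sub F b)); apply: pmat_spar.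
  by rewrite memJ_norm.
move/pradP: uU => uU; apply/pradP => i j bij.
have [ji|ij] := leqP j i; first exact: uU.
have ebij : b i = b j by apply/eqP; rewrite eqn_leq bij bm // ltnW.
have ebij' : b (w^-1 i)%g = b (w^-1 j)%g by rewrite -[LHS]bw -[RHS]bw !permKV.
have lt : (w^-1 j < w^-1 i)%g%N.
  rewrite ltnNge leq_eqVlt; apply/negP => /predU1P[/val_inj/perm_inj e|lt].
    by rewrite e ltnn in ij.
  have := wP _ _ lt ebij'; rewrite !permM !permKV !permE /=.
  by have := ltn_ord j; lia.
have := uw _ _ lt; rewrite conj_pmatE invgK !permKV => ->.
by case: (i =P j) ij => // ->; rewrite ltnn.
Qed.

Lemma longest_all : exists w : 'S_n.-1.+1, forall u, u \in U -> (u ^ P w)%g \in B -> u = 1%g.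
Proof.
have [|w [_ wP]] := @longest (fun=> 0%N); first by [].
exists (w^-1)%g => u uU; rewrite wP // => /pradP u1.
by apply: GL_eqP => i j; rewrite u1 // GL_oneE.
Qed.

(** The longest element conjugates no non-trivial element of [U] into [B], so each
    coefficient is read off at one place of the big Bruhat cell. *)
Lemma Uspan_free (c : gT -> R) : \sum_(u in U) c u *: ([b u] * steps) = 0 ->
  forall u, u \in U -> c u = 0.
Proof.
have [w w1] := longest_all; move=> c0 v vU.
have := coef_span_shift c w vU; rewrite c0 (bigD1 1%g) /=; last first.
  by rewrite group1 conj1g group1.
rewrite big1 => [|u /andP[/andP[uU uB] u1]]; last by rewrite (w1 u) ?eqxx in u1.
rewrite mulg1 addr0 {1}/coefg ffunE => /esym/eqP.
by rewrite mulf_eq0 signr_eq0 => /eqP.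
Qed.

(** A character of [U] is encoded as a function on the whole group, of which only the
    values on [U] matter. *)
Definition Uchar lam := {in U, forall u, lam u \is a GRing.unit} /\
  {in U &, {morph lam : u v / (u * v)%g >-> u * v}}.

Lemma Uchar1 lam : Uchar lam -> lam 1%g = 1.
Proof.
case=> lu lM; have u1 := lu 1%g (group1 _).
by apply: (mulrI u1); rewrite -lM ?group1 // mulg1 mulr1.
Qed.

Lemma UcharV lam u : Uchar lam -> u \in U -> lam u * lam u^-1%g = 1.
Proof. by move=> lc uU; case: (lc) => _ lM; rewrite -lM ?groupV // mulgV Uchar1. Qed.

Lemma Uchar_triv : Uchar (fun=> 1).
Proof. by split=> [u _|u v _ _]; rewrite ?unitr1 ?mulr1. Qed.

Definition ehat lam : RG := \sum_(u in U) lam u *: [b u].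
Definition Evec lam : RG := ehat lam * steps.

Lemma ehat_triv : ehat (fun=> 1) = hat R U.
Proof. by rewrite hatE; apply: eq_bigr => u _; rewrite scale1r. Qed.

Lemma EvecE lam : Evec lam = \sum_(u in U) lam u *: ([b u] * steps).
Proof. by rewrite /Evec mulr_suml; apply: eq_bigr => u _; rewrite galg_scalerAl. Qed.

Lemma ehat_gel lam u : Uchar lam -> u \in U -> ehat lam * [b u] = lam u^-1%g *: ehat lam.
Proof.
move=> lc uU; rewrite mulr_suml scaler_sumr (reindex_inj (mulIg u^-1%g)) /=.
apply: eq_big => v; rewrite ?groupMr ?groupV // => vU.
by case: (lc) => _ lM; rewrite -galg_scalerAl gelM mulgKV lM ?groupV // mulrC scalerA.
Qed.

Lemma gel_ehat lam u : Uchar lam -> u \in U -> [b u] * ehat lam = lam u^-1%g *: ehat lam.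
Proof.
move=> lc uU; rewrite mulr_sumr scaler_sumr (reindex_inj (mulgI u^-1%g)) /=.
apply: eq_big => v; rewrite ?groupMl ?groupV // => vU.
by case: (lc) => _ lM; rewrite -galg_scalerAr gelM mulKVg lM ?groupV // scalerA.
Qed.

Lemma ehat_eigen lam x : Uchar lam -> (forall u, u \in U -> [b u] * x = lam u^-1%g *: x) ->
  ehat lam * x = #|U|%:R *: x.
Proof.
move=> lc xE; rewrite mulr_suml.
under eq_bigr => u uU do rewrite -galg_scalerAl xE // scalerA UcharV // scale1r.
by rewrite sumr_const scaler_nat.
Qed.

Lemma gel_Evec lam u : Uchar lam -> u \in U -> [b u] * Evec lam = lam u^-1%g *: Evec lam.
Proof. by move=> lc uU; rewrite mulrA gel_ehat // -galg_scalerAl. Qed.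

(** The restriction of the lattice to [U] is the regular module: each character
    occurs once. *)
Lemma ehat_ideal lam x : Uchar lam -> exists r, ehat lam * (x * steps) = r *: Evec lam.
Proof.
move=> lc; have [c ->] := Uspan_ideal x.
exists (\sum_(u in U) c u * lam u^-1%g); rewrite mulr_sumr scaler_suml; apply: eq_bigr => u uU.
by rewrite -galg_scalerAr mulrA ehat_gel // -galg_scalerAl scalerA.
Qed.

(** The coordinate of [Evec lam] at the identity of [U] is [1]. *)
Lemma Evec_inj lam a c : Uchar lam -> a *: Evec lam = c *: Evec lam -> a = c.
Proof.
move=> lc ac; apply/eqP; rewrite -subr_eq0; apply/eqP.
have ac0 : \sum_(u in U) ((a - c) * lam u) *: ([b u] * steps) = 0.
  transitivity ((a - c) *: Evec lam); last by rewrite scalerBl ac subrr.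
  by rewrite EvecE scaler_sumr; apply: eq_bigr => u _; rewrite scalerA.
have := Uspan_free (c := fun u => (a - c) * lam u) ac0 (group1 _).
by rewrite Uchar1 // mulr1.
Qed.

(** The [U]-invariants of the lattice have rank one, and evaluation at the identity
    computes the sum of the [U]-translates of a vector. *)
Lemma hatU_ideal x : hat R U * (x * steps) = coefg (x * steps) 1%g *: Evec (fun=> 1).
Proof.
have [c e] := Uspan_ideal x.
have := coef_span c 1%g; rewrite -e pmat1 odd_perm1 expr0 mul1r => ->.
rewrite e mulr_sumr scaler_suml big_mkcondr /=; apply: eq_bigr => u uU.
by rewrite conjg1 U_sub_Bin // -galg_scalerAr mulrA (hat_gel _ uU) /Evec ehat_triv.
Qed.

Lemma coef_Evec lam s : coefg (Evec lam) (P s) = (-1) ^+ s * \sum_(u in U | (u ^ P s)%g \in B) lam u.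
Proof. by rewrite EvecE coef_span. Qed.

(** The longest element of the Levi subgroup links the eigenvector of every character
    trivial on the radical to that of the trivial character: the evaluation at [w^-1] only
    sees the values of [lam] on the radical. *)
Lemma hatU_Evec_longest b w lam : block_fun b ->
  (forall u, u \in U -> ((u ^ P w^-1)%g \in B) = (u \in prad F b)) ->
  {in prad F b, forall u, lam u = 1} ->
  hat R U * ([b P w] * Evec lam) = ((-1) ^+ w * #|prad F b|%:R) *: Evec (fun=> 1).
Proof.
move=> bm wP lt; have -> : [b P w] * Evec lam = ([b P w] * ehat lam) * steps by rewrite mulrA.
rewrite hatU_ideal; congr (_ *: _).
rewrite -mulrA coefg_gelM mulg1 -pmatV coef_Evec odd_permV; congr (_ * _).
rewrite (eq_bigl (mem (prad F b))) => [|u]; last first.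
  have [uU|uU] := boolP (u \in U); first by rewrite wP.
  by apply/esym/negP => uP; case/negP: uU; apply: (subsetP (pradS F (block_fun_coarser bm))).
by rewrite (eq_bigr (fun=> 1)) ?sumr_const.
Qed.

End Eigenvectors.

(** * Characters of the unitriangular group *)

Section Orthogonality.
Variables (F : finFieldType) (R : idomainType).
Hypothesis natR : forall k, (k.+1)%:R != 0 :> R.
Implicit Types (f : F -> R) (a c : F).

Definition add_char f := f 0 = 1 /\ {morph f : a c / a + c >-> a * c}.

Lemma add_char_sum f : add_char f -> (exists a, f a != 1) -> \sum_a f a = 0.
Proof.
move=> [f0 fD] [c fc]; apply/eqP.
have : (f c - 1) * \sum_a f a == 0.
  rewrite mulrBl mul1r mulr_sumr [X in _ - X](reindex_inj (addrI c)) /= subr_eq0.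
  by apply/eqP/eq_bigr => a _; rewrite fD.
by rewrite mulf_eq0 subr_eq0 (negPf fc).
Qed.

(** The characters of [F] are the dilates of one of them: otherwise the double sum
    [\sum_c \sum_a f (- c a) g a] of character sums, which is [#|F|], vanishes. *)
Lemma add_char_dilate f g : add_char f -> add_char g ->
  (exists a, f a != 1) -> (exists a, g a != 1) ->
  exists2 c, c != 0 & forall a, g a = f (c * a).
Proof.
move=> [f0 fD] [g0 gD] fn [a1 ga1].
have fV a : f a * f (- a) = 1 by rewrite -fD addrN.
have chi c : add_char (fun a => f (- (c * a)) * g a).
  split=> [|a a'] /=; first by rewrite mulr0 oppr0 f0 g0 mulr1.
  rewrite mulrDr opprD fD gD. by rewrite mulrACA.
case: (pselect (exists c, forall a, f (- (c * a)) * g a = 1)) => [[c fg]|nfg].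
  have gE a : g a = f (c * a) by rewrite -[LHS]mul1r -(fV (c * a)) -mulrA fg mulr1.
  exists c => //; apply: contraNneq ga1 => c0.
  by rewrite gE c0 mul0r f0.
have S0 : \sum_c \sum_a f (- (c * a)) * g a = 0.
  apply: big1 => c _; apply: add_char_sum => //.
  apply: contrapT => nex; apply: nfg; exists c => a; apply/eqP/negPn/negP => na.
  by apply: nex; exists a.
have S1 : \sum_c \sum_a f (- (c * a)) * g a = #|F|%:R.
  rewrite exchange_big (bigD1 0) //= [X in _ + X]big1 => [|a a0].
    rewrite addr0 (eq_bigr (fun=> 1)) ?sumr_const // => c _.
    by rewrite mulr0 oppr0 f0 g0 mulr1.
  have inj : injective (fun c => - (c * a)) by move=> x y /oppr_inj/(mulIf a0).
  have e : \sum_c f (- (c * a)) = 0.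
    transitivity (\sum_c f c); last exact: add_char_sum.
    by rewrite [RHS](reindex_inj inj).
  by rewrite -mulr_suml e mul0r.
have : #|F| != 0%N by apply/eqP => /card0_eq/(_ 0).
by case: #|F| S1 (natR #|F|.-1) => // k; rewrite S0 => <-; rewrite eqxx.
Qed.

End Orthogonality.

Section Generic.
Variables (F : finFieldType) (n : nat) (R : idomainType).
Hypothesis natR : forall k, (k.+1)%:R != 0 :> R.
Local Notation gT := (GLT F n).
Local Notation I := 'I_n.-1.+1.
Local Notation RG := (galg R gT).
Local Notation U := (prad F (@nat_of_ord n.-1.+1)).
Local Notation T := (levi F (@nat_of_ord n.-1.+1)).
Local Notation "[ 'b' g ]" := (gel R g) (format "[ 'b'  g ]").
Local Notation steps := (steps F n R).
Implicit Types (x y z : RG) (g h u v : gT) (i j k : I) (s t : 'S_n.-1.+1) (b : I -> nat).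
Implicit Types (lam mu : gT -> R) (a c : F).

Lemma simple_U i j a : (i < j)%N -> xroot i j a \in U.
Proof. exact: xroot_prad. Qed.

Lemma Uchar_add lam i j : Uchar lam -> (i < j)%N -> add_char (fun a => lam (xroot i j a)).
Proof.
move=> lc ij; have nij : i != j by rewrite -(inj_eq val_inj) neq_ltn ij.
split=> [|a c]; first by rewrite xroot0 ?Uchar1.
by case: (lc) => _ lM; rewrite -xrootD // lM // simple_U.
Qed.

(** A root element away from the superdiagonal is a commutator of root elements, by
    [xroot_comm]. *)
Lemma Uchar_deep lam i j a : Uchar lam -> (i.+1 < j)%N -> lam (xroot i j a) = 1.
Proof.
move=> lc ij; have lt_k : (i.+1 < n.-1.+1)%N by apply: ltn_trans ij (ltn_ord j).
pose k := Ordinal lt_k; have ik : (i < k)%N by []; have kj : (k < j)%N by [].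
have nij : i != j by rewrite -(inj_eq val_inj) neq_ltn (ltn_trans ik).
have nik : i != k by rewrite -(inj_eq val_inj) neq_ltn ik.
have nkj : k != j by rewrite -(inj_eq val_inj) neq_ltn kj.
case: (lc) => lu lM; have := congr1 lam (xroot_comm a 1 nik nkj nij).
have ikU : xroot i k a \in U by apply: simple_U.
have kjU : xroot k j 1 \in U by apply: simple_U.
have ijU : xroot i j a \in U by apply: simple_U; apply: ltn_trans ik kj.
rewrite mulr1 !lM ?groupM // => e.
have u0 : lam (xroot k j 1) * lam (xroot i k a) \is a GRing.unit by rewrite unitrM !lu.
by apply: (mulrI u0); rewrite -e mulr1 mulrC.
Qed.

(** Root elements generate [U], and characters are trivial on those away from the
    superdiagonal. *)
Lemma Uchar_eq lam mu : Uchar lam -> Uchar mu ->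
  (forall i j a, j = i.+1 :> nat -> lam (xroot i j a) = mu (xroot i j a)) ->
  {in U, lam =1 mu}.
Proof.
move=> lc mc lmu; apply: U_ind => [|u i j a ij uU e]; first by rewrite !Uchar1.
case: (lc) (mc) => _ lM [_ mM]; rewrite lM ?mM ?simple_U // e; congr (_ * _).
move: ij; rewrite leq_eqVlt => /predU1P[/esym/lmu//|ij].
by rewrite !Uchar_deep.
Qed.

(** The condition that [b] is a block function of the parabolic subgroup of [lam], read on
    the simple root subgroups. *)
Definition generic lam b := Uchar lam /\ forall i j, j = i.+1 :> nat ->
  (exists a, lam (xroot i j a) != 1) <-> b i = b j.

(** By [Uchar_eq] the character factors through the Levi part, because it does so on the
    simple root elements. *)
Lemma generic_rad lam b : block_fun b -> generic lam b -> {in prad F b, forall u, lam u = 1}.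
Proof.
move=> bm [lc lg] u uP; have uU := subsetP (pradS F (block_fun_coarser bm)) _ uP.
have mc : Uchar (fun v => lam (levi_part b v)).
  case: (lc) => lu lM; split=> [v vU|v w vU wU]; first by apply/lu/levi_part_U.
  by rewrite levi_partM // lM // levi_part_U.
rewrite (Uchar_eq lc mc) // => [|i j a ij]; first by rewrite levi_part1 // Uchar1.
have lt : (i < j)%N by rewrite ij.
have nij : i != j by rewrite -(inj_eq val_inj) neq_ltn lt.
have [bij|nbij] := eqVneq (b i) (b j).
  by rewrite levi_part_id ?simple_U // xroot_levi.
rewrite levi_part1 // ?xroot_prad ?Uchar1 //; last first.
  by rewrite ltn_neqAle nbij bm // ltnW.
apply/eqP/negPn/negP => la; case/eqP: nbij; apply/(lg _ _ ij).
by exists a.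
Qed.

(** The diagonal matrices fix the generator [steps]. *)
Lemma torus_Evec lam mu g : g \in T -> Uchar mu -> {in U, forall u, mu u = lam (u ^ g)%g} ->
  [b g] * Evec lam = Evec mu.
Proof.
move=> gT' mc e; have gB := subsetP (T_sub_B F n) _ gT'.
have gN := subsetP (borel_norm F n) _ gB.
rewrite !EvecE mulr_sumr (reindex_inj (conjg_inj g)) /=.
apply: eq_big => u; first by rewrite memJ_norm.
rewrite memJ_norm // => uU; rewrite -galg_scalerAr mulrA gelM -conjgC -gelM -mulrA (torus_steps _ gT').
by rewrite e.
Qed.

(** On each simple root subgroup two non-trivial characters differ by a dilation, and
    conjugation by a diagonal matrix realises any family of dilations of the simple root
    subgroups. *)
Lemma generic_torus lam mu b : generic lam b -> generic mu b ->
  exists g, [b g] * Evec lam = Evec mu.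
Proof.
move=> [lc lg] [mc mg].
have /choice[c cP] (i : I) : exists c : F, c != 0 /\ forall j, j = i.+1 :> nat ->
    forall a, mu (xroot i j a) = lam (xroot i j (c * a)).
  case: (pselect (exists j : I, j = i.+1 :> nat)) => [[j ij]|nj]; last first.
    by exists 1; split=> [|j ij]; [apply: oner_neq0 | case: nj; exists j].
  have lt : (i < j)%N by rewrite ij.
  have jE j' : j' = i.+1 :> nat -> j' = j by move=> e; apply: val_inj; rewrite /= e ij.
  case: (eqVneq (b i) (b j)) => [bij|nbij].
    have [||||c c0 cE] := @add_char_dilate F R natR
      (fun a => lam (xroot i j a)) (fun a => mu (xroot i j a)).
    - exact: Uchar_add.
    - exact: Uchar_add.
    - exact/lg.
    - exact/mg.
    by exists c; split=> // j' /jE ->.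
  exists 1; split=> [|j' /jE -> a]; first exact: oner_neq0.
  have tr nu : (exists a, nu (xroot i j a) != 1) <-> b i = b j -> forall a, nu (xroot i j a) = 1 :> R.
    move=> h a'; apply/eqP/negPn/negP => na; case/eqP: nbij; apply/h.
    by exists a'.
  by rewrite (tr _ (lg _ _ ij)) (tr _ (mg _ _ ij)).
(* Conjugation by [torus d] dilates the root subgroup of [(i, i.+1)] by the quotient of
   [d i.+1] by [d i], which has to be [c i]. *)
pose d (j : I) : F := \prod_(k < n.-1.+1 | (k < j)%N) c k.
have d0 k : d k != 0 by apply/prodf_neq0 => i _; case: (cP i).
exists (torus d); apply: (torus_Evec (torus_levi _ d0) mc).
have tN : torus d \in 'N(U)%g.
  by apply: (subsetP (borel_norm F n)); apply: (subsetP (T_sub_B F n)); apply: torus_levi.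
have lc' : Uchar (fun u => lam (u ^ torus d)%g).
  case: (lc) => lu lM; split=> [u uU|u v uU vU]; first by rewrite lu ?memJ_norm.
  by rewrite conjMg lM ?memJ_norm.
apply: (Uchar_eq mc lc') => i j a ij.
have lt : (i < j)%N by rewrite ij.
have nij : i != j by rewrite -(inj_eq val_inj) neq_ltn lt.
rewrite torus_conjE //; case: (cP i) => _ /(_ _ ij a) ->; congr (lam (xroot i j _)).
have -> : d j = c i * d i.
  rewrite /d (bigD1 i) //=; congr (_ * _); apply: eq_bigl => k.
  by rewrite ij ltnS ltn_neqAle andbC.
by rewrite [RHS]mulrC -!mulrA mulVKf.
Qed.

End Generic.

(** * Operators on the Steinberg lattice *)

Section Operators.
Variables (F : finFieldType) (n : nat) (R : idomainType).
Hypothesis natR : forall k, (k.+1)%:R != 0 :> R.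
Local Notation gT := (GLT F n).
Local Notation I := 'I_n.-1.+1.
Local Notation RG := (galg R gT).
Local Notation B := (spar F (@nat_of_ord n.-1.+1)).
Local Notation U := (prad F (@nat_of_ord n.-1.+1)).
Local Notation P s := (pmat F s).
Local Notation "[ 'b' g ]" := (gel R g) (format "[ 'b'  g ]").
Local Notation steps := (steps F n R).
Implicit Types (x y z : RG) (g h u v : gT) (i j k : I) (s t : 'S_n.-1.+1) (b : I -> nat).
Implicit Types (lam mu : gT -> R) (a c : R).

Lemma card_natR (A : {group gT}) : #|A|%:R != 0 :> R.
Proof. by case: #|A| (cardG_gt0 A) => // k _; apply: natR. Qed.

(** The longest element of the Weyl group. *)
Definition wlong : 'S_n.-1.+1 := sval (cid (longest_all F n)).

Lemma wlongP u : u \in U -> (u ^ P wlong)%g \in B -> u = 1%g.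
Proof. exact: (svalP (cid (longest_all F n))). Qed.

(** The coordinates of a vector of the lattice in the basis of the [u * steps], read
    off on the big Bruhat cell. *)
Definition coord x u : R := (-1) ^+ wlong * coefg x (u * P wlong)%g.

Lemma coord_sum (J : Type) (r : seq J) (Q : pred J) (f : J -> RG) u :
  coord (\sum_(a <- r | Q a) f a) u = \sum_(a <- r | Q a) coord (f a) u.
Proof. by rewrite /coord coefg_sum mulr_sumr. Qed.

Lemma coordZ a x u : coord (a *: x) u = a * coord x u.
Proof. by rewrite /coord coefgZ mulrCA. Qed.

Lemma coord_span (c : gT -> R) v : v \in U ->
  coord (\sum_(u in U) c u *: ([b u] * steps)) v = c v.
Proof.
move=> vU; rewrite /coord coef_span_shift // mulrA -expr2 sqrr_sign mul1r.
rewrite (bigD1 1%g) /=; last by rewrite group1 conj1g group1.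
rewrite mulg1 big1 ?addr0 // => u /andP[/andP[uU uB] u1].
by rewrite (wlongP uU uB) eqxx in u1.
Qed.

Lemma ideal_coord x :
  x * steps = \sum_(u in U) coord (x * steps) u *: ([b u] * steps).
Proof.
have [c e] := Uspan_ideal x; rewrite {1}e; apply: eq_bigr => u uU.
by rewrite e coord_span.
Qed.

Lemma coord_base u v : u \in U -> v \in U -> coord ([b u] * steps) v = (v == u)%:R.
Proof.
move=> uU vU; rewrite -(coord_span (fun v => (v == u)%:R)) //.
rewrite (bigD1 u) //= eqxx scale1r big1 ?addr0 // => w /andP[_ /negPf->].
by rewrite scale0r.
Qed.

Definition trace z : R := \sum_(u in U) coord (z * ([b u] * steps)) u.

Lemma trace_sum (J : Type) (r : seq J) (Q : pred J) (f : J -> RG) :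
  trace (\sum_(a <- r | Q a) f a) = \sum_(a <- r | Q a) trace (f a).
Proof.
rewrite /trace exchange_big; apply: eq_bigr => u _.
by rewrite mulr_suml coord_sum.
Qed.

Lemma traceZ a z : trace (a *: z) = a * trace z.
Proof.
by rewrite /trace mulr_sumr; apply: eq_bigr => u _; rewrite -galg_scalerAl coordZ.
Qed.

(** The left ideal is stable under both operators, so their matrices in the basis multiply
    as the operators do. *)
Lemma traceMC y z : trace (y * z) = trace (z * y).
Proof.
have e x x' : trace (x * x') =
    \sum_(u in U) \sum_(v in U) coord (x' * ([b u] * steps)) v * coord (x * ([b v] * steps)) u.
  apply: eq_bigr => u uU; rewrite -mulrA [x' * _]mulrA {1}ideal_coord mulr_sumr coord_sum.
  by apply: eq_bigr => v _; rewrite -galg_scalerAr coordZ -mulrA.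
rewrite !e exchange_big; apply: eq_bigr => u _; apply: eq_bigr => v _.
by rewrite mulrC.
Qed.

(** [U] permutes freely the basis of the lattice, so only the identity has a trace. *)
Lemma trace_hat (A : {group gT}) : A \subset U -> trace (hat R A) = #|U|%:R.
Proof.
move=> AU; rewrite hatE trace_sum (bigD1 1%g) ?group1 //= [X in _ + X]big1 ?addr0.
  rewrite /trace (eq_bigr (fun=> 1)) ?sumr_const // => u uU.
  by rewrite gel1 mul1r coord_base // eqxx.
move=> a /andP[aA a1]; rewrite /trace big1 // => u uU.
have aU := subsetP AU _ aA.
rewrite mulrA gelM coord_base ?groupM // -[X in X == _]mul1g (inj_eq (mulIg u)).
by rewrite eq_sym (negPf a1).
Qed.

(** An operator commuting with a parabolic subgroup is scalar on the invariants of its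
    unipotent radical: evaluation at [g] followed by the invariants of [U] recovers
    the vector on the parabolic subgroup, where it is determined. *)
Lemma commuting_scalar b z : block_fun b ->
  {in spar F b, forall g, [b g] * z = z * [b g]} ->
  exists k : R, forall x, {in prad F b, forall u, [b u] * (x * steps) = x * steps} ->
    z * (x * steps) = k *: (x * steps).
Proof.
move=> bm zP; have US : U \subset spar F b.
  exact: subset_trans (U_sub_B F n) (sparS F (block_fun_coarser bm)).
have PU : prad F b \subset U := pradS F (block_fun_coarser bm).
exists (coefg (z * steps) 1%g); set k := coefg _ _ => x xP.
have zU : hat R U * z = z * hat R U.
  by rewrite hatE mulr_suml mulr_sumr; apply: eq_bigr => u /(subsetP US)/zP.
have zE1 : z * Evec (fun=> 1) = k *: Evec (fun=> 1).
  by rewrite -hatU_ideal /Evec ehat_triv !mulrA zU.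
pose y : RG := z * x - k *: x.
have yE : y * steps = z * (x * steps) - k *: (x * steps).
  by rewrite mulrBl -galg_scalerAl mulrA.
suff y0 : y * steps = 0 by apply/eqP; rewrite -subr_eq0 -yE y0.
have yP g : g \in spar F b -> coefg (y * steps) g = 0.
  move=> gP; apply: (@Evec_inj F n R (fun=> 1) _ 0); first exact: Uchar_triv.
  have gVP : g^-1%g \in spar F b by rewrite groupV.
  have ev (w : RG) : hat R U * ([b g^-1%g] * (w * steps)) = coefg (w * steps) g *: Evec (fun=> 1).
    by rewrite [[b _] * _]mulrA hatU_ideal -mulrA coefg_gelM invgK mulg1.
  rewrite -ev yE scale0r mulrBr mulrBr (mulrA [b _]) (zP _ gVP) -(mulrA z) (mulrA (hat R U)) zU -(mulrA z).
  by rewrite ev -!galg_scalerAr ev zE1 !scalerA mulrC subrr.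
have yU u : u \in prad F b -> [b u] * (y * steps) = y * steps.
  move=> uP; rewrite yE mulrBr -galg_scalerAr xP // (mulrA [b u]) zP ?(subsetP (prad_sub F b)) //.
  by rewrite -mulrA xP.
have [w [bw wP]] := longest F bm.
have cU u v : u \in prad F b -> coord (y * steps) (u * v)%g = coord (y * steps) v.
  by move=> uP; rewrite /coord -{1}(yU u uP) coefg_gelM -mulgA mulKg.
rewrite ideal_coord big1 // => v vU.
suff -> : coord (y * steps) v = 0 by rewrite scale0r.
have vwP : (v * P w^-1)%g \in spar F b.
  have wb : P w \in spar F b := subsetP (levi_sub F b) _ (pmat_spar F bw).
  by rewrite pmatV groupM ?groupV // (subsetP US).
have := yP _ vwP; rewrite {1}ideal_coord coef_span_shift // => /eqP.
rewrite mulf_eq0 signr_eq0 /= (eq_bigl (mem (prad F b))) => [|u]; last first.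
  have [uU|uU] := boolP (u \in U); first by rewrite wP.
  by apply/esym/negP => /(subsetP PU); apply/negP.
rewrite (eq_bigr (fun=> coord (y * steps) v)) => [|u uP]; last first.
  rewrite -[(v * u)%g](mulgKV v) cU //; last first.
  have vN : v^-1%g \in 'N(prad F b)%g by rewrite groupV (subsetP (prad_norm F b)) // (subsetP US).
  have uP' : u \in prad F b := uP.
  by have := memJ_norm u vN; rewrite uP' conjgE invgK mulgA => ->.
rewrite sumr_const -mulr_natl mulf_eq0 (negPf (card_natR (prad_group F b))) /=.
by move/eqP.
Qed.

Lemma hat_hat_r (H : {group gT}) (A : {set gT}) : A \subset H ->
  hat R H * hat R A = #|A|%:R *: hat R H.
Proof.
move=> /subsetP AH; rewrite (hatE _ A) mulr_sumr (eq_bigr (fun=> hat R H)) => [|g /AH gH].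
  by rewrite sumr_const scaler_nat.
by rewrite hat_gel.
Qed.

(** The sum of the unipotent radical of [b'], an idempotent up to its order, is summed over
    its conjugates so as to commute with the parabolic subgroup of [b]. *)
Definition theta b b' : RG :=
  \sum_(g in spar F b) [b g] * (hat R (prad F b') * [b g^-1%g]).

(** [theta] is scalar on the invariants of the radical of [b], onto which the sum of this
    radical projects up to its order; the traces of [theta] and of that sum give the
    scalar. *)
Lemma theta_scalar b b' : block_fun b -> block_fun b' -> coarser b b' ->
  forall x, {in prad F b, forall u, [b u] * (x * steps) = x * steps} ->
  theta b b' * (x * steps) = (#|spar F b| * #|prad F b|)%:R *: (x * steps).
Proof.
move=> bm bm' bb.
have PU : prad F b \subset U := pradS F (block_fun_coarser bm).
have QU : prad F b' \subset U := pradS F (block_fun_coarser bm').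
have thP g : g \in spar F b -> [b g] * theta b b' = theta b b' * [b g].
  move=> gP; rewrite mulr_sumr mulr_suml (reindex_inj (mulgI g^-1%g)) /=.
  apply: eq_big => h; first by rewrite groupMl ?groupV.
  by move=> _; rewrite !mulrA gelM mulKVg -[RHS]mulrA gelM invMg invgK.
have [k kP] := commuting_scalar bm thP.
have thR : theta b b' * hat R (prad F b) = #|prad F b|%:R *: theta b b'.
  rewrite mulr_suml scaler_sumr; apply: eq_bigr => g gP.
  have gN : g^-1%g \in 'N(prad F b)%g by rewrite groupV (subsetP (prad_norm F b)).
  rewrite -!mulrA (hat_norm _ gN) (mulrA (hat _ _)) hat_hat_r ?pradS //.
  by rewrite -galg_scalerAl -galg_scalerAr.
have kE : k * #|U|%:R = (#|spar F b| * #|prad F b|)%:R * #|U|%:R.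
  have trP : trace (hat R (prad F b)) = #|U|%:R by rewrite trace_hat.
  have trT : trace (theta b b') = #|spar F b|%:R * #|U|%:R.
    rewrite trace_sum (eq_bigr (fun=> #|U|%:R)) ?sumr_const ?mulr_natl // => g _.
    by rewrite traceMC -mulrA gelM mulVg gel1 mulr1 trace_hat.
  have -> : k * #|U|%:R = trace (theta b b' * hat R (prad F b)).
    rewrite -trP /trace mulr_sumr; apply: eq_bigr => u uU.
    rewrite -coordZ; congr (coord _ u); rewrite -mulrA [hat _ _ * _]mulrA kP // => v vP.
    by rewrite !mulrA gel_hat.
  by rewrite thR traceZ trT mulrA natrM [#|_|%:R * _]mulrC.
have -> : (#|spar F b| * #|prad F b|)%:R = k.
  by apply: (mulIf (card_natR (prad_group F (@nat_of_ord n.-1.+1)))); rewrite -kE.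
by move=> x xP; rewrite kP.
Qed.

End Operators.

(** * Permutations reversing blocks *)

Section BlockCombinatorics.
Variable m : nat.
Implicit Types (i j k : 'I_m) (s t : 'S_m) (b : 'I_m -> nat).

Lemma coarser_eq b b' i j : coarser b b' -> b' i = b' j -> b i = b j.
Proof. by move=> bb e; apply/eqP; rewrite eqn_leq !bb // e. Qed.

Lemma block_fun_mid b i j k : block_fun b -> (i <= j)%N -> (j <= k)%N -> b i = b k -> b i = b j.
Proof.
by move=> bm ij jk e; apply/eqP; rewrite eqn_leq bm // e bm.
Qed.

(** On each block, [s] is a translation. *)
Definition block_shift b s := forall i j, j = i.+1 :> nat -> b i = b j -> s j = (s i).+1 :> nat.

Lemma block_shift_incr b s : block_fun b -> block_shift b s -> block_incr b s.
Proof.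
move=> bm bs i j; move: {2}(j - i)%N (leqnn (j - i)) => d.
elim: d i j => [|d IH] i j ijd ij bij; first lia.
have lt_k : (i.+1 < m)%N by apply: leq_ltn_trans ij (ltn_ord j).
pose k := Ordinal lt_k; have bik : b i = b k by apply: (block_fun_mid (k := j)) => //=.
have ski := bs i k erefl bik.
have [e|ne] := eqVneq k j; first by rewrite -e ski.
have kj : (k < j)%N by rewrite ltn_neqAle ne.
by apply: ltn_trans (IH k j _ kj _); rewrite ?ski //= -?bik //; lia.
Qed.

(** The labels [b' \o s^-1] weakly decrease along each block of [b], so [s] puts the blocks
    of [b'] in the reverse order, each on an interval. An index [k] strictly between the
    images of two neighbours of one block would come from the same block, and increase of
    [s] there leaves no place for it. *)
Lemma block_reversal b b' s : block_fun b -> block_fun b' -> coarser b b' ->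
  (forall i, b (s i) = b i) -> block_incr b' s ->
  (forall i j, j = i.+1 :> nat -> b i = b j -> (b' (s^-1 j)%g <= b' (s^-1 i)%g)%N) ->
  block_shift b' s.
Proof.
move=> bm bm' bb bs inc dec.
have decr d : forall i j, (j - i <= d)%N -> (i <= j)%N -> b i = b j ->
    (b' (s^-1 j)%g <= b' (s^-1 i)%g)%N.
  elim: d => [|d IH] i j ijd ij bij; first by have -> : i = j by apply: val_inj => /=; lia.
  have [->//|ne] := eqVneq i j.
  have lt : (i < j)%N by rewrite ltn_neqAle ne.
  have lt_k : (i.+1 < m)%N by apply: leq_ltn_trans lt (ltn_ord j).
  pose k := Ordinal lt_k; have bik : b i = b k by apply: (block_fun_mid (k := j)) => //=.
  by apply: leq_trans (IH k j _ _ _) (dec i k erefl bik); rewrite -?bik //=; lia.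
move=> i j ij bij; have lt : (i < j)%N by rewrite ij.
have slt := inc _ _ lt bij; apply/eqP; rewrite eqn_leq slt andbT leqNgt; apply/negP => gap.
have lt_k : ((s i).+1 < m)%N by apply: ltn_trans gap (ltn_ord _).
pose k := Ordinal lt_k.
have bsij : b (s i) = b (s j) by rewrite !bs; apply: coarser_eq bb bij.
have bk : b (s i) = b k by apply: (block_fun_mid (k := s j)) => //=; apply: ltnW.
have le1 := decr _ (s i) k (leqnn _) (leqnSn _) bk.
have le2 := decr _ k (s j) (leqnn _) (ltnW gap) (etrans (esym bk) bsij).
rewrite !permK in le1 le2.
have bke : b' (s^-1 k)%g = b' i by apply/eqP; rewrite eqn_leq le1 bij.
have [lt'|gt'|e] := ltngtP (s^-1 k)%g i.
- by have := inc _ _ lt' bke; rewrite permKV /= ltnNge leqnSn.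
- have [gt2|le2'] := ltnP j (s^-1 k)%g.
    have := inc _ _ gt2; rewrite bke permKV /= => /(_ (esym bij)).
    by rewrite ltnNge ltnW.
  have e : (s^-1 k)%g = j by apply: val_inj => /=; lia.
  by move: gap; rewrite -e permKV /= ltnn.
- have := congr1 s (val_inj e); rewrite permKV => /(congr1 val) /=; lia.
Qed.

End BlockCombinatorics.

(** * Links between eigenvectors modulo l *)

Section Links.
Variables (F : finFieldType) (n : nat) (R : idomainType) (l : nat).
Local Notation gT := (GLT F n).
Local Notation I := 'I_n.-1.+1.
Local Notation RG := (galg R gT).
Local Notation U := (prad F (@nat_of_ord n.-1.+1)).
Local Notation P s := (pmat F s).
Local Notation "[ 'b' g ]" := (gel R g) (format "[ 'b'  g ]").
Implicit Types (h y : RG) (u v : gT) (i j k : I) (s : 'S_n.-1.+1) (b : I -> nat).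
Implicit Types (lam mu : gT -> R) (a c : R).

Definition ldvd a := exists c, a = l%:R * c.

Hypothesis l_prime : prime l.
Hypothesis ldvd1 : ~ ldvd 1.
Hypothesis ldvdM : forall a c, ldvd (a * c) -> ldvd a \/ ldvd c.
Hypothesis l_U : ~~ (l %| #|U|)%N.

Lemma ldvd_mull a c : ldvd a -> ldvd (c * a).
Proof. by move=> [d ->]; exists (c * d); rewrite mulrCA. Qed.

Lemma ldvd_mulr a c : ldvd a -> ldvd (a * c).
Proof. by move=> [d ->]; exists (d * c); rewrite mulrA. Qed.

Lemma ldvd_nat (k : nat) : ~~ (l %| k)%N -> ~ ldvd k%:R.
Proof.
move=> lk [c kc]; apply: ldvd1.
have k0 : (0 < k)%N by case: k lk {kc}; rewrite ?dvdn0.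
have cop : coprime k l by rewrite coprime_sym prime_coprime.
case: (egcdnP l k0) => u v e _; rewrite (eqP cop) in e.
exists (u%:R * c - v%:R); rewrite mulrBr mulrCA -kc -!natrM e natrD mulnC.
by rewrite addrAC subrr add0r.
Qed.

Lemma ldvd_sign (k : nat) a : ~ ldvd a -> ~ ldvd ((-1) ^+ k * a).
Proof.
move=> la /(ldvd_mull ((-1) ^+ k)); rewrite mulrA -expr2 sqrr_sign mul1r.
by apply: la.
Qed.

Lemma ldvd_prod a c : ~ ldvd a -> ~ ldvd c -> ~ ldvd (a * c).
Proof. by move=> la lc /ldvdM []. Qed.

Lemma ldvd_subU (A : {group gT}) : A \subset U -> ~ ldvd #|A|%:R.
Proof.
by move=> AU; apply: ldvd_nat; apply: contra l_U => lA; apply: dvdn_trans lA (cardSg AU).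
Qed.

(** Stated over [R], with a scalar that becomes invertible modulo [l], so that composition
    needs no division. *)
Definition reach lam mu := exists (h : RG) (r : R), ~ ldvd r /\ h * Evec lam = r *: Evec mu.

Lemma reach_trans lam mu nu : reach lam mu -> reach mu nu -> reach lam nu.
Proof.
move=> [h [r [lr e]]] [h' [r' [lr' e']]]; exists (h' * h), (r * r').
split; first exact: ldvd_prod.
by rewrite -mulrA e -galg_scalerAr e' scalerA.
Qed.

(** The character of [U] by which the passage through the permutation [s] to the invariants
    of the radical of [b] replaces [lam]. *)
Definition link_char b s lam : gT -> R := fun u => lam (levi_part b u ^ P s)%g.

Lemma levi_partV b u : block_fun b -> u \in U -> levi_part b u^-1%g = (levi_part b u)^-1%g.
Proof.
move=> bm uU; apply: (mulgI (levi_part b u)); rewrite mulgV -levi_partM ?groupV //.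
by rewrite mulgV levi_part1 // group1.
Qed.

Lemma link_Uchar b s lam : block_fun b -> block_incr b s -> Uchar lam -> Uchar (link_char b s lam).
Proof.
move=> bm bs [lu lM].
have cU u : u \in U -> (levi_part b u ^ P s)%g \in U.
  by move=> uU; apply: levi_conj_U bs (levi_part_U _ uU) (levi_part_levi _ uU).
split=> [u uU|u v uU vU]; first by apply/lu/cU.
by rewrite /link_char levi_partM // conjMg lM ?cU.
Qed.

(** The radical of [b] fixes the vector; the Levi part of [v] normalises the radical, and
    [s] conjugates it into [U], where it meets [lam]. *)
Lemma link_eigen b s lam : block_fun b -> block_incr b s -> Uchar lam ->
  forall v, v \in U -> [b v] * (hat R (prad F b) * ([b P s] * Evec lam)) =
    link_char b s lam v^-1%g *: (hat R (prad F b) * ([b P s] * Evec lam)).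
Proof.
move=> bm bs lc v vU; set L := levi_part b v.
have LU : L \in U := levi_part_U b vU.
have LL : L \in levi F b := levi_part_levi b vU.
have LN : L \in 'N(prad F b)%g by rewrite (subsetP (prad_norm F b)) // (subsetP (levi_sub F b)).
have rP := levi_part_rad bm vU; rewrite -/L in rP.
rewrite -{1}(mulKVg L v) -gelM -mulrA (mulrA [b (L^-1 * v)%g]) (gel_hat _ rP).
rewrite mulrA (hat_norm _ LN) -mulrA (mulrA [b L]) gelM conjgC -gelM -mulrA.
have LsU : (L ^ P s)%g \in U := levi_conj_U bs LU LL.
rewrite (gel_Evec lc LsU) -!galg_scalerAr; congr (_ *: _).
by rewrite /link_char levi_partV // -/L conjVg.
Qed.

(** If [r] is the scalar by which the passage from [lam] to the invariants of the
    unipotent radical and back acts, then [r] times [#|U|] is the product of the scalars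
    of the two passages, so that both are prime to [l] when [r] is. *)
Lemma link_reach b s lam r : block_fun b -> block_incr b s -> Uchar lam -> ~ ldvd r ->
  ehat lam * ([b (P s)^-1%g] * (hat R (prad F b) * ([b P s] * Evec lam))) = r *: Evec lam ->
  reach lam (link_char b s lam) /\ reach (link_char b s lam) lam.
Proof.
move=> bm bs lc lr er; set mu := link_char b s lam.
have mc : Uchar mu := link_Uchar bm bs lc.
set y := hat R (prad F b) * ([b P s] * Evec lam) in er.
have ey : ehat mu * y = #|U|%:R *: y := ehat_eigen mc (link_eigen bm bs lc).
have [r1 e1] : exists r1 : R, ehat mu * y = r1 *: Evec mu.
  have [r1 e] := ehat_ideal (hat R (prad F b) * ([b P s] * ehat lam)) mc.
  by exists r1; rewrite -e /y /Evec !mulrA.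
have [r2 e2] : exists r2 : R, ehat lam * ([b (P s)^-1%g] * Evec mu) = r2 *: Evec lam.
  have [r2 e] := ehat_ideal ([b (P s)^-1%g] * ehat mu) lc.
  by exists r2; rewrite -e /Evec !mulrA.
have er12 : r1 * r2 = #|U|%:R * r.
  apply: (Evec_inj lc); rewrite -scalerA -e2 galg_scalerAr galg_scalerAr -e1 ey.
  by rewrite -!galg_scalerAr er scalerA.
have l12 : ~ ldvd (r1 * r2) by rewrite er12; apply: ldvd_prod lr; apply: ldvd_subU.
split.
  exists (#|U|%:R *: (hat R (prad F b) * [b P s])), r1; split.
    by move=> l1; apply: l12; apply: ldvd_mulr.
  by rewrite -e1 ey -galg_scalerAl -mulrA.
exists (ehat lam * [b (P s)^-1%g]), r2; split; last by rewrite -mulrA.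
by move=> l2; apply: l12; apply: ldvd_mull.
Qed.

(** As [s] translates the blocks of [b'], it carries the simple root subgroups inside them
    to simple root subgroups inside the blocks of [b]. *)
Lemma link_generic b b' s lam : block_fun b' -> block_shift b' s ->
  (forall i j, b' i = b' j -> b (s i) = b (s j)) ->
  generic lam b -> generic (link_char b' s lam) b'.
Proof.
move=> bm' bs bb [lc lg]; have inc := block_shift_incr bm' bs.
split; first exact: link_Uchar.
move=> i j ij; have lt : (i < j)%N by rewrite ij.
have nij : i != j by rewrite -(inj_eq val_inj) neq_ltn lt.
have [bij|nbij] := eqVneq (b' i) (b' j); last first.
  split=> [[a]|e]; last by rewrite e eqxx in nbij.
  rewrite /link_char levi_part1 ?conj1g ?Uchar1 ?eqxx //.
  by apply: xroot_prad; rewrite ltn_neqAle nbij bm' // ltnW.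
split=> // _; have [a la] := (lg (s i) (s j) (bs _ _ ij bij)).2 (bb _ _ bij).
exists a; rewrite /link_char levi_part_id ?simple_U ?xroot_levi //.
by rewrite xroot_conj.
Qed.

End Links.

(** * Descent and rearrangement *)

Section Passages.
Variables (F : finFieldType) (n : nat) (R : idomainType) (l : nat).
Hypothesis natR : forall k, (k.+1)%:R != 0 :> R.
Local Notation gT := (GLT F n).
Local Notation I := 'I_n.-1.+1.
Local Notation RG := (galg R gT).
Local Notation B := (spar F (@nat_of_ord n.-1.+1)).
Local Notation U := (prad F (@nat_of_ord n.-1.+1)).
Local Notation P s := (pmat F s).
Local Notation "[ 'b' g ]" := (gel R g) (format "[ 'b'  g ]").
Local Notation steps := (steps F n R).
Implicit Types (x y z : RG) (g h u v : gT) (i j k : I) (s t : 'S_n.-1.+1) (b : I -> nat).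
Implicit Types (lam mu : gT -> R) (a c : R).
Local Notation ldvd := (@ldvd R l).
Hypothesis l_prime : prime l.
Hypothesis ldvd1 : ~ ldvd 1.
Hypothesis ldvdM : forall a c, ldvd (a * c) -> ldvd a \/ ldvd c.
Hypothesis l_U : ~~ (l %| #|U|)%N.
Local Notation reach := (@reach F n R l).

Lemma ldvd_sum (J : Type) (r : seq J) (Q : pred J) (f : J -> R) :
  (forall d, Q d -> ldvd (f d)) -> ldvd (\sum_(d <- r | Q d) f d).
Proof.
move=> fQ; apply: big_ind => // [|_ _ [c ->] [d ->]]; first by exists 0; rewrite mulr0.
by exists (c + d); rewrite mulrDr.
Qed.

(** A function invariant under [K] on the right is summed over left cosets, indexed here by
    the inverses of the right cosets. *)
Lemma sum_cosets (H K : {group gT}) (f : gT -> R) : K \subset H ->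
  {in K, forall h g, f (g * h)%g = f g} ->
  \sum_(g in H) f g = #|K|%:R * \sum_(C in rcosets K H) f (repr C)^-1%g.
Proof.
move=> KH fK; rewrite (reindex_inj invg_inj) /=.
rewrite (eq_bigl (mem H)) => [|g]; last by rewrite groupV.
rewrite (set_partition_big _ (rcosets_partition KH)) /= mulr_sumr.
apply: eq_bigr => C /rcosetsP[x xH ->]; set y := repr _.
have yC : y \in (K :* x)%g by apply: mem_repr (rcoset_refl _ _).
rewrite (eq_bigr (fun=> f y^-1%g)) => [|z zC]; last first.
  have yz : (y * z^-1)%g \in K.
    have [[k1 k1K ->] [k2 k2K ->]] := (rcosetP yC, rcosetP zC).
    by rewrite invMg mulgA mulgK groupM ?groupV.
  by rewrite -(fK _ yz y^-1%g) mulgA mulVg mul1g.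
by rewrite sumr_const card_rcoset mulr_natl.
Qed.

(** Passage from a parabolic subgroup to a smaller one of index prime to [l]. The operator
    [theta] acts by a scalar equal to this index up to the order of the smaller subgroup and
    a power of the characteristic, so one of its summands, for some [g], does not kill the
    vector of [lam] modulo [l]. The genericity of [lam] then forces [g] to lie in the double
    coset of a permutation reversing the blocks. *)
Lemma descent lam b b' : block_fun b -> block_fun b' -> coarser b b' ->
  ~~ (l %| #|spar F b : spar F b'|%g)%N -> generic lam b ->
  exists mu, [/\ generic mu b', reach lam mu & reach mu lam].
Proof.
move=> bm bm' bb lPQ gl; have [lc lg] := gl; have lt := generic_rad bm gl.
have US b0 : block_fun b0 -> U \subset spar F b0.
  by move=> cm; apply: subset_trans (U_sub_B F n) (sparS F (block_fun_coarser cm)).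
have PU : prad F b \subset U := pradS F (block_fun_coarser bm).
have QP : spar F b' \subset spar F b := sparS F bb.
pose op g : RG := [b g] * (hat R (prad F b') * [b g^-1%g]).
have /choice[r rE] g : exists r : R, ehat lam * (op g * Evec lam) = r *: Evec lam.
  have [r e] := ehat_ideal (op g * ehat lam) lc.
  by exists r; rewrite -e /Evec !mulrA.
have rQ : {in spar F b', forall h g, r (g * h)%g = r g}.
  move=> h hQ g; apply: (Evec_inj lc); rewrite -!rE; congr (_ * (_ * _)).
  have hN : h \in 'N(prad F b')%g by rewrite (subsetP (prad_norm F b')).
  rewrite /op invMg -!gelM -mulrA (mulrA [b h]) (hat_norm _ hN) -mulrA.
  by rewrite (mulrA [b h]) gelM mulgV gel1 mul1r.
have rU u g : u \in U -> r (u * g)%g = r g.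
  move=> uU; apply: (Evec_inj lc); rewrite -!rE /op invMg -!gelM -!mulrA.
  have uVU : u^-1%g \in U by rewrite groupV.
  rewrite (gel_Evec lc uVU) invgK -!galg_scalerAr mulrA (ehat_gel lc uU) -galg_scalerAl scalerA.
  by rewrite UcharV // scale1r.
have rsum : \sum_(g in spar F b) r g = (#|spar F b| * #|prad F b|)%:R * #|U|%:R.
  apply: (Evec_inj lc); rewrite scaler_suml.
  under eq_bigr => g _ do rewrite -rE.
  rewrite -mulr_sumr -mulr_suml.
  have th := @theta_scalar F n R natR b b' bm bm' bb (ehat lam).
  rewrite [X in _ * (X * _)](_ : _ = @theta F n R b b') // th; last first.
    move=> u uP; have uU := subsetP PU _ uP.
    by rewrite -/(Evec lam) (gel_Evec lc uU) lt ?scale1r // groupV.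
  rewrite -galg_scalerAr -scalerA; congr (_ *: _).
  exact: (ehat_eigen lc (fun u => @gel_Evec _ _ _ lam u lc)).
(* The scalars [r g] are constant on the cosets of the smaller group, so the order of the
   latter cancels from their sum and leaves the index. *)
have [g gP lrg] : exists2 g, g \in spar F b & ~ ldvd (r g).
  apply: contrapT => nex.
  have rd g : g \in spar F b -> ldvd (r g).
    by move=> gP; apply: contrapT => lrg; apply: nex; exists g.
  have := sum_cosets QP rQ; rewrite rsum -(Lagrange QP) mulnAC -mulnA natrM -mulrA.
  move/(mulfI (card_natR natR _)) => e.
  have : ldvd (\sum_(C in rcosets (spar F b') (spar F b)) r (repr C)^-1%g).
    apply: ldvd_sum => _ /rcosetsP[x xP ->]; apply: rd.
    have yC : repr (spar F b' :* x)%g \in (spar F b' :* x)%g by apply: mem_repr (rcoset_refl _ _).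
    have /rcosetP[k kQ ->] := yC.
    by rewrite groupV groupM // (subsetP QP).
  rewrite -e -natrM; apply: ldvd_nat => //.
  rewrite !(Euclid_dvdM _ _ l_prime) !negb_or lPQ l_U !andbT.
  by apply: contra l_U => lA; apply: dvdn_trans lA (cardSg PU).
have [u [s0 [x [uU xB eg]]]] := bruhat g.
(* [s0] matters only up to permutations inside the blocks of [b']; its inverse is made
   increasing on them. *)
have [t [bt tinc]] := block_sort s0^-1%g bm'.
set s := (t * s0^-1)%g in tinc.
have tQ : P t \in spar F b' := subsetP (levi_sub F b') _ (pmat_spar F bt).
have xQ : x \in spar F b' := subsetP (sparS F (block_fun_coarser bm')) _ xB.
have eg' : g = (u * (P s)^-1 * (P t * x))%g.
  by rewrite eg /s -pmatV invMg invgK pmatM !mulgA pmatV mulgKV.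
have lrs : ~ ldvd (r (P s)^-1%g).
  by rewrite -(rU u) // -(rQ (P t * x)%g) ?groupM // -eg'.
have bs i : b (s i) = b i.
  apply: (@spar_perm F); rewrite -groupV.
  have -> : (P s)^-1%g = (u^-1 * g * (P t * x)^-1)%g by rewrite eg' -(mulgA u) mulKg mulgK.
  rewrite !groupM ?groupV //; first by rewrite (subsetP (US b bm)).
  by rewrite groupM // (subsetP QP).
(* Were the label to increase from [i] to [j], the simple root subgroup of [(i, j)] would lie
   in the conjugate of the radical of [b'], and [lam] would have to be trivial on it. *)
have dec i j : j = i.+1 :> nat -> b i = b j -> (b' (s^-1 j)%g <= b' (s^-1 i)%g)%N.
  move=> ij bij; rewrite leqNgt; apply/negP => ltb.
  have [a /eqP la] := (lg i j ij).2 bij; apply: la.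
  have ltij : (i < j)%N by rewrite ij.
  set x0 := xroot (s^-1 i)%g (s^-1 j)%g a.
  have nij : (s^-1 i)%g != (s^-1 j)%g by rewrite (inj_eq perm_inj) -(inj_eq val_inj) neq_ltn ltij.
  have x0P : x0 \in prad F b' by apply: xroot_prad.
  have ex : xroot i j a = (x0 ^ P s)%g by rewrite xroot_conj // !permKV.
  have xU : xroot i j a \in U by apply: simple_U.
  have xc : [b xroot i j a] * op (P s)^-1%g = op (P s)^-1%g.
    rewrite /op mulrA gelM.
    have -> : (xroot i j a * (P s)^-1 = (P s)^-1 * x0)%g.
      by rewrite ex conjgE -!mulgA mulgV mulg1.
    by rewrite -gelM -mulrA (mulrA [b x0]) (gel_hat _ x0P).
  have e : lam (xroot i j a)^-1%g * r (P s)^-1%g = r (P s)^-1%g.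
    apply: (Evec_inj lc); rewrite -scalerA -rE galg_scalerAl -(ehat_gel lc xU) -mulrA.
    by rewrite [X in _ * X]mulrA xc.
  have r0 : r (P s)^-1%g != 0.
    by apply/eqP => r0; apply: lrs; exists 0; rewrite r0 mulr0.
  have lV : lam (xroot i j a)^-1%g = 1 by apply: (mulIf r0); rewrite e mul1r.
  by have := UcharV lc xU; rewrite lV mulr1.
have shift := block_reversal bm bm' bb bs tinc dec.
have bbs i j : b' i = b' j -> b (s i) = b (s j) by move=> e; rewrite !bs; apply: coarser_eq bb e.
exists (link_char b' s lam).
have /(link_reach l_prime ldvd1 ldvdM l_U bm' tinc lc lrs) [] :
  ehat lam * ([b (P s)^-1%g] * (hat R (prad F b') * ([b P s] * Evec lam))) =
  r (P s)^-1%g *: Evec lam.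
  by rewrite -rE /op invgK !mulrA.
by split=> //; apply: link_generic bm' shift bbs gl.
Qed.

(** Up to sign, the coefficient counts the [u] in [U] with [u ^ s] upper triangular, which
    form a subgroup of [U]. *)
Lemma ldvd_coef_triv s : ~ ldvd (coefg (@Evec F n R (fun=> 1)) (P s)).
Proof.
rewrite coef_Evec; apply: ldvd_sign => //; rewrite sumr_const.
pose A := [set u in U | (u ^ P s)%g \in B].
have AP u : (u \in A) = (u \in U) && (u ^ P s \in B)%g by exact: in_set.
have gA : group_set A.
  apply/group_setP; split=> [|u v]; first by rewrite AP conj1g !group1.
  rewrite !AP => /andP[uU uB] /andP[vU vB].
  by apply/andP; split; rewrite ?conjMg groupM.
have -> : #|[pred u | u \in U & (u ^ P s)%g \in B]| = #|Group gA|.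
  by apply: eq_card => u; rewrite [RHS]AP.
apply: (ldvd_subU l_prime ldvd1 l_U); apply/subsetP => u.
by rewrite AP => /andP[].
Qed.

(** The passage leads to an eigenvector of the trivial character, hence is a multiple of the
    one fixed vector; evaluation at the identity gives the factor. *)
Lemma prad_passage_triv b s : block_fun b -> block_incr b s ->
  #|U|%:R *: (hat R (prad F b) * ([b P s] * Evec (fun=> 1))) =
  (#|prad F b|%:R * coefg (@Evec F n R (fun=> 1)) (P s^-1%g)) *: Evec (fun=> 1).
Proof.
move=> bm bs; have tc := @Uchar_triv F n R.
have PU : prad F b \subset U := pradS F (block_fun_coarser bm).
rewrite -(ehat_eigen tc) => [|u uU]; last first.
  by rewrite (link_eigen bm bs tc).
rewrite ehat_triv mulrA hat_hat_r // -galg_scalerAl -scalerA; congr (_ *: _).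
have -> : [b P s] * Evec (fun=> 1) = ([b P s] * @ehat F n R (fun=> 1)) * steps.
  by rewrite /Evec mulrA.
by rewrite hatU_ideal -mulrA coefg_gelM mulg1 -pmatV.
Qed.

(** An operator commuting with a Levi subgroup acts by the same scalar on the vectors of
    all the characters trivial on the unipotent radical: the longest element of the Levi
    subgroup carries each of them to the vector of the trivial character. *)
Lemma scalar_transfer b lam z a c : block_fun b -> Uchar lam ->
  {in prad F b, forall u, lam u = 1} ->
  {in levi F b, forall g, [b g] * z = z * [b g]} ->
  {in prad F b, forall u, [b u] * z = z} ->
  z * Evec lam = a *: Evec lam -> z * Evec (fun=> 1) = c *: Evec (fun=> 1) -> a = c.
Proof.
move=> bm lc lt zL zP zl z1; have [w [bw wP]] := longest F bm.
have wL : P w \in levi F b := pmat_spar F bw.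
have PU : prad F b \subset U := pradS F (block_fun_coarser bm).
have wN : P w \in 'N(prad F b)%g by rewrite (subsetP (prad_norm F b)) // (subsetP (levi_sub F b)).
have ew := hatU_Evec_longest bm wP lt; set k := (-1) ^+ w * _ in ew.
have k0 : k != 0.
  by apply: mulf_neq0; [rewrite signr_eq0 | exact: (card_natR natR (prad_group F b))].
clearbody k.
set y := [b P w] * Evec lam in ew.
have yP u : u \in prad F b -> [b u] * y = y.
  move=> uP; rewrite /y mulrA gelM conjgC -gelM -mulrA.
  have uwP : (u ^ P w)%g \in prad F b by rewrite memJ_norm.
  have uwU := subsetP PU _ uwP.
  by rewrite (gel_Evec lc uwU) lt ?scale1r // groupV.
have zU : hat R U * (z * y) = z * (hat R U * y).
  rewrite hatE !mulr_suml mulr_sumr; apply: eq_bigr => u uU.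
  have rP := levi_part_rad bm uU; have LL := levi_part_levi b uU.
  rewrite -(mulKVg (levi_part b u) u) -gelM -!mulrA (yP _ rP).
  rewrite [in LHS](mulrA _ z) (zP _ rP) mulrA zL //.
  by rewrite -mulrA.
apply: (mulIf k0); apply: (@Evec_inj F n R (fun=> 1)); first exact: Uchar_triv.
rewrite -!scalerA -ew; move: zU; rewrite {1}/y [in X in X = _](mulrA z) -zL //.
rewrite -mulrA zl -!galg_scalerAr -/y ew => ->.
by rewrite -galg_scalerAr z1 !scalerA mulrC.
Qed.

(** Passage between parabolic subgroups with the same Levi subgroup up to conjugation.
    The composite of the two projections on invariants commutes with the Levi subgroup;
    its scalar is computed on the vector of the trivial character, where it is a power of
    the characteristic up to sign. *)
Lemma rearrangement lam b b' s : block_fun b -> block_fun b' -> block_shift b' s ->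
  (forall i j, b (s i) = b (s j) <-> b' i = b' j) -> generic lam b ->
  exists mu, [/\ generic mu b', reach lam mu & reach mu lam].
Proof.
move=> bm bm' bs bb gl; have [lc lg] := gl; have lt := generic_rad bm gl.
have tc := @Uchar_triv F n R.
have PU : prad F b \subset U := pradS F (block_fun_coarser bm).
have inc := block_shift_incr bm' bs.
have incV : block_incr b s^-1%g.
  move=> i j ij bij.
  have bij' : b' (s^-1 i)%g = b' (s^-1 j)%g by apply/bb; rewrite !permKV.
  rewrite ltnNge leq_eqVlt; apply/negP => /predU1P[/val_inj/perm_inj e|lt'].
    by rewrite e ltnn in ij.
  by have := inc _ _ lt' (esym bij'); rewrite !permKV ltnNge ltnW.
pose zs : RG := [b (P s)^-1%g] * (hat R (prad F b') * [b P s]).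
pose z : RG := hat R (prad F b) * zs.
have zsL g : g \in levi F b -> [b g] * zs = zs * [b g].
  move=> gL; have gsL : (g ^ (P s)^-1)%g \in 'N(prad F b')%g.
    apply: (subsetP (prad_norm F b')); apply: (subsetP (levi_sub F b')).
    move/leviP: gL => gL; apply/leviP => i j bij.
    by rewrite conj_pmatVE gL //; apply: contra bij => /eqP/bb ->.
  have e1 : (g * (P s)^-1 = (P s)^-1 * g ^ (P s)^-1)%g by rewrite conjgC.
  have e2 : (g ^ (P s)^-1 * P s = P s * g)%g by rewrite conjgE invgK -!mulgA mulVg mulg1.
  rewrite /zs mulrA gelM e1 -gelM -!mulrA; congr (_ * _).
  by rewrite mulrA (hat_norm _ gsL) -mulrA gelM e2 gelM.
have zL g : g \in levi F b -> [b g] * z = z * [b g].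
  move=> gL; have gN : g \in 'N(prad F b)%g.
    by apply: (subsetP (prad_norm F b)); apply: (subsetP (levi_sub F b)).
  by rewrite /z mulrA (hat_norm _ gN) -mulrA zsL // mulrA.
have zP u : u \in prad F b -> [b u] * z = z.
  by move=> uP; rewrite /z mulrA gel_hat.
have zE nu : Uchar nu -> {in prad F b, forall u, nu u = 1} ->
    ehat nu * (z * Evec nu) = #|U|%:R *: (z * Evec nu).
  move=> nc nt; apply: (ehat_eigen nc) => u uU.
  have rP := levi_part_rad bm uU; have LL := levi_part_levi b uU.
  have LU := levi_part_U b uU.
  rewrite -{1}(mulKVg (levi_part b u) u) -gelM -mulrA (mulrA _ z) (zP _ rP).
  rewrite mulrA zL // -mulrA (gel_Evec nc LU) -galg_scalerAr; congr (_ *: _).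
  have eu : (u^-1 = ((levi_part b u)^-1 * u)^-1 * (levi_part b u)^-1)%g.
    by rewrite invMg invgK mulgK.
  have rPV : (((levi_part b u)^-1 * u)^-1)%g \in prad F b by rewrite groupV.
  have rUV := subsetP PU _ rPV; have LUV : ((levi_part b u)^-1)%g \in U by rewrite groupV.
  by case: (nc) => _ nM; rewrite eu nM // (nt _ rPV) mul1r.
have zEk nu : Uchar nu -> {in prad F b, forall u, nu u = 1} ->
    exists k : R, (#|U|%:R *: z) * Evec nu = k *: Evec nu.
  move=> nc nt; have [k ek] := ehat_ideal (z * ehat nu) nc.
  by exists k; rewrite -ek -galg_scalerAl -zE // /Evec (mulrA z).
have [k1 e1] := zEk _ tc (fun _ _ => erefl).
have [kl el] := zEk _ lc lt.
have ekl : kl = k1.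
  apply: (scalar_transfer bm lc lt _ _ el e1) => [g gL|u uP].
    by rewrite -galg_scalerAr zL // galg_scalerAl.
  by rewrite -galg_scalerAr zP.
have lk1 : ~ ldvd k1.
  pose cb := coefg (@Evec F n R (fun=> 1)).
  have e : #|U|%:R * k1 = (#|prad F b'|%:R * cb (P s^-1%g)) * (#|prad F b|%:R * cb (P s)).
    apply: (Evec_inj tc); rewrite -[LHS]scalerA -e1 /z /zs -galg_scalerAl.
    have -> : hat R (prad F b) * ([b (P s)^-1%g] * (hat R (prad F b') * [b P s])) * Evec (fun=> 1) =
        hat R (prad F b) * ([b (P s)^-1%g] * (hat R (prad F b') * ([b P s] * Evec (fun=> 1)))).
      by rewrite -!mulrA.
    rewrite 2!galg_scalerAr (prad_passage_triv bm' inc) -!galg_scalerAr scalerA mulrC -scalerA.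
    by rewrite -pmatV (prad_passage_triv bm incV) invgK scalerA.
  move=> lk; suff: ldvd (#|U|%:R * k1); last exact: ldvd_mull.
  by rewrite e; do 2?apply: ldvd_prod => //; first [exact: ldvd_coef_triv
    | apply: (ldvd_subU l_prime ldvd1 l_U); apply: pradS; apply: block_fun_coarser].
have [r er] : exists r : R, ehat lam * (zs * Evec lam) = r *: Evec lam.
  have [r e] := ehat_ideal (zs * ehat lam) lc.
  by exists r; rewrite -e /Evec !mulrA.
have lr : ~ ldvd r.
  have e : #|prad F b|%:R * r = kl.
    have U0 := card_natR natR (prad_group F (@nat_of_ord n.-1.+1)).
    apply: (mulfI U0); apply: (Evec_inj lc).
    rewrite -[RHS]scalerA -el -galg_scalerAl -zE // /z -mulrA.
    have -> : ehat lam * (hat R (prad F b) * (zs * Evec lam)) =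
        #|prad F b|%:R *: (ehat lam * (zs * Evec lam)).
      rewrite mulrA hatE mulr_sumr (eq_bigr (fun=> ehat lam)) => [|u uP].
        by rewrite sumr_const galg_scalerAl scaler_nat.
      by rewrite (ehat_gel lc (subsetP PU _ uP)) lt ?groupV // scale1r.
    by rewrite er !scalerA mulrA.
  by move=> lr; apply: lk1; rewrite -ekl -e; apply: ldvd_mull.
exists (link_char b' s lam).
have [|l1 l2] := link_reach l_prime ldvd1 ldvdM l_U bm' inc lc lr.
  by rewrite -er /zs !mulrA.
by split=> //; apply: link_generic bm' bs (fun i j => (bb i j).2) gl.
Qed.

End Passages.

(** * Arithmetic of the valuations *)

Section Valuations.
Local Open Scope nat_scope.
Implicit Types (i j k q l d e x : nat).

(** The division in [qnum] hides the splittings [gsumD] and [gsumM] of this sum. *)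
Definition gsum (Q k : nat) := \sum_(j < k) Q ^ j.

Lemma gsumE q k : 1 < q -> qnum q k = gsum q k.
Proof.
move=> q1; rewrite /qnum !subn1 predn_exp mulKn // -subn1 subn_gt0 //.
Qed.

Lemma gsumS Q k : gsum Q k.+1 = Q ^ k + gsum Q k.
Proof. by rewrite /gsum big_ord_recr addnC. Qed.

Lemma gsum0 Q : gsum Q 0 = 0.
Proof. by rewrite /gsum big_ord0. Qed.

Lemma gsumD Q j k : gsum Q (j + k) = gsum Q j + Q ^ j * gsum Q k.
Proof.
elim: k => [|k IH]; first by rewrite addn0 gsum0 muln0 addn0.
by rewrite addnS !gsumS IH expnD mulnDr addnCA.
Qed.

Lemma gsumM Q j k : gsum Q (j * k) = gsum Q j * gsum (Q ^ j) k.
Proof.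
elim: k => [|k IH]; first by rewrite muln0 !gsum0 muln0.
by rewrite mulnS addnC gsumD IH gsumS mulnDr -expnM addnC (mulnC (Q ^ _)).
Qed.

Lemma gsum_gt0 Q k : 0 < k -> 0 < gsum Q k.
Proof. by case: k => // k _; rewrite /gsum big_ord_recl expn0. Qed.

Lemma gsum_mod Q k l : Q = 1 %[mod l] -> gsum Q k = k %[mod l].
Proof.
move=> Q1; elim: k => [|k IH]; first by rewrite gsum0.
by rewrite gsumS -modnDm -modnXm Q1 modnXm exp1n IH modnDm add1n.
Qed.

(** Modulo the square of [l], the sum [gsum Q l] is [l + 'C(l, 2) (Q - 1)]. *)
Lemma gsum_prime_logn Q l : prime l -> 0 < Q -> l %| Q - 1 -> (l = 2 -> 4 %| Q - 1) ->
  logn l (gsum Q l) = 1.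
Proof.
move=> lp Q0 lQ Q4; set D := Q - 1 in lQ Q4.
have QE : Q = D.+1 by rewrite /D subn1 prednK.
have expE j : exists c, Q ^ j = 1 + j * D + c * D ^ 2.
  elim: j => [|j [c e]]; first by exists 0; rewrite expn0 mul0n addn0.
  by exists (j + c + c * D); rewrite expnS e QE; ring.
have gE k : exists c, gsum Q k = k + 'C(k, 2) * D + c * D ^ 2.
  elim: k => [|k [c e]]; first by exists 0; rewrite gsum0 bin0n.
  have [c' e'] := expE k; exists (c + c').
  by rewrite gsumS e e' binS bin1; ring.
have [c e] := gE l; have l1 := prime_gt1 lp.
have l2D : l ^ 2 %| 'C(l, 2) * D.
  case: (ltngtP l 2) => [lt|gt|l2]; first by lia.
    by rewrite expnS expn1 dvdn_mul // prime_dvd_bin.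
  by rewrite l2 binn mul1n; apply: Q4.
have l2D2 : l ^ 2 %| c * D ^ 2 by rewrite dvdn_mull // dvdn_exp2r.
have g0 := gsum_gt0 Q (ltnW l1).
apply/eqP; rewrite eqn_leq -!(pfactor_dvdn _ lp g0) andbC expn1.
rewrite e; apply/andP; split.
  by rewrite -addnA dvdn_addr // dvdn_addl // (dvdn_trans _ l2D, dvdn_trans _ l2D2) // dvdn_exp.
rewrite leqNgt -(pfactor_dvdn _ lp) ?e // -?e //.
rewrite e -addnA dvdn_addl ?dvdn_add //.
by rewrite -[X in _ %| X]expn1 dvdn_Pexp2l.
Qed.

Lemma logn_ndvd l k : ~~ (l %| k) -> logn l k = 0.
Proof. by move=> lk; rewrite lognE (negPf lk) !andbF. Qed.

(** Lifting the exponent: [gsumM] splits off one factor [l] of [k] at a time, each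
    contributing one by [gsum_prime_logn], and when [l] does not divide [k] the sum is
    [k] modulo [l]. *)
Lemma gsum_logn Q l k : prime l -> 0 < Q -> l %| Q - 1 -> (l = 2 -> 4 %| Q - 1) -> 0 < k ->
  logn l (gsum Q k) = logn l k.
Proof.
move=> lp; have [m] := ubnP k; elim: m Q k => // m IH Q k; rewrite ltnS => km Q0 lQ Q4 k0.
have Q1 : Q = 1 %[mod l] by apply/eqP; rewrite eqn_mod_dvd.
have [lk|nlk] := boolP (l %| k); last first.
  by rewrite !logn_ndvd // /dvdn (gsum_mod k Q1).
have l1 := prime_gt1 lp; have l0 := ltnW l1.
have [k' kE] := dvdnP lk; rewrite mulnC in kE; subst k => {lk}.
have k'0 : 0 < k' by move: k0; rewrite muln_gt0 => /andP[].
have k'k : k' < l * k' by rewrite ltn_Pmull.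
have dvQ : Q - 1 %| Q ^ l - 1.
  by rewrite !subn1 predn_exp dvdn_mulr.
have Ql0 : 0 < Q ^ l by rewrite expn_gt0 Q0.
rewrite gsumM lognM ?gsum_gt0 // gsum_prime_logn //.
rewrite IH ?(leq_trans k'k) // ?(dvdn_trans lQ dvQ) //; last by move/Q4 => Q4'; apply: dvdn_trans dvQ.
by rewrite lognM // (logn_prime l lp) eqxx.
Qed.

Variables (q l e : nat).
Hypothesis q_gt1 : 1 < q.
Hypothesis l_prime : prime l.
Hypothesis l_q : ~~ (l %| q).
Hypothesis e_least : is_least (fun i => 2 <= i /\ l %| qnum q i) e.

Lemma e_gt1 : 1 < e. Proof. by case: e_least => -[]. Qed.

Lemma l_qX k : ~~ (l %| q ^ k).
Proof. by rewrite Euclid_dvdX // (negPf l_q). Qed.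

(** As [l] divides the sum for [e], it divides the sum for [j] exactly when it divides the
    one for the remainder of [j] modulo [e], which is smaller than the least such [e]. *)
Lemma dvdn_qnum j : (l %| gsum q j) = (e %| j).
Proof.
have [[e2 le] emin] := e_least; rewrite gsumE // in le.
rewrite {1}(divn_eq j e) gsumD dvdn_addr; last by rewrite mulnC gsumM dvdn_mulr.
rewrite Euclid_dvdM // (negPf (l_qX _)) /=.
have lt : j %% e < e by rewrite ltn_pmod // ltnW.
rewrite /(dvdn e j); case: (j %% e) lt => [|[|r]] lt.
- by rewrite gsum0 dvdn0.
- by rewrite /gsum big_ord1 expn0 dvdn1 (gtn_eqF (prime_gt1 l_prime)).
- apply/negP => lr; have := emin r.+2; rewrite gsumE // => /(_ (conj isT lr)).
  by rewrite leqNgt lt.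
Qed.

(** For [l = 2] the least [e] is [2], and odd squares are [1] modulo [4]. *)
Lemma qe_four : l = 2 -> 4 %| q ^ e - 1.
Proof.
move=> l2; have q_odd : odd q by move: l_q; rewrite l2 dvdn2 negbK.
have e2 : e = 2.
  have [[e2 _] emin] := e_least; apply/eqP; rewrite eqn_leq e2 andbT.
  apply: emin; split=> //; rewrite gsumE // l2 !gsumS gsum0 expn0 expn1 addn0 dvdn2 oddD.
  by rewrite q_odd.
rewrite e2 -(odd_double_half q) q_odd add1n -mul2n.
have -> : (2 * q./2).+1 ^ 2 - 1 = 4 * (q./2 * (q./2 + 1)) by rewrite expnS expn1; nia.
exact: dvdn_mulr.
Qed.

(** What a part [x] of a composition contributes to the valuation of the index of the Borel
    subgroup in the parabolic one. *)
Definition val_sum (x : nat) := \sum_(1 <= i < x.+1) logn l (gsum q i).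

Local Notation d := (logn l (qnum q e)).

Lemma logn_gsum_e k : 0 < k -> logn l (gsum q (e * k)) = d + logn l k.
Proof.
move=> k0; have [[e2 le] _] := e_least; have e0 := ltnW e2.
have q0 := ltnW q_gt1.
rewrite gsumM lognM ?gsum_gt0 // -gsumE //; congr (_ + _).
apply: gsum_logn => //; first by rewrite expn_gt0 q0.
- by rewrite !subn1 predn_exp -/(gsum q e) -gsumE // dvdn_mull.
- exact: qe_four.
Qed.

(** Only the multiples of [e] contribute, by [dvdn_qnum] and [logn_gsum_e]. *)
Lemma val_sumE x : val_sum x = d * (x %/ e) + logn l (x %/ e)`!.
Proof.
have e0 : 0 < e := ltnW e_gt1.
elim: x => [|x IH]; first by rewrite /val_sum big_geq // div0n muln0 fact0 logn1.
rewrite /val_sum big_nat_recr //= -/(val_sum x) IH divnS //.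
case: (boolP (e %| x.+1)) => [ex|nex]; last first.
  by rewrite add0n (@logn_ndvd l (gsum q x.+1)) ?addn0 // dvdn_qnum.
have xE : x.+1 = e * (x %/ e).+1 by rewrite mulnC -{1}(divnK ex) divnS // ex add1n.
rewrite xE logn_gsum_e // add1n factS lognM ?fact_gt0 //; ring.
Qed.

(** One step of Legendre's formula. *)
Lemma logn_factD K : logn l K`! = K %/ l + logn l (K %/ l)`!.
Proof.
have l0 := prime_gt0 l_prime.
elim: K => [|K IH]; first by rewrite div0n fact0 logn1.
rewrite factS lognM ?fact_gt0 // IH divnS //.
case: (boolP (l %| K.+1)) => [lK|nlK]; last by rewrite add0n (@logn_ndvd l K.+1).
have KE : K.+1 = l * (K %/ l).+1 by rewrite mulnC -{1}(divnK lK) divnS // lK add1n.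
rewrite {1}KE lognM // (logn_prime l l_prime) eqxx /= !add1n factS lognM ?fact_gt0 //; ring.
Qed.

Lemma s_seqE i : s_seq l d i = l ^ i * d + gsum l i.
Proof.
elim: i => [|i IH]; first by rewrite /= gsum0 expn0 mul1n addn0.
have -> : gsum l i.+1 = (l * gsum l i).+1.
  by rewrite -add1n (gsumD l 1 i) expn1 /gsum big_ord1.
by rewrite /= IH expnS; ring.
Qed.

(** Legendre's formula in terms of the digits of [K] in base [l]. *)
Lemma gsum_digits M K : K < l ^ M -> \sum_(i < M) gsum l i * (K %/ l ^ i %% l) = logn l K`!.
Proof.
have l0 := prime_gt0 l_prime.
elim: M K => [|M IH] K KM.
  by rewrite big_ord0; case: K KM => //; rewrite fact0 logn1.
have K'M : K %/ l < l ^ M by rewrite ltn_divLR // -expnSr.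
have dE : \sum_(i < M) K %/ l %/ l ^ i %% l * l ^ i = K %/ l.
  by rewrite digits_sum // modn_small.
rewrite logn_factD -(IH _ K'M) -{1}dE -big_split big_ord_recl gsum0 mul0n add0n /=.
apply: eq_bigr => i _; rewrite /bump /= add1n gsumS expnS divnMA.
by rewrite mulnDl mulnC.
Qed.

Lemma val_sum_digits m x : x %/ e < l ^ m.+1 ->
  val_sum x = \sum_(i < m.+1) s_seq l d i * (Delta e l m x).2 i.
Proof.
move=> xm; have l0 := prime_gt0 l_prime.
rewrite val_sumE -(gsum_digits xm) -{1}(modn_small xm) -digits_sum // big_distrr -big_split /=.
by apply: eq_bigr => i _; rewrite ffunE s_seqE; ring.
Qed.

Lemma val_sum1 : val_sum 1 = 0.
Proof. by rewrite /val_sum big_nat1 /gsum big_ord1 expn0 logn1. Qed.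

Lemma val_sum_pow i : val_sum (e * l ^ i) = s_seq l d i.
Proof.
have l0 := prime_gt0 l_prime.
rewrite val_sumE mulKn ?(ltnW e_gt1) // s_seqE mulnC; congr (_ + _).
elim: i => [|i IH]; first by rewrite expn0 factS fact0 muln1 logn1 gsum0.
by rewrite logn_factD expnS mulKn // IH gsumS.
Qed.

End Valuations.

(** * Compositions *)

Section Compositions.
Local Open Scope nat_scope.
Variables (e l m : nat).
Hypotheses (e_gt0 : 0 < e) (l_gt0 : 0 < l).
Implicit Types (a : seq nat) (x : nat).

Lemma Delta_seqE a : (Delta_seq e l m a).1 = \sum_(x <- a) (Delta e l m x).1 /\
  forall i, (Delta_seq e l m a).2 i = \sum_(x <- a) (Delta e l m x).2 i.
Proof.
rewrite /Delta_seq; elim: a => [|x a [IH1 IH2]].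
  by rewrite !big_nil; split=> // i; rewrite big_nil ffunE.
rewrite !big_cons; split=> [|i]; first by rewrite -IH1.
by rewrite big_cons -IH2 /= ffunE.
Qed.

Lemma sum_star (f : nat -> nat) a :
  \sum_(x <- star e l m a) f x = \sum_(x <- a) (f 1 * (Delta e l m x).1 +
    \sum_(i < m.+1) f (e * l ^ i) * (Delta e l m x).2 i).
Proof.
have [D1 D2] := Delta_seqE a.
rewrite /star big_cat big_nseq iter_addn_0 big_flatten big_map big_enum /= D1.
rewrite big_split /= big_distrr /=; congr (_ + _).
rewrite exchange_big /=; apply: eq_bigr => i _.
by rewrite big_nseq iter_addn_0 D2 big_distrr.
Qed.

Lemma sum_star1 (f : nat -> nat) a :
  \sum_(x <- star e l m a) f x = \sum_(x <- a) \sum_(y <- star e l m [:: x]) f y.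
Proof. by rewrite sum_star; apply: eq_bigr => x _; rewrite sum_star big_seq1. Qed.

Lemma sumn_star1 x : x %/ e < l ^ m.+1 -> sumn (star e l m [:: x]) = x.
Proof.
move=> xm; rewrite sumnE sum_star big_seq1 mul1n.
have [_ _ xE] := (DeltaP (Delta e l m x) e_gt0 l_gt0 xm).2 erefl.
rewrite {3}xE big_distrr; congr (_ + _); apply: eq_bigr => i _ /=.
by rewrite ffunE mulnA mulnAC.
Qed.

Lemma notin_star a : 0 \notin star e l m a.
Proof.
rewrite mem_cat negb_or mem_nseq andbF /=; apply/flattenP => -[_ /mapP[i _ ->]].
by rewrite mem_nseq => /andP[_]; rewrite eq_sym muln_eq0 expn_eq0 !gtn_eqF.
Qed.

(** The parts of [star a] grouped according to the part of [a] they come from. *)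
Definition refine a := flatten [seq star e l m [:: x] | x <- a].

Lemma perm_refine a : perm_eq (star e l m a) (refine a).
Proof.
apply/seq.permP => Q; rewrite -!sum1_count big_mkcond /= /refine big_flatten big_map.
rewrite (sum_star1 (fun x => if Q x then 1 else 0)).
by apply: eq_bigr => x _; rewrite [RHS]big_mkcond.
Qed.

Lemma refine_composition n a : (forall x, x <= n -> x %/ e < l ^ m.+1) ->
  is_composition n a ->
  [/\ is_composition n (refine a), is_composition n (star e l m a) &
      [seq sumn s | s <- [seq star e l m [:: x] | x <- a]] = a].
Proof.
move=> nm /andP[/eqP an a0].
have ax x : x \in a -> x <= n.
  by move=> xa; rewrite -an sumnE (big_rem x) //= leq_addr.
have e1 : [seq sumn s | s <- [seq star e l m [:: x] | x <- a]] = a.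
  rewrite -map_comp -[RHS]map_id; apply/eq_in_map => x xa /=.
  by rewrite sumn_star1 // nm // ax.
have sn : sumn (refine a) = n by rewrite sumn_flatten e1.
split=> //; rewrite /is_composition ?sn ?(perm_sumn (perm_refine a)) ?sn ?eqxx /=.
  by rewrite -(perm_mem (perm_refine a)) notin_star.
by rewrite notin_star.
Qed.

End Compositions.

Section Blocks.
Local Open Scope nat_scope.
Implicit Types (a sh : seq nat) (ss : seq (seq nat)) (i j : nat).

Lemma reshape_index_cons x a i :
  reshape_index (x :: a) i = if i < x then 0 else (reshape_index a (i - x)).+1.
Proof.
rewrite /reshape_index /= subn_eq0; case: ltnP => // xi.
by rewrite subSn.
Qed.

Lemma reshape_index_mono a i j : i <= j -> reshape_index a i <= reshape_index a j.
Proof.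
elim: a i j => [|x a IH] i j ij; first by [].
rewrite !reshape_index_cons; case: (ltnP i x) => // xi.
by rewrite (ltnNge j) (leq_trans xi ij) /= ltnS IH // leq_sub2r.
Qed.

Lemma reshape_index_cat a a' i : reshape_index (a ++ a') i =
  if i < sumn a then reshape_index a i else size a + reshape_index a' (i - sumn a).
Proof.
elim: a i => [|x a IH] i /=; first by rewrite subn0.
rewrite !reshape_index_cons; case: (ltnP i x) => xi; first by rewrite ltn_addr.
by rewrite IH ltn_subLR // subnDA addSn; case: ifP.
Qed.

(** The concatenation of the [ss] refines the composition of their sums. *)
Lemma reshape_index_flatten ss i j :
  reshape_index (flatten ss) j <= reshape_index (flatten ss) i ->
  reshape_index [seq sumn s | s <- ss] j <= reshape_index [seq sumn s | s <- ss] i.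
Proof.
elim: ss i j => [|s ss IH] i j //=.
rewrite !reshape_index_cat !reshape_index_cons.
case: (ltnP j (sumn s)) => sj; case: (ltnP i (sumn s)) => si //.
  by rewrite leqNgt ltn_addr // reshape_indexP.
by rewrite leq_add2l ltnS; apply: IH.
Qed.

Lemma reshape_index_nseq1 k i : i < k -> reshape_index (nseq k 1) i = i.
Proof.
elim: k i => // k IH i ik; rewrite [nseq _ _]/= reshape_index_cons.
by case: i ik => // i ik; rewrite subn1 IH.
Qed.

Variable n : nat.
Hypothesis n_gt0 : 0 < n.

(** The index set has size [n.-1.+1], which is [n] since [n > 0]. *)
Definition blk a : 'I_n.-1.+1 -> nat := fun k => reshape_index a k.

Lemma blk_fun a : block_fun (blk a).
Proof. by move=> i j; apply: reshape_index_mono. Qed.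

(** An index is sent to the one with the same offset in the block matched to its own by the
    rearrangement. *)
Lemma blk_rearrange a a' : is_composition n a -> is_composition n a' -> perm_eq a' a ->
  exists s : 'S_n.-1.+1, block_shift (blk a') s /\
    forall i j : 'I_n.-1.+1, blk a (s i) = blk a (s j) <-> blk a' i = blk a' j.
Proof.
move=> /andP[/eqP an _] /andP[/eqP an' _] /(perm_iotaP 0)[Is IsP a'E].
have i_n (i : 'I_n.-1.+1) : i < n := leq_trans (ltn_ord i) (eq_leq (prednK n_gt0)).
have IsU : uniq Is by rewrite (perm_uniq IsP) iota_uniq.
have sz : size a' = size Is by rewrite a'E size_map.
have r_lt (i : 'I_n.-1.+1) : reshape_index a' i < size Is.
  by rewrite -sz reshape_indexP // an'.
pose r (i : 'I_n.-1.+1) := nth 0 Is (reshape_index a' i).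
have off (i : 'I_n.-1.+1) : reshape_offset a' i < nth 0 a (r i).
  have := @reshape_offsetP a' i; rewrite an' => /(_ (i_n i)).
  by rewrite {2}a'E (nth_map 0).
have f_lt (i : 'I_n.-1.+1) : flatten_index a (r i) (reshape_offset a' i) < n.-1.+1.
  by apply: leq_trans (flatten_indexP (off i)) _; rewrite an prednK.
pose f (i : 'I_n.-1.+1) := Ordinal (f_lt i).
have rf (i : 'I_n.-1.+1) : blk a (f i) = r i by rewrite /blk /= flatten_indexKl.
have rP (i j : 'I_n.-1.+1) : r i = r j <-> blk a' i = blk a' j.
  split=> [e|e]; last by rewrite /r -/(blk a' i) e.
  by apply/eqP; rewrite -(nth_uniq 0 (r_lt i) (r_lt j) IsU); apply/eqP.
have f_inj : injective f.
  move=> i j e; have rij : r i = r j by rewrite -!rf e.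
  apply: val_inj; rewrite /= -(reshape_indexK a' i) -(reshape_indexK a' j).
  have -> : reshape_index a' i = reshape_index a' j by apply/rP.
  have ef := congr1 val e; rewrite /= in ef.
  by rewrite -(flatten_indexKr (off i)) -(flatten_indexKr (off j)) ef.
exists (perm f_inj); split=> [i j ij bij|i j]; rewrite !permE; last by rewrite !rf.
have rij : r j = r i by apply/rP.
rewrite /= rij /flatten_index -addnS; congr (_ + _).
rewrite /reshape_offset -[reshape_index a' j]/(blk a' j) -bij ij subSn //.
by rewrite -[X in _ <= X](reshape_indexK a' i) leq_addr.
Qed.

End Blocks.

(** * Orders of the parabolic subgroups *)

Section Orders.
Variables (F : finFieldType).
Local Notation q := #|F|.
Implicit Types (a : seq nat).

(** The parabolic subgroup as a set of matrices of arbitrary size [k], so that the size may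
    be zero and recursion on the composition is possible. *)
Definition bmx (k : nat) a : {set 'M[F]_k} :=
  [set A | (A \in unitmx) && [forall i : 'I_k, forall j : 'I_k,
     (reshape_index a j < reshape_index a i)%N ==> (A i j == 0)]].

Lemma bmxP k a (A : 'M[F]_k) : reflect (A \in unitmx /\
  forall i j : 'I_k, (reshape_index a j < reshape_index a i)%N -> A i j = 0) (A \in bmx k a).
Proof.
rewrite inE; apply: (iffP andP) => -[uA A0]; split=> //.
  by move=> i j ij; move/forallP: A0 => /(_ i)/forallP/(_ j)/implyP/(_ ij)/eqP.
by apply/forallP => i; apply/forallP => j; apply/implyP => /A0->.
Qed.

Definition unitmx_set (k : nat) : {set 'M[F]_k} := [set A | A \in unitmx].

Lemma card_unitmx_set k : (0 < k)%N ->
  #|unitmx_set k| = (q ^ 'C(k, 2) * \prod_(1 <= i < k.+1) (q ^ i - 1))%N.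
Proof.
move=> k0; rewrite -card_GL //; case: k k0 => // k _.
rewrite cardsT -(card_imset _ (@val_inj _ _ {'GL_k.+1[F]})); apply: eq_card => A.
apply/idP/imsetP => [|[g _ ->]]; last by rewrite inE; apply: (valP g).
by rewrite inE => uA; exists (FinRing.Unit uA : {'GL_k.+1[F]}).
Qed.

(** Such a matrix consists of an invertible corner of size [x], a matrix of the same kind
    for [a] and an arbitrary rectangle above the latter. *)
Lemma card_bmx_cons x m a :
  #|bmx (x + m) (x :: a)| = (#|unitmx_set x| * #|bmx m a| * q ^ (x * m))%N.
Proof.
pose f (t : ('M[F]_x * 'M[F]_m) * 'M[F]_(x, m)) := block_mx t.1.1 t.2 0 t.1.2.
have f_inj : injective f.
  by move=> [[A D] C] [[A' D'] C'] /eq_block_mx[/= -> -> _ ->].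
have -> : bmx (x + m) (x :: a) = f @: setX (setX (unitmx_set x) (bmx m a)) setT.
  apply/setP => M; apply/bmxP/imsetP => [[uM M0]|[[[A D] C]]].
    have dl0 : dlsubmx M = 0.
      apply/matrixP => i j; rewrite !mxE M0 // !reshape_index_cons /= ltn_ord.
      by rewrite (ltnNge _ x) leq_addr.
    have ME : M = f (ulsubmx M, drsubmx M, ursubmx M) by rewrite /f /= -dl0 submxK.
    exists (ulsubmx M, drsubmx M, ursubmx M) => //.
    have := uM; rewrite {1}ME unitmxE det_ublock unitrM => /andP[uA uD].
    rewrite !inE /= andbT unitmxE uA /= unitmxE uD /=.
    apply/forallP => i; apply/forallP => j; apply/implyP => ij.
    rewrite !mxE M0 // !reshape_index_cons /=.
    by rewrite !(ltnNge _ x) !leq_addr /= !addKn ltnS.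
  rewrite !in_setX => /andP[/andP[/=]]; rewrite inE unitmxE => uA /bmxP[uD D0] _ ->.
  rewrite unitmxE det_ublock unitrM uA -unitmxE uD; split=> // i j.
  rewrite -(splitK i) -(splitK j); case: (split i) => i'; case: (split j) => j' /=.
  - by rewrite !reshape_index_cons !ltn_ord.
  - by rewrite !reshape_index_cons !ltn_ord.
  - by rewrite block_mxEdl mxE.
  - rewrite block_mxEdr !reshape_index_cons !(ltnNge _ x) !leq_addr /= !addKn ltnS.
    exact: D0.
by rewrite card_imset // !cardsX cardsT card_mx.
Qed.

Lemma card_bmx a k : k = sumn a -> 0%N \notin a ->
  exists E, #|bmx k a| = (q ^ E * \prod_(x <- a) \prod_(1 <= i < x.+1) (q ^ i - 1))%N.
Proof.
move=> -> {k}; elim: a => [|x a IH] /=.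
  move=> _; exists 0%N; rewrite big_nil.
  have -> : bmx 0 [::] = setT.
    by apply/setP => A; rewrite [RHS]inE; apply/bmxP; split=> [|[]//]; rewrite unitmxE det_mx00 unitr1.
  by rewrite cardsT card_mx.
rewrite inE negb_or => /andP[x0 /IH[E e]].
exists ('C(x, 2) + E + x * sumn a)%N.
rewrite card_bmx_cons e card_unitmx_set ?lt0n 1?eq_sym // big_cons !expnD.
by rewrite -!mulnA; congr (_ * _)%N; rewrite mulnCA; congr (_ * _)%N; rewrite mulnA mulnC.
Qed.

Variable n : nat.
Hypothesis n_gt0 : (0 < n)%N.

Lemma card_spar_blk a : #|spar F (@blk n a)| = #|bmx n.-1.+1 a|.
Proof.
rewrite -(card_imset _ (@val_inj _ _ {'GL_n[F]})); apply: eq_card => A.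
apply/imsetP/bmxP => [[g /sparP gP ->]|[uA A0]]; first by split=> //; apply: (valP g).
have gE : val (@GLof F n A) = A by rewrite GLofK.
by exists (@GLof F n A) => //; apply/sparP => i j ij; rewrite gE A0.
Qed.

Lemma logn_prod_seq (l : nat) (J : eqType) (r : seq J) (f : J -> nat) :
  {in r, forall x, 0 < f x}%N -> logn l (\prod_(x <- r) f x) = (\sum_(x <- r) logn l (f x))%N.
Proof.
move=> f0; suff [] : (0 < \prod_(x <- r) f x)%N /\
  logn l (\prod_(x <- r) f x) = (\sum_(x <- r) logn l (f x))%N by [].
elim: r f0 => [|x r IH] f0; first by rewrite !big_nil logn1.
have [|g0 e] := IH; first by move=> y yr; apply: f0; rewrite inE yr orbT.
have x0 := f0 x (mem_head _ _).
by rewrite !big_cons muln_gt0 x0 g0 lognM // e.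
Qed.

Lemma logn_spar (l : nat) a : prime l -> ~~ (l %| q)%N -> is_composition n a ->
  logn l #|spar F (@blk n a)| = (n * logn l (q - 1) + \sum_(x <- a) val_sum q l x)%N.
Proof.
move=> lp lq /andP[/eqP an a0]; have q1 : (1 < q)%N := card_finNzRing_gt1 F.
have aN : n.-1.+1 = sumn a by rewrite prednK.
have [E e] := card_bmx aN a0; rewrite card_spar_blk e.
have qX k : (0 < q ^ k)%N by rewrite expn_gt0 ltnW.
have q10 : (0 < q - 1)%N by rewrite subn_gt0.
have gE i : (q ^ i - 1 = (q - 1) * gsum q i)%N by rewrite !subn1 predn_exp.
have g0 i : (0 < i)%N -> (0 < q ^ i - 1)%N.
  by move=> i0; rewrite gE muln_gt0 q10 gsum_gt0.
have fE x : logn l (\prod_(1 <= i < x.+1) (q ^ i - 1)) = (x * logn l (q - 1) + val_sum q l x)%N.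
  rewrite logn_prod_seq => [|i]; last by rewrite mem_index_iota => /andP[/g0].
  rewrite (eq_big_nat _ _ (F2 := fun i => logn l (q - 1) + logn l (gsum q i))%N).
    by rewrite big_split /= sum_nat_const_nat subSS subn0.
  by move=> i /andP[i0 _]; rewrite gE lognM ?gsum_gt0.
have f0 x : (0 < \prod_(1 <= i < x.+1) (q ^ i - 1))%N.
  rewrite big_seq; apply: prodn_cond_gt0 => i.
  by rewrite mem_index_iota => /andP[/g0].
rewrite lognM //; last by apply: prodn_gt0.
rewrite lognX (logn_ndvd lq) muln0 add0n logn_prod_seq //.
under eq_bigr => x _ do rewrite fE.
by rewrite big_split -big_distrl /= -sumnE an.
Qed.

End Orders.

(** * Scalars and orders prime to l *)

Section LocalRing.
Variables (R : idomainType) (l : nat).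
Hypothesis R_local : local_with_maximal R l.
Local Notation ldvd := (@ldvd R l).

Lemma ldvd_maximal : maximal_ideal (fun a : R => ldvd a).
Proof. by apply/R_local => a. Qed.

(** The ideal generated by [a] and [l] contains the maximal ideal strictly. *)
Lemma ldvd_inv (a : R) : ~ ldvd a -> exists y z, y * a = 1 + l%:R * z.
Proof.
move=> la; have [_ _ mx] := ldvd_maximal.
pose J x := exists y z, x = y * a + l%:R * z.
have [||ldJ|[y [z e]]] := mx J.
- split=> [|x x' [y [z ->]] [y' [z' ->]]|c x [y [z ->]]].
  + by exists 0, 0; rewrite mul0r mulr0 addr0.
  + by exists (y + y'), (z + z'); rewrite mulrDl mulrDr addrACA.
  + by exists (c * y), (c * z); rewrite mulrDr mulrA mulrCA.
- by move=> _ [z ->]; exists 0, z; rewrite mul0r add0r.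
- by case: la; apply: ldJ; exists 1, 0; rewrite mul1r mulr0 addr0.
by exists y, (- z); rewrite mulrN [X in X - _]e addrK.
Qed.

Lemma ldvd_one : ~ ldvd 1.
Proof. by case: ldvd_maximal. Qed.

Lemma ldvd_prime (a c : R) : ldvd (a * c) -> ldvd a \/ ldvd c.
Proof.
move=> [d e]; case: (pselect (ldvd a)) => [|la]; [by left | right].
have [y [z ey]] := ldvd_inv la.
exists (y * d - z * c); rewrite mulrBr mulrCA -e mulrA ey mulrDl mul1r mulrA.
by rewrite addrK.
Qed.

End LocalRing.

Section PrimeToL.
Variables (F : finFieldType) (n p l : nat).
Hypotheses (pF : p \in [pchar F]) (l_prime : prime l) (lp : l <> p).
Local Notation U := (prad F (@nat_of_ord n.-1.+1)).

Lemma l_neq0 : l%:R != 0 :> F.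
Proof.
apply/negP => l0; have : l \in [pchar F] by rewrite inE l_prime l0.
by rewrite (pcharf_eq pF) inE => /eqP/lp.
Qed.

(** An element of order [l] of the additive group would be killed by [l], which is not zero
    in the field. *)
Lemma l_ndvd_card : ~~ (l %| #|F|)%N.
Proof.
apply/negP; rewrite -cardsT => /(Cauchy l_prime)[x _ xl].
have := expg_order x; rewrite xl FinRing.zmodXgE -mulr_natl => /eqP.
rewrite mulf_eq0 (negPf l_neq0) /= => /eqP x0.
by move: xl l_prime; rewrite x0 -[0]/(1%g : F) order1 => <-.
Qed.

(** On the first non-zero superdiagonal of [u] the entries of [u ^+ k] are [k] times those
    of [u], so that [u ^+ l] is the identity only when [u] is. *)
Lemma l_ndvd_U : ~~ (l %| #|U|)%N.
Proof.
apply/negP => /(Cauchy l_prime)[u uU ul].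
have ul1 : (u ^+ l)%g = 1%g by rewrite -ul expg_order.
suff u1 : u = 1%g by move: ul l_prime; rewrite u1 order1 => <-.
have key (d : nat) : forall i j : 'I_n.-1.+1, (j <= i + d)%N -> val u i j = (i == j)%:R.
  elim: d => [|d IH] i j; first by rewrite addn0; move/pradP: uU => uU; apply: uU.
  rewrite leq_eqVlt addnS ltnS => /predU1P[jid|]; last exact: IH.
  have ij : (i < j)%N by rewrite jid ltnS leq_addr.
  have nij : (i == j) = false by apply/negbTE; rewrite -(inj_eq val_inj) neq_ltn ij.
  have pw k : (u ^+ k)%g \in U /\ val (u ^+ k)%g i j = k%:R * val u i j.
    elim: k => [|k [kU kE]]; first by rewrite expg0 group1 GL_oneE nij mul0r.
    rewrite expgS; split; first by rewrite groupM.
    rewrite GL_mulE (bigD1 i) //= (bigD1 j) 1?eq_sym ?nij //= big1 => [|m /andP[mi mj]].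
      rewrite (pradP _ _ uU i i (leqnn _)) (pradP _ _ kU j j (leqnn _)).
      by rewrite kE !eqxx mul1r mulr1 addr0 -natr1 mulrDl mul1r.
    have [mi'|im] := leqP m i.
      by rewrite (pradP _ _ uU i m mi') eq_sym (negPf mi) mul0r.
    have [jm|mj'] := leqP j m.
      by rewrite (pradP _ _ kU m j jm) (negPf mj) mulr0.
    by rewrite IH 1?eq_sym ?(negPf mi) ?mul0r //; lia.
  have [_] := pw l; rewrite ul1 GL_oneE nij => /esym/eqP.
  by rewrite mulf_eq0 (negPf l_neq0) => /eqP.
by apply: GL_eqP => i j; rewrite GL_oneE (key j) // leq_addl.
Qed.

End PrimeToL.

(** * Submodules generated by eigenvectors *)

Section Statement.
Import generic_quotient.
Local Open Scope quotient_scope.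
Variables (F : finFieldType) (n : nat) (R : idomainType) (l : nat).
Local Notation gT := (GLT F n).
Local Notation K := (residue R l).

Lemma steinberg_E_val (lam : {'GL_n[F]} -> R) : val (steinberg_E lam) = @Evec F n R lam.
Proof.
rewrite /steinberg_E raddf_sum EvecE; apply: eq_big => [u|u _]; first by rewrite unitri_prad.
transitivity ((lam u *: gel R (u : gT)) * steps F n R); last by rewrite -galg_scalerAl.
by rewrite gelE -steinberg_genE.
Qed.

Lemma scale_lat (r : galg R gT) (x : steinberg F n R) :
  galg_red l r *: \pi_(lat_mod F n R l) x = \pi_(lat_mod F n R l) (r *: x).
Proof. exact: resmod_pi_scale. Qed.

Hypothesis R_local : local_with_maximal R l.

(** Modulo [l] the scalar of [reach] is invertible. *)
Lemma reach_steinberg_F (lam mu : {'GL_n[F]} -> R) : @reach F n R l lam mu ->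
  exists k : galg K gT, k *: steinberg_F l lam = steinberg_F l mu.
Proof.
move=> [h [r [lr e]]]; have [y [z ey]] := ldvd_inv R_local lr.
exists (galg_red l (y *: h)); rewrite /steinberg_F scale_lat.
apply/resmod_eqP; exists ((z *: (1 : galg R {'GL_n[F]}) : galg R {'GL_n[F]}) *: steinberg_E mu).
apply: val_inj.
transitivity ((y *: h) * val (steinberg_E lam) - val (steinberg_E mu)); first by [].
transitivity (((z *: (1 : galg R gT)) * val (steinberg_E mu)) *+ l); last by rewrite raddfMn.
rewrite !steinberg_E_val -!galg_scalerAl e mul1r scalerA ey scalerDl scale1r addrAC subrr add0r.
by rewrite mulr_natl scalerMnl.
Qed.

Lemma N_sub_le c (lam mu : {'GL_n[F]} -> R) : @reach F n R l lam mu ->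
  forall x, x \in N_sub l c mu -> x \in N_sub l c lam.
Proof.
move=> /reach_steinberg_F[k ek] x /asboolP[r ->]; apply/asboolP.
exists (r * k); rewrite -ek -scalerA; congr (_ *: _).
exact/esym/quotmod_pi_scale.
Qed.

Lemma N_sub_eq c (lam mu : {'GL_n[F]} -> R) :
  @reach F n R l lam mu -> @reach F n R l mu lam -> N_sub l c lam =i N_sub l c mu.
Proof. by move=> lm ml x; apply/idP/idP; apply: N_sub_le. Qed.

End Statement.

(** * Characters and indices of parabolic subgroups *)

Section CharParab.
Variables (F : finFieldType) (n : nat) (R : idomainType).

(** If [lam] is trivial on the simple root subgroup of [(i, j)], the generators of its
    parabolic subgroup all lie in the maximal one with blocks separated after [i], which does
    not contain the transposition of [i] and [j]. *)
Lemma char_parab_generic (lam : {'GL_n[F]} -> R) a : unitri_char lam ->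
  char_parab lam = parab F n a :> {set _} -> generic lam (@blk n a).
Proof.
move=> [lu lM] Pa.
have UE : unitri F n = prad F (@nat_of_ord n.-1.+1) := unitri_prad F n.
have lc : @Uchar F n R lam.
  split=> [u uU|u v uU vU]; first by apply: lu; rewrite UE.
  by apply: lM; rewrite UE.
split=> // i j ij; have lt : (i < j)%N by rewrite ij.
have nij : i != j := simple_neq ij.
split=> [[x lx]|bij].
  have sP : pmat F (tperm i j) \in spar F (@blk n a).
    rewrite -[spar _ _]/(parab F n a) -Pa; apply: mem_gen; rewrite inE; apply/orP; right.
    apply/imsetP; exists (i, j) => //; rewrite inE /= ij eqxx /=.
    apply/existsP; exists (xroot i j x); rewrite lx andbT inE.
    by apply/existsP; exists x; rewrite xroot_val.
  by have := spar_perm sP i; rewrite tpermL.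
apply: contrapT => nex.
pose c (k : 'I_n.-1.+1) : nat := (i < k)%N.
have cm : block_fun c.
  move=> k k' kk'; rewrite /c; case: (ltnP i k) => // ik.
  by rewrite (leq_trans ik kk').
have sP : permGL F (tperm i j) \in parab F n a.
  apply: (subsetP (levi_sub F (@blk n a))); apply: (pmat_spar F) => k.
  by case: tpermP => // ->; rewrite bij.
have sub : (char_parab lam \subset spar F c).
  rewrite gen_subG subUset (sparS F (block_fun_coarser cm)) /=.
  apply/subsetP => _ /imsetP[[i' j'] /= hij ->].
  move: hij; rewrite inE /= => /andP[/eqP ij' /existsP[x /andP[xr lx]]].
  apply: (subsetP (levi_sub F c)); apply: (pmat_spar F) => k.
  suff cij : c i' = c j' by case: tpermP => // ->; rewrite cij.
  rewrite /c ij' ltnS; case: (ltngtP i i') => // e; case: nex.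
  have ei : i' = i by apply: val_inj.
  have ej : j' = j by apply: val_inj; rewrite /= ij' ij e.
  move: xr; rewrite inE ei ej => /existsP[y /eqP xE]; exists y.
  have -> : xroot i j y = x by apply: val_inj; rewrite /= xroot_val.
  by [].
have : pmat F (tperm i j) \in spar F c by apply: (subsetP sub); rewrite Pa.
by move/spar_perm/(_ i); rewrite tpermL /c ltnn lt.
Qed.

End CharParab.

Section Indices.
Variables (F : finFieldType) (n p l : nat).
Hypotheses (pF : p \in [pchar F]) (l_prime : prime l) (lp : l <> p) (n_gt0 : (0 < n)%N).
Local Notation q := #|F|.

Lemma spar_nseq1 : spar F (@blk n (nseq n 1%N)) = spar F (@nat_of_ord n.-1.+1).
Proof.
suff -> : @blk n (nseq n 1%N) = @nat_of_ord n.-1.+1 by [].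
apply: funext => i; rewrite /blk reshape_index_nseq1 //.
by apply: leq_trans (ltn_ord i) _; rewrite prednK.
Qed.

Lemma logn_borel_index a : is_composition n a ->
  logn l #|spar F (@blk n a) : spar F (@nat_of_ord n.-1.+1)|%g = (\sum_(x <- a) val_sum q l x)%N.
Proof.
move=> na; have lq := l_ndvd_card pF l_prime lp.
have BP : spar F (@nat_of_ord n.-1.+1) \subset spar F (@blk n a).
  exact: sparS (block_fun_coarser (@blk_fun n a)).
have n1 : is_composition n (nseq n 1%N).
  by rewrite /is_composition sumn_nseq mul1n eqxx mem_nseq andbF.
have := logn_spar n_gt0 l_prime lq na.
rewrite -(Lagrange BP) lognM ?cardG_gt0 ?indexg_gt0 //.
have := logn_spar n_gt0 l_prime lq n1; rewrite spar_nseq1 => -> /=.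
rewrite -addnA => /addnI.
by rewrite big_nseq val_sum1 iter_addn_0 mul0n add0n.
Qed.

End Indices.

Theorem theorem4p3 (F : finFieldType) (p n l e : nat) (R : idomainType) (a : seq nat)
  (hp : p \in [pchar F]) (hn : (2 <= n)%N) (hl : prime l) (hlp : l <> p)
  (hPID : principal_ideal_ring R) (hloc : local_with_maximal R l)
  (hR0 : [pchar R] =i pred0) (hRp : exists z : R, p.-primitive_root z)
  (he : is_least (fun i => (2 <= i)%N /\ (l %| qnum #|F| i)%N) e)
  (ha : is_composition n a) :
  let d := logn l (qnum #|F| e) in
  let m := trunc_log l (n %/ e)%N in
  let z := Delta_seq e l m a in
  let G := [set: {'GL_n[F]}] in
  let B := borel F n in
  let P := parab F n a in
  let Pstar := parab F n (star e l m a) in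
  [/\ is_composition n (star e l m a),
      exists Q : {group {'GL_n[F]}},
        [/\ standard_parabolic Q, Q \subset P & par_equiv Pstar Q],
      logn l #|P : B|%g = (\sum_(i < m.+1) s_seq l d i * z.2 i)%N,
      (\sum_(i < m.+1) s_seq l d i * z.2 i)%N = logn l #|Pstar : B|%g
    & let c := logn l #|G : P|%g in
      logn l #|G : Pstar|%g = c /\
      forall lam mu : {'GL_n[F]} -> R,
        unitri_char lam -> unitri_char mu ->
        char_parab lam = P :> {set _} -> char_parab mu = Pstar :> {set _} ->
        N_sub l c lam =i N_sub l c mu].
Proof.
move=> d m z G B P Pstar.
have n0 : (0 < n)%N := ltnW hn.
have q1 : (1 < #|F|)%N := card_finNzRing_gt1 F.
have lq := l_ndvd_card hp hl hlp.
have e0 : (0 < e)%N := ltnW (e_gt1 he).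
have l0 := prime_gt0 hl.
have xm x : (x <= n)%N -> (x %/ e < l ^ m.+1)%N.
  move=> xn; apply: leq_ltn_trans (leq_div2r e xn) _.
  exact: trunc_log_ltn (prime_gt1 hl).
have [rn sn ra] := refine_composition e0 l0 xm ha.
have ax x : x \in a -> (x <= n)%N.
  by case/andP: ha => /eqP <- _ xa; rewrite sumnE (big_rem x) //= leq_addr.
have vE x : x \in a -> val_sum #|F| l x =
    (\sum_(i < m.+1) s_seq l d i * (Delta e l m x).2 i)%N.
  by move=> /ax xn; apply: val_sum_digits => //; apply: xm.
have sumz : (\sum_(i < m.+1) s_seq l d i * z.2 i = \sum_(x <- a) val_sum #|F| l x)%N.
  rewrite [RHS](eq_big_seq _ vE) exchange_big; apply: eq_bigr => i _ /=.
  by have [_ ->] := Delta_seqE e l m a; rewrite big_distrr.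
have sums : (\sum_(x <- star e l m a) val_sum #|F| l x = \sum_(x <- a) val_sum #|F| l x)%N.
  rewrite sum_star; apply: eq_big_seq => x xa; rewrite (vE x xa) val_sum1 mul0n add0n.
  by apply: eq_bigr => i _; rewrite val_sum_pow.
have sumr : (\sum_(x <- refine e l m a) val_sum #|F| l x = \sum_(x <- a) val_sum #|F| l x)%N.
  by rewrite -sums; apply/esym/perm_big/perm_refine.
have lP := logn_borel_index hp hl hlp n0 ha.
have lS := logn_borel_index hp hl hlp n0 sn.
have logE b : is_composition n b ->
    (\sum_(x <- b) val_sum #|F| l x = \sum_(x <- a) val_sum #|F| l x)%N ->
    logn l #|spar F (@blk n b)| = logn l #|spar F (@blk n a)|.
  by move=> nb e'; rewrite !logn_spar // e'.
have coars : coarser (@blk n a) (@blk n (refine e l m a)).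
  by move=> i j /reshape_index_flatten; rewrite ra.
split.
- exact: sn.
- exists (parab_group F n (refine e l m a)); split.
  + exact: sparS (block_fun_coarser (@blk_fun n _)).
  + exact: sparS coars.
  + by exists (star e l m a), (refine e l m a); split=> //; apply: perm_refine.
- by rewrite sumz -lP.
- by rewrite sumz -sums -lS.
move=> c; split.
  have idx (b : seq nat) : logn l #|G : spar F (@blk n b)|%g =
      (logn l #|G| - logn l #|spar F (@blk n b)|)%N.
    rewrite -(Lagrange (subsetT (spar F (@blk n b)))) lognM ?cardG_gt0 ?indexg_gt0 //.
    by rewrite addKn.
  by rewrite /c -[Pstar]/(spar F (@blk n _)) -[P]/(spar F (@blk n _)) !idx logE.
move=> lam mu lc mc lamP muP.
have gl := char_parab_generic lc lamP; have gm := char_parab_generic mc muP.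
have natR k : (k.+1)%:R != 0 :> R by rewrite (GRing.pcharf0P R).1.
have ld1 := ldvd_one hloc; have ldM := ldvd_prime hloc.
have lU := l_ndvd_U n hp hl hlp.
have lPQ : ~~ (l %| #|spar F (@blk n a) : spar F (@blk n (refine e l m a))|%g)%N.
  have := logE _ rn sumr; rewrite -(Lagrange (sparS F coars)) lognM ?cardG_gt0 ?indexg_gt0 //.
  rewrite -[LHS]addn0 => /addnI/esym l0'; apply/negP => ldv.
  have : (0 < logn l #|spar F (@blk n a) : spar F (@blk n (refine e l m a))|%g)%N.
    by rewrite -pfactor_dvdn ?expn1 ?indexg_gt0.
  by rewrite l0'.
have [nu1 [g1 r1 r1']] := descent natR hl ld1 ldM lU (@blk_fun n _) (@blk_fun n _) coars lPQ gl.
have [s [sh sb]] := blk_rearrange n0 rn sn (perm_refine e l m a).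
have [nu2 [g2 r2 r2']] := rearrangement natR hl ld1 ldM lU (@blk_fun n _) (@blk_fun n _) sh sb g1.
have one_reach nu nu' : generic nu (@blk n (star e l m a)) -> generic nu' (@blk n (star e l m a)) ->
    @reach F n R l nu nu'.
  move=> gn gn'; have [g eg] := generic_torus natR gn gn'.
  by exists (gel R g), 1; split=> //; rewrite scale1r.
apply: N_sub_eq => //.
  by apply: (reach_trans ldM r1); apply: (reach_trans ldM r2); apply: one_reach.
by apply: (reach_trans ldM (one_reach _ _ gm g2)); apply: (reach_trans ldM r2').
Qed.
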